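(* Let $(\mathbb{X},\mathcal{X})$ be a measurable space. Suppose that $Z=(Z_n)_{n\ge1}$ is a random sequence of $(0,1)$-valued random variables with $\sum_{n=1}^\infty Z_n=1$ and that $X=(X_n)_{n\ge1}$ is a sequence of random elements of $\mathbb{X}$. Let $\kappa$ be a random element of $\mathbb{N}$ satisfying $$\mathbb{P}(\kappa=i\mid Z,X)=Z_i\quad \mathbb{P}\text{-a.s.},\ i\in\mathbb{N}.$$ Assume that $(Z^{(\kappa)},X^{\kappa})\overset{d}{=}(Z,X)$ and that $(Z^{(\kappa)},X^{\kappa})$, $Z_\kappa$ and $X_\kappa$ are independent. Then $Z_\kappa$ has the $\mathrm{Beta}(1,\alpha)$ distribution, where $\alpha:=(1-\mathbb{E}Z_\kappa)/\mathbb{E}Z_\kappa$. Moreover, $\sum_{n=1}^\infty Z_n\delta_{X_n}$ is a Dirichlet process with parameter measure $\alpha\nu'$, where $\nu':=\mathbb{P}(X_\kappa\in\cdot)$. If $\mathbb{X}$ is a Borel space, then $\sum_{n=1}^\infty\delta_{Z_n}$ has the Poisson-Dirichlet distribution with parameter $\alpha$.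
   Context: If $x=(x_n)_{n\ge1}$ is a sequence in some space and $i\in\mathbb{N}$, then $x^i=(x^i_n)_{n\ge1}$ denotes the sequence arising from $x$ by dropping the $i$-th member: $x^i_n:=x_n$ for $n<i$ and $x^i_n:=x_{n+1}$ for $n\ge i$. If $x$ is real-valued, $x^{(i)}:=(1-x_i)^{-1}x^i$, where $a/0:=0$ for each $a\in\mathbb{R}$. Thus $Z^{(\kappa)}$ and $X^\kappa$ are these operations applied with the random index $i=\kappa$. $\overset{d}{=}$ denotes equality in distribution and $\delta_x$ is the Dirac measure at $x$. For $\alpha,\beta>0$, $\mathrm{Beta}(\alpha,\beta)$ is the probability measure on $[0,1]$ with Lebesgue density $x\mapsto B(\alpha,\beta)^{-1}x^{\alpha-1}(1-x)^{\beta-1}$, where $B(\alpha,\beta)=\Gamma(\alpha)\Gamma(\beta)/\Gamma(\alpha+\beta)$. $\mathbf{M}$ denotes the space of all $s$-finite measures (countable sums of finite measures) on $(\mathbb{X},\mathcal{X})$, equipped with the smallest $\sigma$-field making the mappings $\mu\mapsto\mu(B)$ measurable for each $B\in\mathcal{X}$. A random measure on $\mathbb{X}$ is a random element of $\mathbf{M}$ defined on a probability space $(\Omega,\mathcal{F},\mathbb{P})$. Dirichlet distribution: for $n\ge 1$ and $\alpha_1,\dots,\alpha_n\in[0,\infty)$ with $\alpha_1+\cdots+\alpha_n>0$, $\mathrm{Dir}(\alpha_1,\dots,\alpha_n)$ is the probability measure on $\Delta_n:=\{(p_1,\dots,p_n)\in[0,1]^n:p_1+\dots+p_n=1\}$ defined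 as follows. If $n\ge 2$ and all $\alpha_i>0$, it has density $(x_1,\dots,x_n)\mapsto \frac{\Gamma(\alpha_1+\dots+\alpha_n)}{\Gamma(\alpha_1)\cdots\Gamma(\alpha_n)}x_1^{\alpha_1-1}\cdots x_n^{\alpha_n-1}$ with respect to Lebesgue measure on $\Delta_n$ (parametrized by the first $n-1$ coordinates). If $n=1$, $\mathrm{Dir}(\alpha_1):=\delta_1$. If $n\ge2$ and some of the $\alpha_i$ vanish, the corresponding coordinates are equal to $0$ and the remaining coordinates have the Dirichlet distribution with the remaining (positive) parameters. For a measure $\rho$ on $\mathbb{X}$ with $0<\rho(\mathbb{X})<\infty$, a random measure $\zeta$ on $\mathbb{X}$ is called a Dirichlet process with parameter measure $\rho$ if $(\zeta(B_1),\ldots,\zeta(B_n))$ has distribution $\mathrm{Dir}(\rho(B_1),\ldots,\rho(B_n))$ whenever $B_1,\ldots,B_n$, $n\ge1$, form a measurable partition of $\mathbb{X}$. Poisson-Dirichlet distribution: let $\alpha>0$, let $\sum_{n=1}^\infty\delta_{T_n}$ be a Poisson process on $(0,\infty)$ with intensity measure $\alpha r^{-1}e^{-r}\,dr$ and let $S:=\sum_{n=1}^\infty T_n$ (almost surely finite and positive). A random measure (point process) on $(0,1)$ is said to have the Poisson-Dirichlet distribution with parameter $\alpha$ if it has the same distribution as $\sum_{n=1}^\infty\delta_{T_n/S}$. *)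

(* Defs.v *)
From HB Require Import structures.
From mathcomp Require Import all_boot all_order all_algebra.
From mathcomp Require Import all_classical all_reals all_analysis.
From mathcomp Require Import measurable_realfun.

Set Implicit Arguments.
Unset Strict Implicit.
Unset Printing Implicit Defensive.

Import Order.TTheory GRing.Theory Num.Theory.
Import numFieldNormedType.Exports.

Local Open Scope classical_set_scope.
Local Open Scope ring_scope.

Definition mseq (T : Type) : Type := nat -> T.

Definition mseq_display : measure_display -> measure_display.
Proof. by []. Qed.

Section mseq_measurable.
Context d (T : measurableType d).

HB.instance Definition _ := gen_eqMixin (mseq T).
HB.instance Definition _ := gen_choiceMixin (mseq T).
HB.instance Definition _ := isPointed.Build (mseq T) (fun=> point).

Definition mseq_measurable : set (set (mseq T)) :=
  <<s \bigcup_n preimage_set_system setT (fun x : mseq T => x n) measurable >>.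

Let mseq_measurable0 : mseq_measurable set0.
Proof. exact: sigma_algebra0. Qed.

Let mseq_measurableC (A : set (mseq T)) :
  mseq_measurable A -> mseq_measurable (~` A).
Proof. exact: sigma_algebraC. Qed.

Let mseq_measurableU (F : (set (mseq T))^nat) :
  (forall i, mseq_measurable (F i)) -> mseq_measurable (\bigcup_i F i).
Proof. exact: sigma_algebra_bigcup. Qed.

HB.instance Definition _ := @isMeasurable.Build (mseq_display d) (mseq T)
  mseq_measurable mseq_measurable0 mseq_measurableC mseq_measurableU.

Lemma measurable_coord n : measurable_fun setT (fun x : mseq T => x n).
Proof.
move=> _ A mA; rewrite setTI; apply: sub_sigma_algebra.
by exists n => //; exists A => //; rewrite setTI.
Qed.

Lemma measurable_mseqP d' (S : measurableType d') (f : S -> mseq T) :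
  (forall n, measurable_fun setT (fun w => f w n)) -> measurable_fun setT f.
Proof.
move=> mf.
apply: (@measurability _ _ _ _ setT f
  (\bigcup_n preimage_set_system setT (fun x : mseq T => x n) measurable)) => //.
move=> _ [_ [n _ [A mA <-]] <-]; rewrite !setTI.
by have := mf n measurableT A mA; rewrite setTI.
Qed.

End mseq_measurable.

(* Sequences are indexed from 0. *)
Definition drop_at (T : Type) (i : nat) (x : mseq T) : mseq T :=
  fun n => if (n < i)%N then x n else x n.+1.

(* [_^-1] maps 0 to 0, so this is 0 when [x i = 1]. *)
Definition sdrop_at (R : realType) (i : nat) (x : mseq R) : mseq R :=
  fun n => (1 - x i)^-1 * drop_at i x n.

Section random_index.
Context d dO (Omega : measurableType dO) (T : measurableType d).
Variable k : {mfun Omega >-> nat}.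

Lemma measurable_random_index (f : nat -> Omega -> T) :
  (forall i, measurable_fun setT (f i)) ->
  measurable_fun setT (fun w => f (k w) w).
Proof.
move=> mf _ A mA; rewrite setTI.
have -> : (fun w => f (k w) w) @^-1` A =
    \bigcup_i (k @^-1` [set i] `&` f i @^-1` A).
  apply/seteqP; split => [w /= fA|w [i _ [/= <-]]//].
  by exists (k w).
apply: bigcup_measurable => i _; apply: measurableI.
  exact: measurable_funPTI.
by have := mf i measurableT A mA; rewrite setTI.
Qed.

Definition at_index (Y : {mfun Omega >-> mseq T}) : Omega -> T :=
  fun w => Y w (k w).

Lemma measurable_at_index (Y : {mfun Omega >-> mseq T}) :
  measurable_fun setT (at_index Y).
Proof.
apply: (measurable_random_index (f := fun i w => Y w i)) => i.
exact: measurableT_comp (measurable_coord i) (measurable_funPT Y).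
Qed.

HB.instance Definition _ (Y : {mfun Omega >-> mseq T}) :=
  isMeasurableFun.Build _ _ _ _ (at_index Y) (measurable_at_index Y).

End random_index.

Section random_sequences.
Context (R : realType) d dO (Omega : measurableType dO) (T : measurableType d).
Variables (Z : {mfun Omega >-> mseq R}) (X : {mfun Omega >-> mseq T}).
Variable k : {mfun Omega >-> nat}.

Definition joint_seq : Omega -> mseq R * mseq T := fun w => (Z w, X w).

Definition reduced_seq : Omega -> mseq R * mseq T :=
  fun w => (sdrop_at (k w) (Z w), drop_at (k w) (X w)).

Lemma measurable_joint_seq : measurable_fun setT joint_seq.
Proof. by apply: measurable_fun_pair; exact: measurable_funPT. Qed.

Lemma measurable_reduced_seq : measurable_fun setT reduced_seq.
Proof.
have mc d' (S : measurableType d') (Y : {mfun Omega >-> mseq S}) i :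
    measurable_fun setT (fun w => Y w i).
  exact: measurableT_comp (measurable_coord i) (measurable_funPT Y).
have md d' (S : measurableType d') (Y : {mfun Omega >-> mseq S}) i n :
    measurable_fun setT (fun w => drop_at i (Y w) n).
  by rewrite /drop_at; case: (n < i)%N; exact: mc.
apply: (@measurable_fun_pair _ _ _ _ _ _ (fun w => sdrop_at (k w) (Z w))
  (fun w => drop_at (k w) (X w))); apply: measurable_mseqP => n; last first.
  by apply: (@measurable_random_index _ _ _ _ k (fun i w => drop_at i (X w) n)).
apply: (@measurable_random_index _ _ _ _ k (fun i w => sdrop_at i (Z w) n)) => i.
apply: measurable_funM; last exact: md.
have -> : (fun w => (1 - Z w i)^-1) =
    (fun w => (1 - Z w i) * ((1 - Z w i) ^+ 2) `^ (-1)).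
  apply/funext => w; rewrite powR_inv1 ?sqr_ge0// expr2 invfM mulrA.
  by have [->|nz] := eqVneq (1 - Z w i) 0; rewrite ?invr0 ?mulr0// divff// mul1r.
have m1 : measurable_fun setT (fun w => 1 - Z w i).
  by apply: measurable_funB; [exact: measurable_cst|exact: mc].
apply: measurable_funM => //.
apply: (measurableT_comp (measurable_powR _)).
exact: measurable_funX.
Qed.

HB.instance Definition _ :=
  isMeasurableFun.Build _ _ _ _ joint_seq measurable_joint_seq.
HB.instance Definition _ :=
  isMeasurableFun.Build _ _ _ _ reduced_seq measurable_reduced_seq.

End random_sequences.

Definition smeasure d (T : measurableType d) (R : realType) : Type :=
  {sfinite_measure set T -> \bar R}.

Definition smeasure_display : measure_display.
Proof. by constructor. Qed.

Section smeasure.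
Context d (T : measurableType d) (R : realType).

HB.instance Definition _ := gen_eqMixin (smeasure T R).
HB.instance Definition _ := gen_choiceMixin (smeasure T R).
HB.instance Definition _ :=
  isPointed.Build (smeasure T R) (mzero : {sfinite_measure set T -> \bar R}).

Definition smeasure_ev (A : set T) (mu : smeasure T R) : \bar R := mu A.

Definition smeasure_measurable : set (set (smeasure T R)) :=
  <<s \bigcup_(A in measurable)
        preimage_set_system setT (smeasure_ev A) measurable >>.

Let smeasure_measurable0 : smeasure_measurable set0.
Proof. exact: sigma_algebra0. Qed.

Let smeasure_measurableC (A : set (smeasure T R)) :
  smeasure_measurable A -> smeasure_measurable (~` A).
Proof. exact: sigma_algebraC. Qed.

Let smeasure_measurableU (F : (set (smeasure T R))^nat) :
  (forall i, smeasure_measurable (F i)) -> smeasure_measurable (\bigcup_i F i).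
Proof. exact: sigma_algebra_bigcup. Qed.

HB.instance Definition _ :=
  @isMeasurable.Build smeasure_display (smeasure T R) smeasure_measurable
    smeasure_measurable0 smeasure_measurableC smeasure_measurableU.

End smeasure.


Section sums_of_diracs.
Context d (T : measurableType d) (R : realType).

Section weighted.
Variables (z : nat -> {nonneg R}) (x : nat -> T).

Definition weighted_diracs : set T -> \bar R :=
  mseries (fun n => mscale (z n) \d_(x n)) 0.

HB.instance Definition _ := Measure.on weighted_diracs.

Let weighted_diracs_sfinite : sfinite_measure weighted_diracs.
Proof. by exists (fun n => mscale (z n) \d_(x n)). Qed.

HB.instance Definition _ :=
  isSFinite.Build _ _ _ weighted_diracs weighted_diracs_sfinite.

End weighted.

Section unweighted.
Variable x : nat -> T.

Definition sum_diracs : set T -> \bar R := mseries (fun n => \d_(x n)) 0.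

HB.instance Definition _ := Measure.on sum_diracs.

Let sum_diracs_sfinite : sfinite_measure sum_diracs.
Proof. by exists (fun n => \d_(x n)). Qed.

HB.instance Definition _ :=
  isSFinite.Build _ _ _ sum_diracs sum_diracs_sfinite.

End unweighted.

End sums_of_diracs.
Arguments sum_diracs {d T R} x.

Section probability_notions.
Context (R : realType) d (Omega : measurableType d) (P : probability Omega R).
Local Open Scope ereal_scope.

(* [g] is a version of the conditional probability of [A] given the
   sub-sigma-algebra [G]. *)
Definition is_cond_prob (G : set (set Omega)) (A : set Omega)
    (g : Omega -> R) : Prop :=
  [/\ forall B : set R, measurable B -> G (g @^-1` B),
      P.-integrable setT (EFin \o g) &
      forall C, G C -> \int[P]_(w in C) (g w)%:E = P (A `&` C)].

Definition independent3 d1 d2 d3 (T1 : measurableType d1)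
    (T2 : measurableType d2) (T3 : measurableType d3)
    (U : Omega -> T1) (V : Omega -> T2) (W : Omega -> T3) : Prop :=
  forall A B C, measurable A -> measurable B -> measurable C ->
    P (U @^-1` A `&` V @^-1` B `&` W @^-1` C) =
    P (U @^-1` A) * P (V @^-1` B) * P (W @^-1` C).

Definition independent_family d1 (T : measurableType d1) n
    (U : 'I_n -> Omega -> T) : Prop :=
  forall A : 'I_n -> set T, (forall i, measurable (A i)) ->
    P (\bigcap_i (U i @^-1` A i)) = \prod_(i < n) P (U i @^-1` A i).

End probability_notions.

Section beta_gamma.
Variable R : realType.

Definition Gamma (a : R) : R :=
  \int[lebesgue_measure]_(t in `]0, +oo[) (t `^ (a - 1) * expR (- t)).

Definition Beta (a b : R) : R := Gamma a * Gamma b / Gamma (a + b).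

(* The library's [beta_prob] only allows natural parameters. *)
Definition beta_law (a b : R) (A : set R) : \bar R :=
  (\int[lebesgue_measure]_(x in A `&` `[0%R, 1%R])
     ((Beta a b)^-1 * x `^ (a - 1) * (1 - x) `^ (b - 1))%:E)%E.

End beta_gamma.

Section dirichlet.
Variable R : realType.
Local Open Scope ereal_scope.

Fixpoint lebesgue_tuple (n : nat) : set (n.-tuple R) -> \bar R :=
  match n with
  | 0 => \d_[tuple]
  | m.+1 => pushforward ((@lebesgue_measure R) \x (@lebesgue_tuple m))
      (fun p : R * m.-tuple R => [tuple of p.1 :: p.2])
  end.

Definition simplex n : set (n.-tuple R) :=
  [set p | (forall i, (0 <= tnth p i <= 1)%R) /\ (\sum_i tnth p i = 1)%R].

Definition simplex_point m (x : m.-tuple R) : m.+1.-tuple R :=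
  [tuple of rcons x (1 - \sum_i tnth x i)%R].

Definition dirichlet_pdf n (a x : n.-tuple R) : R :=
  (Gamma (\sum_i tnth a i) / \prod_i Gamma (tnth a i)
   * \prod_i tnth x i `^ (tnth a i - 1))%R.

(* Positive parameters; the case [n = 0] is junk. *)
Definition dirichlet_pos (n : nat) :
    n.-tuple R -> set (n.-tuple R) -> \bar R :=
  match n return n.-tuple R -> set (n.-tuple R) -> \bar R with
  | 0 => fun _ _ => 0
  | 1 => fun _ A => \d_([tuple 1%R] : 1.-tuple R) A
  | m.+2 => fun a A =>
      \int[@lebesgue_tuple m.+1]_(x in @simplex_point m.+1 @^-1` (@simplex m.+2 `&` A))
        (dirichlet_pdf a (simplex_point x))%:E
  end.

(* Puts the entries of [y], in order, at the positions where [a] is positive,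
   and 0 elsewhere. *)
Definition zero_extend n (a : n.-tuple R) (y : seq R) : n.-tuple R :=
  [tuple if (0 < tnth a i)%R
         then nth 0%R y (count (fun r => 0 < r)%R (take i a)) else 0%R | i < n].

Definition dirichlet n (a : n.-tuple R) (A : set (n.-tuple R)) : \bar R :=
  @dirichlet_pos _ (in_tuple [seq r <- a | (0 < r)%R])
    [set y | A (zero_extend a y)].

End dirichlet.

Section random_measures.
Context (R : realType) d dO (T : measurableType d) (Omega : measurableType dO).
Variable P : probability Omega R.
Local Open Scope ereal_scope.

Definition random_measure (zeta : Omega -> smeasure T R) : Prop :=
  measurable_fun setT zeta.

(* [fine] loses nothing: the one-block partition forces [zeta w setT] to be 1
   almost surely. *)
Definition is_dirichlet_process (rho : {measure set T -> \bar R})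
    (zeta : Omega -> smeasure T R) : Prop :=
  [/\ 0 < rho setT < +oo, random_measure zeta &
      forall n (B : 'I_n.+1 -> set T),
        (forall i, measurable (B i)) -> trivIset setT B ->
        \bigcup_i B i = setT ->
        forall A : set (n.+1.-tuple R), measurable A ->
          P [set w | A [tuple fine (zeta w (B i)) | i < n.+1]] =
          dirichlet [tuple fine (rho (B i)) | i < n.+1] A].

(* The second argument of [poisson_prob] is a dummy. *)
Definition is_poisson_process (lambda : set T -> \bar R)
    (eta : Omega -> smeasure T R) : Prop :=
  [/\ random_measure eta,
      forall B, measurable B -> lambda B < +oo ->
        forall k : nat, P [set w | eta w B = k%:R%:E] =
                        poisson_prob (fine (lambda B)) 0%N [set k],
      forall B, measurable B -> lambda B = +oo ->
        P [set w | eta w B = +oo] = 1 &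
      forall n (B : 'I_n -> set T),
        (forall i, measurable (B i)) -> trivIset setT B ->
        independent_family P (fun i w => eta w (B i))].

End random_measures.

Section poisson_dirichlet.
Variable R : realType.
Local Open Scope ereal_scope.

Definition gamma_intensity (alpha : R) (B : set R) : \bar R :=
  \int[lebesgue_measure]_(r in B `&` `]0%R, +oo[)
    (alpha * r^-1 * expR (- r))%:E.

(* Point processes on (0, 1) and on (0, +oo) are viewed as random measures on
   [R]. The almost surely finite sum S is read off through [fine]. *)
Definition is_poisson_dirichlet d (Omega : measurableType d)
    (P : probability Omega R) (alpha : R) (eta : Omega -> smeasure R R)
    : Prop :=
  [/\ (0 < alpha)%R, random_measure eta &
  exists d' (Omega' : measurableType d') (P' : probability Omega' R)
      (t : {mfun Omega' >-> mseq R}),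
    let S w := fine (\sum_(n <oo) (t w n)%:E) in
    [/\ forall w n, (0 < t w n)%R,
        is_poisson_process P' (gamma_intensity alpha)
          (fun w => sum_diracs (t w)) &
        forall A : set (smeasure R R), measurable A ->
          P (eta @^-1` A) =
          P' [set w | A (sum_diracs (fun n => (t w n / S w)%R))]]].

End poisson_dirichlet.

Definition borel_space (R : realType) d (T : measurableType d) : Prop :=
  exists f : T -> R,
    [/\ measurable_fun setT f, injective f, range f `<=` `[0, 1] &
        forall A, measurable A -> measurable (f @` A)].

Section nonnegativity.
Context (R : realType) dO (Omega : measurableType dO).

Lemma itv01_ge0 (r : R) : 0 < r < 1 -> 0 <= r.
Proof. by case/andP => /ltW. Qed.

Lemma size_bias_ge0 (P : probability Omega R) (W : {mfun Omega >-> R}) :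
  (forall w, 0 < W w < 1) ->
  0 <= (1 - fine 'E_P[W]%E) / fine 'E_P[W]%E.
Proof.
move=> W01; have W0 w : 0 <= W w by exact: itv01_ge0.
have E0 : (0 <= 'E_P[W])%E by rewrite unlock; apply: integral_ge0 => w _; rewrite lee_fin.
have E1 : ('E_P[W] <= 1%:E)%E.
  rewrite -(expectation_cst P) !unlock; apply: ge0_le_integral => //=.
  - by move=> w _; rewrite lee_fin.
  - exact/measurable_EFinP.
  - by move=> w _; rewrite lee_fin; case/andP: (W01 w) => _ /ltW.
have Efin : 'E_P[W]%E \is a fin_num.
  by rewrite ge0_fin_numE// (le_lt_trans E1)// ltry.
by rewrite divr_ge0// ?fine_ge0// subr_ge0 -lee_fin fineK.
Qed.

End nonnegativity.

(* Main.v *)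
(* The law of V = Z_kappa is found from its moments: using P(kappa = i | Z, X) = Z_i
   before and after removing the kappa-th atom gives
   E[V^m (1 - V)] = E[(1 - V)^(m+1)] E[V^m]. Together with
   E[V^k (1 - V)^l] = E[V^k (1 - V)^(l+1)] + E[V^(k+1) (1 - V)^l] this recursion leaves
   only E V free, and the law Beta(1, alpha) satisfies it with the same mean.

   For a partition B_1, ..., B_n the vector p = (zeta(B_1), ..., zeta(B_n)) equals
   V u + (1 - V) p', where u is the unit vector of the block containing X_kappa and p'
   is a copy of p independent of (V, u). This random affine map contracts distances
   by the factor E(1 - V) < 1 on average, so at most one law on the cube is invariant
   under it. The Dirichlet law is: it is the law of independent gamma variables divided
   by their sum, and the invariance follows from the Mecke-type equation
   a E h(G_a + G_1) = E[G_a h(G_a)] and the beta-gamma algebra.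

   For the Poisson-Dirichlet law, multiply Z by an independent Gamma(alpha) variable G.
   By size biasing, the points G Z_n satisfy the Mecke equation with intensity
   alpha r^(-1) e^(-r) dr, which characterizes the Poisson process; their sum is G, and
   dividing by it gives back Z. *)

Require Import Defs.
From HB Require Import structures.
From mathcomp Require Import all_boot all_order all_algebra.
From mathcomp Require Import all_classical all_reals all_analysis.
From mathcomp Require Import measurable_realfun.
From mathcomp Require Import ring lra.

Set Implicit Arguments.
Unset Strict Implicit.
Unset Printing Implicit Defensive.

Import Order.TTheory GRing.Theory Num.Theory.
Import numFieldNormedType.Exports.

Local Open Scope classical_set_scope.
Local Open Scope ring_scope.

(** Everything is tested against nonnegative functions with values in the extended reals, so that
    Tonelli applies without integrability conditions; the absolute values in test functions extend
    them nonnegatively to arbitrary real arguments. The law of V has to come first: the Dirichlet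
    invariance concerns a Beta(1, a) weight in which a is also the total mass of the parameter, so
    the two laws are fixed by the same random map only once V is known to be Beta(1, alpha). The
    Dirichlet law is given by a density on the simplex; polar coordinates for gamma vectors identify
    it with the normalised vector and show at the same time that the sum is independent of the
    direction, which is what the invariance rests on. Blocks of zero mass are absorbed by reading
    Gamma(0) as the Dirac mass at 0. The moment argument and the contraction argument both end in
    one criterion: Lipschitz bumps around lower orthants determine a law. In the Poisson-Dirichlet
    part the total mass 1 holds only almost surely, whereas the points of the auxiliary process must
    be positive at every sample point. *)

(** * Densities and Lebesgue measure *)

(* The measure instance of [pushforward] leaves the measurability proof as an
   unresolved argument; this packs it. *)
Definition image_measure d d' (T1 : measurableType d) (T2 : measurableType d')
  (R : realType) (m : {measure set T1 -> \bar R}) (f : T1 -> T2)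
  (mf : measurable_fun setT f) : {measure set T2 -> \bar R}.
Proof. by refine (pushforward m f). Defined.

Lemma ge0_mulr_integral d (T : measurableType d) (R : realType)
    (m : {measure set T -> \bar R}) (k : R) (f : T -> \bar R) :
  0 <= k -> (forall x, 0 <= f x)%E -> measurable_fun setT f ->
  (k%:E * \int[m]_x f x = \int[m]_x (k%:E * f x))%E.
Proof. by move=> k0 f0 mf; rewrite ge0_integralZl. Qed.

Section density.
Context d (T : measurableType d) (R : realType).
Variables (mu : {measure set T -> \bar R}) (w : T -> R).
Hypotheses (w0 : forall x, 0 <= w x) (mw : measurable_fun setT w).
Local Open Scope ereal_scope.

(** The two proofs are phantom arguments: they let the measure structure below be inferred from the
    term alone. *)
Definition density of (forall x, 0 <= w x)%R & measurable_fun setT w :=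
  fun A : set T => \int[mu]_(x in A) (w x)%:E.

Local Notation dens := (density w0 mw).

Let dens0 : dens set0 = 0.
Proof. by rewrite /density integral_set0. Qed.

Let dens_ge0 A : 0 <= dens A.
Proof. by rewrite /density integral_ge0// => x _; rewrite lee_fin. Qed.

Let dens_sigma_additive : semi_sigma_additive dens.
Proof.
move=> F mF tF mUF; rewrite /density ge0_integral_bigcup//.
- by apply: is_cvg_nneseries => n _ _; apply: integral_ge0 => x _; rewrite lee_fin.
- exact/measurable_EFinP/measurable_funTS.
- by move=> x _; rewrite lee_fin.
Qed.

HB.instance Definition _ :=
  isMeasure.Build _ _ _ dens dens0 dens_ge0 dens_sigma_additive.

End density.

Section ge0_integral_density.
Context d (T : measurableType d) (R : realType).
Variables (mu nu : {measure set T -> \bar R}) (w : T -> R).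
Hypotheses (w0 : forall x, 0 <= w x) (mw : measurable_fun setT w).
Local Open Scope ereal_scope.
Hypothesis nuE : forall A, measurable A -> nu A = \int[mu]_(x in A) (w x)%:E.

Import HBNNSimple.

(** Indicators, then simple functions, then monotone convergence. Any measure [nu] with the right
    values on measurable sets is allowed, so that it also covers laws whose definition is not
    literally a [density]. *)
Lemma ge0_integral_density (f : T -> \bar R) : (forall x, 0 <= f x) ->
  measurable_fun setT f ->
  \int[nu]_x f x = \int[mu]_x ((w x)%:E * f x).
Proof.
move=> f0 mf; pose h := nnsfun_approx measurableT mf.
have mew : measurable_fun setT (EFin \o w) by exact/measurable_EFinP.
have -> : \int[nu]_x f x = lim (\int[nu]_x (EFin \o h n) x @[n --> \oo]).
  have fE x : setT x -> f x = lim ((EFin \o h n) x @[n --> \oo]).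
    by move=> Ex; apply/esym/cvg_lim => //; exact: cvg_nnsfun_approx.
  under eq_integral => x /[!inE] /fE -> //.
  apply: monotone_convergence => //.
  - by move=> n; exact/measurable_EFinP.
  - by move=> n x Ex //=; rewrite lee_fin.
  - by move=> x Ex a b ab; rewrite lee_fin; exact/lefP/nd_nnsfun_approx.
have -> : \int[mu]_x ((w x)%:E * f x) =
    lim (\int[mu]_x ((w x)%:E * (h n x)%:E) @[n --> \oo]).
  have fg x : setT x ->
      (w x)%:E * f x = lim (((w x)%:E * (h n x)%:E) @[n --> \oo]).
    by move=> Ex; apply/esym/cvg_lim => //; apply: cvgeZl => //;
      exact: cvg_nnsfun_approx.
  under eq_integral => x /[!inE] /fg -> //.
  apply: monotone_convergence => [//| | |].
  - by move=> n; apply: emeasurable_funM => //; exact/measurable_EFinP.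
  - by move=> n x Ex /=; rewrite mule_ge0 ?lee_fin.
  - by move=> x Ex a b ab/=; rewrite lee_wpmul2l ?lee_fin//;
      exact/lefP/nd_nnsfun_approx.
congr (limn _); apply/funext => n.
transitivity (\int[nu]_x
   (\sum_(y \in range (h n)) (y * \1_(h n @^-1` [set y]) x)%:E)).
  by apply: eq_integral => t tE; rewrite /= fimfunE -fsumEFin.
rewrite ge0_integral_fsum//; last 2 first.
- by move=> r; exact/measurable_EFinP/measurable_funM.
- by move=> m y Ey; exact: nnfun_muleindic_ge0.
transitivity (\int[mu]_x (\sum_(y \in range (h n))
    (w x)%:E * (y * \1_(h n @^-1` [set y]) x)%:E)); last first.
  under eq_integral => x xE.
    rewrite -ge0_mule_fsumr => [|y]; last exact: nnfun_muleindic_ge0.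
    rewrite fsumEFin // -(fimfunE _ x); over.
  by [].
rewrite ge0_integral_fsum//; last 2 first.
  - by move=> y; apply: emeasurable_funM => //;
      exact/measurable_EFinP/measurable_funM.
  - move=> m y Ey; apply: mule_ge0; first by rewrite lee_fin.
    exact: nnfun_muleindic_ge0.
apply: eq_fsbigr => r rhn.
rewrite integralZl_indic_nnsfun//.
have r0 : (0 <= r)%R by move: rhn; rewrite inE => -[x _ <-].
under [RHS]eq_integral do rewrite EFinM muleCA.
rewrite ge0_integralZl//; last 2 first.
- by apply: emeasurable_funM => //; exact/measurable_EFinP.
- by move=> x _; rewrite mule_ge0 ?lee_fin.
congr (_ * _); rewrite integral_indic// setIT nuE//.
rewrite integral_mkcond; apply: eq_integral => x _.
by rewrite epatch_indic.
Qed.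

End ge0_integral_density.

Lemma measurable_affine (R : realType) (c t : R) :
  measurable_fun setT (fun x : R => c * x + t).
Proof. by apply: measurable_funD => //; exact: measurable_funM. Qed.

(* [lebesgue_measure] lives on [measurableTypeR R], a different measurable type
   structure (with the same sigma-algebra) than the canonical one of [R]. *)
Definition leb (R : realType) : set R -> \bar R := @lebesgue_measure R.

Section leb.
Context (R : realType).
Local Open Scope ereal_scope.

Let leb0 : @leb R set0 = 0. Proof. exact: measure0. Qed.
Let leb_ge0 A : 0 <= @leb R A. Proof. exact: measure_ge0. Qed.
Let leb_sigma_additive : semi_sigma_additive (@leb R).
Proof. exact: (@measure_semi_sigma_additive _ _ _ (@lebesgue_measure R)). Qed.

HB.instance Definition _ :=
  isMeasure.Build _ _ _ (@leb R) leb0 leb_ge0 leb_sigma_additive.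

Let leb_sigma_finite : sigma_finite setT (@leb R).
Proof. exact: (@sigma_finiteT _ _ _ (@lebesgue_measure R)). Qed.

HB.instance Definition _ :=
  @Measure_isSigmaFinite.Build _ _ _ (@leb R) leb_sigma_finite.

Lemma integral_leb (D : set R) (f : R -> \bar R) : measurable D ->
  measurable_fun D f -> (forall x, D x -> 0 <= f x) ->
  \int[lebesgue_measure]_(x in D) f x = \int[@leb R]_(x in D) f x.
Proof.
move=> mD mf f0.
pose phi : measurableTypeR R -> R := id.
have mphi : measurable_fun setT phi by move=> _ A mA; rewrite setTI.
transitivity (\int[image_measure (@lebesgue_measure R) mphi]_(x in D) f x).
  rewrite (@ge0_integral_pushforward _ _ _ _ _ phi mphi)//.
  by move=> x /set_mem; exact: f0.
exact: eq_measure_integral.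
Qed.

(** The rescaled image measure gives half-open intervals their length, so uniqueness of Lebesgue
    measure applies. The later changes of variables, polar coordinates included, combine this affine
    case with Tonelli. *)
Lemma ge0_integral_affine (c t : R) (f : R -> \bar R) : (0 < c)%R ->
  (forall x, 0 <= f x) -> measurable_fun setT f ->
  \int[@leb R]_x f x = c%:E * \int[@leb R]_x f (c * x + t)%R.
Proof.
move=> c0 f0 mf.
have c0' : (0 <= c)%R by exact: ltW.
pose m : {measure set R -> \bar R} :=
  mscale (NngNum c0') (image_measure (@leb R) (measurable_affine c t)).
have mE A : measurable A -> @leb R A = m A.
  pose m' : {measure set (measurableTypeR R) -> \bar R} :=
    mscale (NngNum c0') (image_measure (@lebesgue_measure R)
      (measurable_affine c t : measurable_fun setT
        (fun x => c * x + t : measurableTypeR R))%R).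
  apply: (@lebesgue_measure_unique _ m') => _ [[a b]] _ <- /=.
  rewrite /m' /mscale/= /image_measure/= /pushforward.
  have -> : (fun x : R => c * x + t)%R @^-1` `]a, b] =
      (`](a - t) / c, (b - t) / c]%classic)%R.
    apply/seteqP; split => x; rewrite /= !in_itv/=;
      rewrite ltr_pdivrMr// ler_pdivlMr// ltrBlDr lerBrDr (mulrC c)//.
  rewrite !lebesgue_measure_itv/= !lte_fin ltr_pM2r ?invr_gt0// ltrD2r.
  case: ifPn => ab; last by rewrite mule0.
  by rewrite -!EFinB -EFinM; congr EFin; field; rewrite gt_eqF.
rewrite (eq_measure_integral m); last by move=> A mA _; exact: mE.
rewrite ge0_integral_mscale//; congr (_ * _).
by rewrite (@ge0_integral_pushforward _ _ _ _ _ _ (measurable_affine c t))//=.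
Qed.

End leb.

(** * Gamma and beta laws *)

Section gamma_beta_densities.
Context (R : realType).
Local Notation mu := (@lebesgue_measure R).
Local Open Scope ereal_scope.

(** Unnormalised and cut off outside the open support, like [bdens] below: integrals then run over
    the whole line and Tonelli needs no bookkeeping of domains. *)
Definition gdens (a x : R) : R :=
  (if 0 < x then x `^ (a - 1) * expR (- x) else 0)%R.

Definition bdens (a b v : R) : R :=
  (if 0 < v < 1 then v `^ (a - 1) * (1 - v) `^ (b - 1) else 0)%R.

Lemma gdens_ge0 a x : (0 <= gdens a x)%R.
Proof. by rewrite /gdens; case: ifP => // _; rewrite mulr_ge0 ?powR_ge0 ?expR_ge0. Qed.

Lemma bdens_ge0 a b x : (0 <= bdens a b x)%R.
Proof. by rewrite /bdens; case: ifP => // _; rewrite mulr_ge0 ?powR_ge0. Qed.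

Lemma measurable_gdens a : measurable_fun setT (gdens a).
Proof.
apply: measurable_fun_ifT => //.
- by apply: measurable_fun_ltr.
- apply: measurable_funM.
    by apply: (measurableT_comp (measurable_powR _)); exact: measurable_id.
  exact: (measurableT_comp (@measurable_expR R)).
Qed.

Lemma measurable_bdens a b : measurable_fun setT (bdens a b).
Proof.
apply: measurable_fun_ifT => //.
- by apply: measurable_and; apply: measurable_fun_ltr.
- apply: measurable_funM.
    by apply: (measurableT_comp (measurable_powR _)); exact: measurable_id.
  by apply: (measurableT_comp (measurable_powR _)); exact: measurable_funB.
Qed.

Lemma integral_powR_itvoo (a y : R) : (0 < a)%R -> (0 < y)%R ->
  \int[@leb R]_(x in `]0%R, y[) (x `^ (a - 1))%:E = (y `^ a / a)%:E.
Proof.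
move=> a0 y0.
rewrite -integral_leb//; last 2 first.
- by apply/measurable_EFinP/measurable_funTS; exact: measurable_powR.
- by move=> x _; rewrite lee_fin powR_ge0.
have mpow (D : set R) : measurable_fun D (fun x : R => (x `^ (a - 1))%:E).
  by apply/measurable_EFinP; apply/measurable_funTS; exact: measurable_powR.
(* For [a < 1] the integrand is unbounded near 0, so the fundamental theorem of calculus is applied
   away from 0 and the intervals are then exhausted. The shift to n + 2 keeps the lower end strictly
   below y. *)
pose F n : set R := `[(y / n.+2%:R)%R, y]%classic.
have F0 n : (0 < y / n.+2%:R)%R by rewrite divr_gt0.
have Fy n : (y / n.+2%:R < y)%R by rewrite ltr_pdivrMr// ltr_pMr// ltr1n.
have FE : \bigcup_n F n = `]0%R, y]%classic.
  apply/seteqP; split => [x [n _]|x]; rewrite /F/= !in_itv/=.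
    by case/andP => xy ->; rewrite (lt_le_trans (F0 n) xy).
  case/andP => x0 xy; exists (Num.truncn (y / x)) => //=.
  rewrite in_itv/= xy andbT ler_pdivrMr// mulrC -ler_pdivrMr//.
  rewrite ltW// (lt_le_trans (truncnS_gt _))// ler_nat//.
have nF : nondecreasing_seq F.
  move=> m n mn; rewrite subsetEset => x; rewrite /F/= !in_itv/=.
  case/andP => xy ->; rewrite andbT (le_trans _ xy)//.
  by rewrite ler_pM2l// lef_pV2 ?posrE// ler_nat.
have Fint n : \int[mu]_(x in F n) (x `^ (a - 1))%:E =
    (y `^ a / a - (y / n.+2%:R) `^ a / a)%:E.
  rewrite (@continuous_FTC2 _ _ (fun x => x `^ a / a)%R)//.
  - apply: derivable_within_continuous => x; rewrite in_itv/= => /andP[xy _].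
    by apply: derivable_powR; rewrite in_itv/= andbT (lt_le_trans _ xy).
  - have cpow (z : R) : (0 < z)%R -> {for z, continuous (fun x : R => x `^ a / a)%R}.
      move=> z0; apply: differentiable_continuous; apply/derivable1_diffP.
      by apply: derivableM => //; apply: derivable_powR; rewrite in_itv/= andbT.
    split.
    + move=> x; rewrite in_itv/= => /andP[xy _].
      apply: derivableM => //; apply: derivable_powR.
      by rewrite in_itv/= andbT (lt_trans _ xy).
    + by apply: cvg_at_right_filter; exact: cpow.
    + by apply: cvg_at_left_filter; exact: cpow.
  - move=> x; rewrite in_itv/= => /andP[xy _].
    have x0 : (0 < x)%R by exact: lt_trans xy.
    have dx : derivable (fun x : R => x `^ a)%R x 1.
      by apply: derivable_powR; rewrite in_itv/= andbT.
    rewrite [X in X^`()%classic](_ : _ = (fun x => a^-1 * x `^ a)%R); last first.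
      by apply/funext => z; rewrite mulrC.
    rewrite derive1Ml// powR_derive1 ?in_itv/= ?andbT//.
    by rewrite mulrA mulVf ?mul1r// gt_eqF.
have cvg1 : \int[mu]_(x in F n) (x `^ (a - 1))%:E @[n --> \oo] -->
    \int[mu]_(x in \bigcup_i F i) (x `^ (a - 1))%:E.
  apply: ge0_nondecreasing_set_cvg_integral => //.
  - by move=> n; exact: measurable_itv.
  - by move=> n; exact: mpow.
  - by move=> n x _; rewrite lee_fin powR_ge0.
have cvg2 : \int[mu]_(x in F n) (x `^ (a - 1))%:E @[n --> \oo] -->
    (y `^ a / a)%:E.
  under eq_cvg do rewrite Fint.
  apply: cvg_EFin; first exact: nearW.
  rewrite -[X in _ --> X]subr0; apply: cvgB; first exact: cvg_cst.
  rewrite -(mul0r (a^-1)%R); apply: cvgM; last exact: cvg_cst.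
  have := powR_cvg0 a0; move/(@cvg_at_rightP _ _ _ 0%R) => /(_ (fun n => y / n.+2%:R)%R); apply.
  split => //.
  rewrite -(mulr0 y); apply: cvgM; first exact: cvg_cst.
  have := @cvg_harmonic R; rewrite -cvg_shiftS; exact.
rewrite (_ : \int[mu]_(x in `]0%R, y[) _ = \int[mu]_(x in `]0%R, y]) (x `^ (a - 1))%:E); last first.
  by apply: integral_itv_bndo_bndc.
rewrite -FE; exact: cvg_unique cvg1 cvg2.
Qed.

Lemma integral_expRN_itvoy (t : R) :
  \int[@leb R]_(x in `]t, +oo[) (expR (- x))%:E = (expR (- t))%:E.
Proof.
rewrite -integral_leb//; last first.
  apply/measurable_EFinP/measurable_funTS.
  exact: (measurableT_comp (@measurable_expR R)).
have cexp : continuous (fun x : R => expR (- x)).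
  move=> z; apply: (@continuous_comp _ _ _ -%R expR); last exact: continuous_expR.
  exact: opp_continuous.
rewrite integral_itv_obnd_cbnd; last first.
  apply/measurable_EFinP/measurable_funTS.
  exact: (measurableT_comp (@measurable_expR R)).
rewrite (@ge0_continuous_FTC2y _ _ (fun x => - expR (- x))%R t 0%R)//.
- by rewrite sub0e EFinN oppeK.
- exact: continuous_subspaceT.
- by rewrite -oppr0; apply: cvgN; exact: cvgr_expR.
- by apply/cvg_at_right_filter; apply: cvgN; exact: cexp.
- move=> x _; rewrite derive1_comp// derive1N// derive1_id mulN1r.
  rewrite derive1_comp// derive1E. have /funeqP -> := @derive_expR R.
  by rewrite derive1N// derive1_id mulrN1 opprK.
Qed.

End gamma_beta_densities.

Section gamma_beta_functions.
Context (R : realType).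
Local Notation mu := (@leb R).
Local Open Scope ereal_scope.

(** [Gamma] is only the [fine] part of this integral; identities are proved here first and
    transferred once finiteness is known. *)
Definition egamma (a : R) : \bar R := \int[mu]_x (gdens a x)%:E.

Lemma egamma_itv a :
  egamma a = \int[mu]_(x in `]0%R, +oo[) (x `^ (a - 1) * expR (- x))%:E.
Proof.
rewrite [RHS]integral_mkcond; apply: eq_integral => x _.
by rewrite patchE mem_setE in_itv/= andbT /gdens; case: ifP.
Qed.

Lemma egammaE a : egamma a =
  \int[lebesgue_measure]_(x in `]0%R, +oo[) (x `^ (a - 1) * expR (- x))%:E.
Proof.
rewrite integral_leb ?egamma_itv//.
- apply/measurable_EFinP/measurable_funTS/measurable_funM.
    exact: measurable_powR.
  exact: (measurableT_comp (@measurable_expR R)).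
- by move=> x _; rewrite lee_fin mulr_ge0 ?powR_ge0 ?expR_ge0.
Qed.

(* Tonelli, writing [x ^ a] as the integral of [a t ^ (a - 1)] over [t < x]:
   unlike integration by parts this needs no boundary terms at 0 when [a < 1]. *)
Lemma egammaS (a : R) : (0 < a)%R -> egamma (a + 1) = a%:E * egamma a.
Proof.
move=> a0.
pose f (p : R * R) : \bar R :=
  (if (0 < p.2) && (p.2 < p.1) then p.2 `^ (a - 1) * expR (- p.1) else 0)%R%:E.
have f0 p : 0 <= f p.
  by rewrite /f lee_fin; case: ifP => // _; rewrite mulr_ge0 ?powR_ge0 ?expR_ge0.
have mf : measurable_fun setT f.
  apply/measurable_EFinP; apply: measurable_fun_ifT => //.
  - by apply: measurable_and; apply: measurable_fun_ltr => //.
  - apply: measurable_funM.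
      exact: (measurableT_comp (measurable_powR _)).
    apply: (measurableT_comp (@measurable_expR R)).
    exact: measurableT_comp.
transitivity (a%:E * \int[mu]_x \int[mu]_t f (x, t)).
  rewrite -ge0_integralZl//; last 3 first.
  - exact: measurable_fun_fubini_tonelli_F.
  - by move=> x _; exact: integral_ge0.
  - by rewrite lee_fin ltW.
  apply: eq_integral => x _; rewrite /gdens.
  case: ifPn => x0; last first.
    rewrite integral0_eq ?mule0// => t _; rewrite /f/=; case: ifP => // /andP[t0 tx].
    by rewrite (lt_trans t0 tx) in x0.
  transitivity (a%:E * ((expR (- x))%:E * \int[mu]_(t in `]0%R, x[) (t `^ (a - 1))%:E)).
    rewrite integral_powR_itvoo// -!EFinM addrK; congr EFin.
    by field; rewrite gt_eqF.
  congr (_ * _); rewrite -ge0_integralZl//; last 2 first.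
  - by apply/measurable_EFinP/measurable_funTS; exact: measurable_powR.
  - by move=> t _; rewrite lee_fin powR_ge0.
  rewrite [LHS]integral_mkcond; apply: eq_integral => t _.
  by rewrite patchE mem_setE in_itv/= /f/=; case: ifP => // _; rewrite -EFinM mulrC.
congr (_ * _); rewrite fubini_tonelli//.
apply: eq_integral => t _; rewrite /gdens; case: ifPn => t0; last first.
  by rewrite integral0_eq// => x _; rewrite /f/= (negbTE t0).
rewrite EFinM -integral_expRN_itvoy -ge0_integralZl//; last 2 first.
- apply/measurable_EFinP/measurable_funTS.
  exact: (measurableT_comp (@measurable_expR R)).
- by rewrite lee_fin powR_ge0.
rewrite [RHS]integral_mkcond; apply: eq_integral => x _.
by rewrite patchE mem_setE in_itv/= andbT /f/= t0/=; case: ifP.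
Qed.

Lemma egamma1 : egamma 1 = 1.
Proof.
rewrite egamma_itv; under eq_integral do rewrite subrr powRr0 mul1r.
by rewrite integral_expRN_itvoy oppr0 expR0.
Qed.

Lemma egamma_ge0 a : 0 <= egamma a.
Proof. by apply: integral_ge0 => x _; rewrite lee_fin gdens_ge0. Qed.

Lemma egamma_nat n : egamma n.+1%:R = n`!%:R%:E.
Proof.
elim: n => [|n IH]; first by rewrite egamma1.
by rewrite -natr1 egammaS// IH -EFinM -natrM factS mulnC.
Qed.

(** For b in [n+1, n+2) one has x^(b-1) <= x^n + x^(n+1) on the positive axis, and the gamma
    integrals at integers are factorials. The case [a < 1] follows from the functional equation,
    since a + 1 >= 1. *)
Lemma egamma_fin_num a : (0 < a)%R -> egamma a \is a fin_num.
Proof.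
have lt_oo b : (1 <= b)%R -> egamma b < +oo.
  move=> b1; have b0 : (0 <= b)%R by exact: le_trans b1.
  pose n := (Num.truncn b).-1.
  have /andP[nb bn] : (n.+1%:R <= b < n.+2%:R)%R.
    have := truncn_itv b0; rewrite /n prednK// -ltnS.
    by have := truncn_itv b0 => /andP[_]; rewrite -(ltr_nat R); apply: le_lt_trans.
  apply: (@le_lt_trans _ _ (egamma n.+1%:R + egamma n.+2%:R)); last first.
    by rewrite !egamma_nat -EFinD ltry.
  rewrite /egamma -ge0_integralD//; last 4 first.
  - by move=> x _; rewrite lee_fin gdens_ge0.
  - by apply/measurable_EFinP; exact: measurable_gdens.
  - by move=> x _; rewrite lee_fin gdens_ge0.
  - by apply/measurable_EFinP; exact: measurable_gdens.
  apply: ge0_le_integral => //.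
  - by move=> x _; rewrite lee_fin gdens_ge0.
  - by apply/measurable_EFinP; exact: measurable_gdens.
  - by apply/measurable_EFinP; apply: measurable_funD; exact: measurable_gdens.
  - move=> x _; rewrite -EFinD lee_fin /gdens; case: ifPn => x0; last by rewrite addr0.
    rewrite -mulrDl ler_wpM2r ?expR_ge0//.
    have [x1|x1] := leP x 1%R.
      by apply: ler_wpDr; rewrite ?powR_ge0// ger_powR ?x0// lerD2r.
    by apply: ler_wpDl; rewrite ?powR_ge0// ler_powR ?(ltW x1)// lerD2r ltW.
move=> a0; rewrite ge0_fin_numE ?egamma_ge0//.
have [a1|a1] := leP 1%R a; first exact: lt_oo.
have /lt_oo : (1 <= a + 1)%R by rewrite lerDr ltW.
rewrite egammaS//.
case: (egamma a) (egamma_ge0 a) => [r _ _|_|//]; first by rewrite ltry.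
by rewrite mulry gtr0_sg// mul1e.
Qed.

Lemma EFin_Gamma a : (0 < a)%R -> (Gamma a)%:E = egamma a.
Proof. by move=> a0; rewrite /Gamma /Rintegral -egammaE fineK// egamma_fin_num. Qed.

Lemma GammaS a : (0 < a)%R -> (Gamma (a + 1) = a * Gamma a :> R)%R.
Proof.
move=> a0; apply/EFin_inj; rewrite EFinM !EFin_Gamma ?egammaS//.
by rewrite addr_gt0.
Qed.

Lemma Gamma1 : (Gamma 1 = 1 :> R)%R.
Proof. by apply/EFin_inj; rewrite EFin_Gamma// egamma1. Qed.

Lemma Gamma_gt0 a : (0 < a)%R -> (0 < Gamma a :> R)%R.
Proof.
move=> a0; rewrite -lte_fin EFin_Gamma//.
(* A lower bound of the density on (1, 2): there x^(a-1) >= 1/x >= 1/2 because a > 0, and the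
   exponential is at least that of -2. *)
have c0 : (0 < expR (- 2) / 2 :> R)%R by rewrite divr_gt0 ?expR_gt0.
apply: (@lt_le_trans _ _ (\int[mu]_x (cst (expR (- 2) / 2)%:E \_ `]1%R, 2%R[) x)).
  rewrite -integral_mkcond integral_cst//= [X in _ * X]lebesgue_measure_itv/= lte_fin ltr1n.
  by rewrite -EFinB -EFinM lte_fin mulr_gt0// subr_gt0 ltr1n.
apply: ge0_le_integral => //.
- by move=> x _; rewrite patchE; case: ifP => //= _; rewrite lee_fin ltW.
- by apply/(measurable_restrictT (cst (expR (- 2) / 2)%:E)).
- by apply/measurable_EFinP; exact: measurable_gdens.
- move=> x _; rewrite patchE mem_setE in_itv/=; case: ifPn => [/andP[x1 x2]|_]; last first.
    by rewrite lee_fin gdens_ge0.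
  have x0 : (0 < x)%R by exact: lt_trans x1.
  rewrite lee_fin /gdens x0 mulrC ler_pM ?invr_ge0 ?expR_ge0//; last first.
    by rewrite ler_expR lerN2 ltW.
  apply: (@le_trans _ _ (x `^ (-1))%R).
    by rewrite powR_inv1 ?(ltW x0)// lef_pV2 ?posrE// ltW.
  by apply: ler_powR; [exact: ltW|rewrite lerBrDr addNr ltW].
Qed.

(** The substitution x = g v, y = g (1 - v) with Jacobian g, done one variable at a time: y = g - x
    for fixed x, then Tonelli, then x = g v for fixed g. For g <= 0 both sides vanish. *)
Lemma beta_gamma_algebra a b (f : R * R -> \bar R) :
  (forall p, 0 <= f p) -> measurable_fun setT f ->
  \int[mu]_x ((gdens a x)%:E * \int[mu]_y ((gdens b y)%:E * f (x, y))) =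
  \int[mu]_g ((gdens (a + b) g)%:E *
    \int[mu]_v ((bdens a b v)%:E * f (g * v, g * (1 - v))%R)).
Proof.
move=> f0 mf.
have mg (c : R) d (T : measurableType d) (h : T -> R) : measurable_fun setT h ->
    measurable_fun setT (fun t => (gdens c (h t))%:E).
  by move=> mh; apply/measurable_EFinP/(measurableT_comp (measurable_gdens c)).
have gd0 c x : 0 <= (gdens c x)%:E by rewrite lee_fin gdens_ge0.
pose h (p : R * R) := (gdens a p.1)%:E * ((gdens b (p.2 - p.1))%:E * f (p.1, p.2 - p.1)%R).
have mh : measurable_fun setT h.
  apply: emeasurable_funM; first exact: mg.
  apply: emeasurable_funM; first by apply: mg; exact: measurable_funB.
  apply: (measurableT_comp mf); apply: measurable_fun_pair => //.
  exact: measurable_funB.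
have h0 p : 0 <= h p by rewrite /h !mule_ge0.
transitivity (\int[mu]_x \int[mu]_g h (x, g)).
  apply: eq_integral => x _.
  have mx : measurable_fun setT (fun y => (gdens b y)%:E * f (x, y)).
    by apply: emeasurable_funM; [exact: mg|exact: measurableT_comp].
  rewrite (@ge0_integral_affine _ 1 (- x))//; last by move=> y; rewrite mule_ge0.
  rewrite mul1e ge0_mulr_integral; last 3 first.
  - exact: gdens_ge0.
  - by move=> y; rewrite mule_ge0.
  - exact: (measurableT_comp mx (measurable_affine _ _)).
  by apply: eq_integral => g _; rewrite /h/= mul1r.
rewrite fubini_tonelli//; apply: eq_integral => g _.
have [g0|g0] := ltP 0%R g; last first.
  rewrite [X in _ = X%:E * _]/gdens ltNge g0/= mul0e integral0_eq// => x _.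
  rewrite /h/= /gdens; case: ifPn => x0; last by rewrite mul0e.
  by rewrite subr_gt0 ltNge (le_trans g0 (ltW x0))/= mul0e mule0.
have mhg : measurable_fun setT (fun x => h (x, g)) by exact: measurableT_comp.
rewrite [LHS](@ge0_integral_affine _ g 0)//.
rewrite ge0_mulr_integral; last 3 first.
- exact: ltW.
- by move=> v; exact: h0.
- exact: (measurableT_comp mhg (measurable_affine _ _)).
rewrite ge0_mulr_integral; last 3 first.
- exact: gdens_ge0.
- by move=> v; rewrite mule_ge0// lee_fin bdens_ge0.
- apply: emeasurable_funM; first by apply/measurable_EFinP; exact: measurable_bdens.
  apply: (measurableT_comp mf); apply: measurable_fun_pair => //.
  apply: measurable_funM => //; exact: measurable_funB.
apply: eq_integral => v _; rewrite /h/= addr0.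
have -> : (g - g * v = g * (1 - v))%R by rewrite mulrBr mulr1.
rewrite !muleA -!EFinM; congr ((_)%:E * _).
rewrite /gdens /bdens !pmulr_rgt0// subr_gt0 g0.
have [v0|v0] := ltP 0%R v => /=; last by rewrite !(mulr0, mul0r).
have [v1|v1] := ltP v 1%R => /=; last by rewrite !(mulr0, mul0r).
rewrite !powRM ?ltW ?subr_gt0//.
have powg r s : (g `^ (r + s) = g `^ r * g `^ s)%R 
  by rewrite powRD//; apply/implyP => _; rewrite gt_eqF.
have -> : (g `^ (a + b - 1) = g * g `^ (a - 1) * g `^ (b - 1))%R.
  have -> : (a + b - 1 = 1 + (a - 1) + (b - 1))%R by ring.
  by rewrite (powg (1 + (a - 1))%R (b - 1)%R) (powg 1%R (a - 1)%R) powRr1 ?(ltW g0).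
have -> : (expR (- g) = expR (- (g * v)) * expR (- (g * (1 - v))))%R.
  by rewrite -expRD; congr expR; ring.
ring.
Qed.

Definition ebeta (a b : R) : \bar R := \int[mu]_v (bdens a b v)%:E.

(** The constant test function in [beta_gamma_algebra] gives Gamma(a) Gamma(b) = Gamma(a + b) times
    the beta integral; the infinite values are excluded because the left side is finite. *)
Lemma ebetaE a b : (0 < a)%R -> (0 < b)%R -> ebeta a b = (Beta a b)%:E.
Proof.
move=> a0 b0.
have := @beta_gamma_algebra a b (cst 1) (fun=> lee01) (measurable_cst _).
under eq_integral do under eq_integral do rewrite mule1.
under [in X in _ = X -> _]eq_integral do under eq_integral do rewrite mule1.
have ab0 : (0 < a + b)%R by exact: addr_gt0.
rewrite -/(egamma b) -/(ebeta a b) -EFin_Gamma//.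
have mgE c : measurable_fun setT (fun x : R => (gdens c x)%:E).
  by apply/measurable_EFinP; exact: measurable_gdens.
rewrite ge0_integralZr//; last 2 first.
- by move=> x _; rewrite lee_fin gdens_ge0.
- by rewrite lee_fin ltW// Gamma_gt0.
rewrite ge0_integralZr//; last 2 first.
- by move=> x _; rewrite lee_fin gdens_ge0.
- by apply: integral_ge0 => x _; rewrite lee_fin bdens_ge0.
rewrite -/(egamma a) -/(egamma _) -!EFin_Gamma// -EFinM.
have G0 := Gamma_gt0 ab0.
case: (ebeta a b) => [r| |] /=.
- rewrite -EFinM => -[E]; congr EFin.
  by rewrite /Beta E mulrC mulKf// gt_eqF.
- by rewrite mulry gtr0_sg// mul1e.
- by rewrite mulrNy gtr0_sg// mul1e.
Qed.

Lemma Gamma_ge0 a : (0 <= Gamma a :> R)%R.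
Proof.
rewrite /Gamma /Rintegral; apply/fine_ge0/integral_ge0 => x _.
by rewrite lee_fin mulr_ge0 ?powR_ge0 ?expR_ge0.
Qed.

Lemma Beta_ge0 a b : (0 <= Beta a b :> R)%R.
Proof. by rewrite /Beta divr_ge0 ?mulr_ge0 ?Gamma_ge0. Qed.

Lemma Beta_gt0 a b : (0 < a)%R -> (0 < b)%R -> (0 < Beta a b :> R)%R.
Proof.
by move=> a0 b0; rewrite /Beta divr_gt0 ?mulr_gt0 ?Gamma_gt0// addr_gt0.
Qed.

End gamma_beta_functions.

Section gamma_beta_laws.
Context (R : realType).
Local Notation mu := (@leb R).
Local Open Scope ereal_scope.

(* For [a <= 0] the gamma law degenerates to the Dirac mass at 0, which turns
   the vanishing parameters of a Dirichlet law into vanishing coordinates. *)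
Definition gamma_law (a : R) (A : set R) : \bar R :=
  if (0 < a)%R then \int[mu]_(x in A) (gdens a x / Gamma a)%:E else \d_(0%R : R) A.

Section gamma_law_measure.
Variable a : R.

Let ndens0 : (0 < a)%R -> forall x, (0 <= gdens a x / Gamma a)%R.
Proof. by move=> a0 x; rewrite divr_ge0 ?gdens_ge0// ltW// Gamma_gt0. Qed.

Let mndens : measurable_fun setT (fun x => gdens a x / Gamma a)%R.
Proof. by apply: measurable_funM => //; exact: measurable_gdens. Qed.

Let gamma0 : gamma_law a set0 = 0.
Proof. by rewrite /gamma_law; case: ifP => _; rewrite ?integral_set0 ?measure0. Qed.

Let gamma_ge0 A : 0 <= gamma_law a A.
Proof.
rewrite /gamma_law; case: ifPn => // a0; apply: integral_ge0 => x _.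
by rewrite lee_fin ndens0.
Qed.

Let gamma_sigma_additive : semi_sigma_additive (gamma_law a).
Proof.
have [a0|a0] := ltP 0%R a.
  rewrite (_ : gamma_law a = density mu (ndens0 a0) mndens).
    exact: (@measure_semi_sigma_additive _ _ _ (density mu (ndens0 a0) mndens)).
  by apply/funext => A; rewrite /gamma_law a0.
rewrite (_ : gamma_law a = \d_(0%R : R)); first exact: measure_semi_sigma_additive.
by apply/funext => A; rewrite /gamma_law ltNge a0.
Qed.

HB.instance Definition _ := isMeasure.Build _ _ _
  (gamma_law a) gamma0 gamma_ge0 gamma_sigma_additive.

Let gamma_setT : gamma_law a setT = 1.
Proof.
rewrite /gamma_law; case: ifPn => a0; last by rewrite diracT.
under eq_integral do rewrite EFinM.
rewrite ge0_integralZr//; last 3 first.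
- by apply/measurable_EFinP; exact: measurable_gdens.
- by move=> x _; rewrite lee_fin gdens_ge0.
- by rewrite lee_fin invr_ge0 ltW// Gamma_gt0.
by rewrite -/(egamma a) -EFin_Gamma// -EFinM divff// gt_eqF// Gamma_gt0.
Qed.

HB.instance Definition _ :=
  @Measure_isProbability.Build _ _ R (gamma_law a) gamma_setT.

End gamma_law_measure.

Lemma ge0_integral_gamma_law a (f : R -> \bar R) : (0 < a)%R ->
  (forall x, 0 <= f x) -> measurable_fun setT f ->
  \int[gamma_law a]_x f x = (Gamma a)^-1%:E * \int[mu]_x ((gdens a x)%:E * f x).
Proof.
move=> a0 f0 mf; have G0 := Gamma_gt0 a0.
have -> : \int[gamma_law a]_x f x = \int[mu]_x ((gdens a x / Gamma a)%:E * f x).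
  apply: (@ge0_integral_density _ _ _ mu (gamma_law a) (fun x => gdens a x / Gamma a)%R) => //.
  - by move=> x; rewrite divr_ge0 ?gdens_ge0 ?(ltW G0).
  - by apply: measurable_funM => //; exact: measurable_gdens.
  - by move=> A mA; rewrite /= /gamma_law a0.
rewrite -ge0_integralZl//; last 3 first.
- apply: (emeasurable_funM (f := fun x => (gdens a x)%:E)) => //.
  by apply/measurable_EFinP; exact: measurable_gdens.
- by move=> x _; rewrite mule_ge0// lee_fin gdens_ge0.
- by rewrite lee_fin invr_ge0 ltW.
by apply: eq_integral => x _; rewrite muleA -EFinM mulrC.
Qed.

Lemma ge0_integral_gamma_law0 a (f : R -> \bar R) : (a <= 0)%R ->
  (forall x, 0 <= f x) -> measurable_fun setT f ->
  \int[gamma_law a]_x f x = f 0%R.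
Proof.
move=> a0 f0 mf; rewrite (eq_measure_integral (\d_(0%R : R)))//; last first.
  by move=> A mA _; rewrite /= /gamma_law ltNge a0.
by rewrite integral_dirac// diracT mul1e.
Qed.

Lemma gamma_law_gt0_eq a (f g : R -> \bar R) : (0 < a)%R ->
  (forall x, 0 <= f x) -> measurable_fun setT f ->
  (forall x, 0 <= g x) -> measurable_fun setT g ->
  (forall x, (0 < x)%R -> f x = g x) ->
  \int[gamma_law a]_x f x = \int[gamma_law a]_x g x.
Proof.
move=> a0 f0 mf g0 mg fg.
rewrite !ge0_integral_gamma_law//; congr (_ * _); apply: eq_integral => x _.
by rewrite /gdens; case: ifPn => [x0|_]; [rewrite fg|rewrite !mul0e].
Qed.

Lemma gamma_law_ge0_eq a (f g : R -> \bar R) :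
  (forall x, 0 <= f x) -> measurable_fun setT f ->
  (forall x, 0 <= g x) -> measurable_fun setT g ->
  (forall x, (0 <= x)%R -> f x = g x) ->
  \int[gamma_law a]_x f x = \int[gamma_law a]_x g x.
Proof.
move=> f0 mf g0 mg fg; have [a0|a0] := ltP 0%R a; last first.
  by rewrite !ge0_integral_gamma_law0// fg.
by apply: gamma_law_gt0_eq => // x x0; rewrite fg// ltW.
Qed.

Lemma beta_lawE a b (A : set R) : measurable A ->
  beta_law a b A = \int[mu]_(x in A) ((Beta a b)^-1 * bdens a b x)%:E.
Proof.
move=> mA; rewrite /beta_law.
set D := A `&` _.
have mD : measurable D by apply: measurableI => //; exact: measurable_itv.
have mf (E : set R) : measurable_fun E
    (fun x => ((Beta a b)^-1 * x `^ (a - 1) * (1 - x) `^ (b - 1))%:E).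
  apply/measurable_EFinP/measurable_funTS/measurable_funM.
    by apply: measurable_funM => //; exact: measurable_powR.
  by apply: (measurableT_comp (measurable_powR _)); exact: measurable_funB.
(* [beta_law] integrates over the closed interval, while [bdens] is 0 at both endpoints, where the
   powers need not vanish. Removing these two null points reconciles them. *)
rewrite -(@integral_setD1 _ _ 1%R)//; last exact: measurableD.
have mD1 : measurable (D `\ 1%R) by exact: measurableD.
have mD10 : measurable ((D `\ 1%R) `\ 0%R) by exact: measurableD.
rewrite -(@integral_setD1 _ _ 0%R)// integral_leb//; last first.
  by move=> x _; rewrite lee_fin !mulr_ge0 ?powR_ge0// invr_ge0 Beta_ge0.
rewrite integral_mkcond [RHS]integral_mkcond; apply: eq_integral => x _.
rewrite !patchE /bdens.
have -> : (x \in (D `\ 1%R) `\ 0%R) = (x \in A) && (0 < x < 1)%R.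
  apply/idP/idP.
    rewrite inE => -[[[Ax]]]; rewrite /= in_itv/= => /andP[x0 x1] /eqP n1 /eqP n0.
    by rewrite mem_set//= !lt_neqAle x0 x1 n1 eq_sym n0.
  case/andP => /set_mem Ax /andP[x0 x1]; rewrite inE; split; first split.
  - by split => //=; rewrite in_itv/= !ltW.
  - by move=> /= xE; rewrite xE ltxx in x1.
  - by move=> /= xE; rewrite xE ltxx in x0.
case: (x \in A) => //=; case: ifPn => _; first by rewrite mulrA.
by rewrite mulr0.
Qed.

Section beta_measure.
Variables (a b : R) (a0 : (0 < a)%R) (b0 : (0 < b)%R).

Let w0 x : (0 <= (Beta a b)^-1 * bdens a b x)%R.
Proof. by rewrite mulr_ge0 ?bdens_ge0// invr_ge0 ltW// Beta_gt0. Qed.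

Let mw : measurable_fun setT (fun x => (Beta a b)^-1 * bdens a b x)%R.
Proof. by apply: measurable_funM => //; exact: measurable_bdens. Qed.

Definition beta_measure : set R -> \bar R := density mu w0 mw.

HB.instance Definition _ := Measure.on beta_measure.

Let beta_setT : beta_measure setT = 1.
Proof.
rewrite /beta_measure /density; under eq_integral do rewrite EFinM.
rewrite ge0_integralZl//; last 3 first.
- by apply/measurable_EFinP; exact: measurable_bdens.
- by move=> x _; rewrite lee_fin bdens_ge0.
- by rewrite lee_fin invr_ge0 ltW// Beta_gt0.
by rewrite -/(ebeta a b) ebetaE// -EFinM mulVf// gt_eqF// Beta_gt0.
Qed.

HB.instance Definition _ :=
  @Measure_isProbability.Build _ _ R beta_measure beta_setT.

Lemma beta_measureE A : measurable A -> beta_measure A = beta_law a b A.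
Proof. by move=> mA; rewrite beta_lawE. Qed.

Lemma ge0_integral_beta (f : R -> \bar R) :
  (forall x, 0 <= f x) -> measurable_fun setT f ->
  \int[beta_measure]_x f x =
  (Beta a b)^-1%:E * \int[mu]_x ((bdens a b x)%:E * f x).
Proof.
move=> f0 mf.
have -> : \int[beta_measure]_x f x =
    \int[mu]_x (((Beta a b)^-1 * bdens a b x)%:E * f x).
  exact: (@ge0_integral_density _ _ _ mu beta_measure).
rewrite -ge0_integralZl//; last 3 first.
- apply: (emeasurable_funM (f := fun x => (bdens a b x)%:E)) => //.
  by apply/measurable_EFinP; exact: measurable_bdens.
- by move=> x _; rewrite mule_ge0// lee_fin bdens_ge0.
- by rewrite lee_fin invr_ge0 ltW// Beta_gt0.
by apply: eq_integral => x _; rewrite muleA -EFinM.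
Qed.

End beta_measure.

End gamma_beta_laws.

Section beta_gamma_laws.
Context (R : realType) (a : R) (a0 : 0 < a).
Local Open Scope ereal_scope.
Local Notation beta := (beta_measure (@ltr01 R) a0).

Let G0 : (0 < Gamma a)%R. Proof. exact: Gamma_gt0. Qed.
Let a1 : (0 < 1 + a)%R. Proof. exact: addr_gt0. Qed.

Let GammaSE : (Gamma (1 + a) = a * Gamma a)%R. Proof. by rewrite addrC GammaS. Qed.

(** The factor x raises the exponent of the density by one, and Gamma(1 + a) = a Gamma(a) supplies
    the constant. The absolute value only matters on a null set. *)
Lemma gamma_law_size_bias (F : R -> \bar R) :
  (forall x, 0 <= F x) -> measurable_fun setT F ->
  \int[gamma_law a]_x (`|x|%:E * F x) = a%:E * \int[gamma_law (1 + a)]_x F x.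
Proof.
move=> F0 mF.
have mabs : measurable_fun setT (fun x : R => `|x|%:E * F x).
  by apply: emeasurable_funM => //; apply/measurable_EFinP; exact: (@normr_measurable R setT).
have abs0 x : 0 <= `|x|%:E * F x by rewrite mule_ge0// lee_fin.
apply: etrans (ge0_integral_gamma_law a0 abs0 mabs) _.
apply: etrans _ (esym (congr1 (mule a%:E) (ge0_integral_gamma_law a1 F0 mF))).
have -> : \int[@leb R]_x ((gdens a x)%:E * (`|x|%:E * F x)) =
    \int[@leb R]_x ((gdens (1 + a) x)%:E * F x).
  apply: eq_integral => x _; rewrite muleA -EFinM /gdens; congr (_%:E * _).
  case: ifPn => x0; last by rewrite mul0r.
  rewrite gtr0_norm// mulrAC; congr (_ * _)%R.
  have -> : (1 + a - 1 = (a - 1) + 1)%R by ring.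
  by rewrite [RHS]powRD ?powRr1 ?(ltW x0)// (gt_eqF x0) implybT.
rewrite muleA -EFinM GammaSE; congr (_%:E * _).
by move: (Gamma a) G0 => G G1; field; rewrite !gt_eqF.
Qed.

(** [beta_gamma_algebra] in probabilistic form: for independent Gamma(1) and Gamma(a) variables, the
    sum is Gamma(1 + a) and independent of the share of the first, which is Beta(1, a). The
    constants match because B(1, a) = 1/a. *)
Lemma gamma_law_add (f : R * R -> \bar R) :
  (forall p, 0 <= f p) -> measurable_fun setT f ->
  \int[gamma_law 1]_x \int[gamma_law a]_y f (x, y) =
  \int[gamma_law (1 + a)]_g \int[beta]_v f (g * v, g * (1 - v))%R.
Proof.
move=> f0 mf.
have mfx (x : R) : measurable_fun setT (fun y => f (x, y)).
  exact: (measurableT_comp mf (measurable_pair1 x)).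
pose f' (p : R * R) := f (p.1 * p.2, p.1 * (1 - p.2))%R.
have f'0 p : 0 <= f' p by exact: f0.
have mf' : measurable_fun setT f'.
  apply: (measurableT_comp mf); apply: measurable_fun_pair.
    by apply: measurable_funM; [exact: measurable_fst|exact: measurable_snd].
  apply: measurable_funM; first exact: measurable_fst.
  by apply: measurable_funB; [exact: measurable_cst|exact: measurable_snd].
have mfg (g : R) : measurable_fun setT (fun v => f' (g, v)).
  exact: (measurableT_comp mf' (measurable_pair1 g)).
pose I x := \int[@leb R]_y ((gdens a y)%:E * f (x, y)).
have I0 x : 0 <= I x.
  by apply: integral_ge0 => y _; rewrite mule_ge0// lee_fin gdens_ge0.
have mI : measurable_fun setT I.
  have := @measurable_fun_fubini_tonelli_F _ _ _ _ R (@leb R)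
    (fun p : R * R => (gdens a p.2)%:E * f p).
  apply; last by move=> p; rewrite mule_ge0// lee_fin gdens_ge0.
  apply: emeasurable_funM; last exact: mf.
  by apply/measurable_EFinP; exact: (measurableT_comp (measurable_gdens a) measurable_snd).
pose B g := \int[beta]_v f' (g, v).
have B0 g : 0 <= B g by exact: integral_ge0.
have mB : measurable_fun setT B.
  have := @measurable_fun_fubini_tonelli_F _ _ _ _ R beta f'; exact.
have Ginv0 : (0 <= (Gamma a)^-1)%R by rewrite invr_ge0 ltW.
have E1 : \int[gamma_law 1]_x \int[gamma_law a]_y f (x, y) =
    \int[gamma_law 1]_x ((Gamma a)^-1%:E * I x).
  apply: eq_integral => x _.
  exact: (ge0_integral_gamma_law a0 (fun y => f0 (x, y)) (mfx x)).
have E2 := ge0_mulr_integral (gamma_law 1) Ginv0 I0 mI.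
have E3 := ge0_integral_gamma_law (@ltr01 R) I0 mI.
rewrite Gamma1 invr1 mul1e (@beta_gamma_algebra R 1 a f f0 mf) in E3.
rewrite E3 in E2; apply: etrans E1 (etrans (esym E2) _).
apply: etrans _ (esym (ge0_integral_gamma_law a1 B0 mB)).
have ainv0 : (0 <= a^-1)%R by rewrite invr_ge0 ltW.
have -> : \int[@leb R]_g ((gdens (1 + a) g)%:E *
      \int[@leb R]_v ((bdens 1 a v)%:E * f (g * v, g * (1 - v))%R)) =
    \int[@leb R]_g ((a^-1)%:E * ((gdens (1 + a) g)%:E * B g)).
  apply: eq_integral => g _; rewrite [RHS]muleCA; congr (_ * _).
  rewrite /B (ge0_integral_beta (@ltr01 R) a0 (fun v => f'0 (g, v)) (mfg g)) muleA -EFinM.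
  have -> : (a^-1 * (Beta 1 a)^-1 = 1 :> R)%R.
    rewrite /Beta Gamma1 GammaSE; move: (Gamma a) G0 => G G1.
    by field; rewrite !gt_eqF.
  by rewrite mul1e.
rewrite -ge0_mulr_integral//; last 2 first.
- by move=> g; rewrite mule_ge0// lee_fin gdens_ge0.
- by apply: emeasurable_funM => //; apply/measurable_EFinP; exact: measurable_gdens.
by rewrite muleA -EFinM GammaSE invfM [(a^-1 * _)%R]mulrC.
Qed.

End beta_gamma_laws.

(** * Determination of laws *)

Section tuple_laws.
Context (R : realType) (n : nat).
Local Open Scope ereal_scope.

(** Lower orthants, on which a law is its multivariate distribution function. *)
Definition halfspaces (s : 'I_n -> R) : set (n.-tuple R) :=
  [set x | forall i, (tnth x i <= s i)%R].

Lemma measurable_halfspaces s : measurable (halfspaces s).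
Proof.
have -> : halfspaces s = \bigcap_(i in [set: 'I_n]) ((@tnth n R ^~ i) @^-1` `]-oo, s i]).
  apply/seteqP; split => [x xs i _|x xs i]; rewrite /= ?in_itv/=; first exact: xs.
  by have := xs i Logic.I; rewrite /= in_itv.
apply: fin_bigcap_measurable => // i _.
rewrite -[X in measurable X]setTI.
exact: (@measurable_tnth _ _ n i measurableT _ (measurable_itv _)).
Qed.

Lemma measurable_tupleE :
  @measurable _ (n.-tuple R) = <<s range halfspaces >>.
Proof.
apply/seteqP; split; last first.
  apply: smallest_sub; first exact: sigma_algebra_measurable.
  by move=> _ [s _ <-]; exact: measurable_halfspaces.
pose id' : g_sigma_algebraType (range halfspaces) -> n.-tuple R := id.
suff mid : measurable_fun setT id'.
  by move=> A mA; have := mid measurableT A mA; rewrite setTI.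
apply/measurable_fun_tnthP => i.
apply: (@measurability _ _ _ _ setT _ (@RGenOInfty.G R)).
  exact: RGenOInfty.measurableE.
move=> _ [_ [r ->] <-]; rewrite setTI.
(* A condition on the single coordinate i is recovered by letting the bounds on all other
   coordinates grow through the naturals. *)
have -> : (fun x : g_sigma_algebraType (range halfspaces) => tnth (id' x) i) @^-1` `]r, +oo[ =
    ~` \bigcup_k halfspaces (fun j => if j == i then r else k%:R).
  apply/seteqP; split => x; rewrite /= in_itv/= andbT.
    by move=> rx [k _] /(_ i); rewrite eqxx leNgt rx.
  move=> nx; rewrite ltNge; apply/negP => xr; apply: nx.
  exists (Num.truncn (\sum_j `|tnth x j|)%R).+1 => // j.
  case: eqP => [->//|_]; rewrite (le_trans (ler_norm _))// ltW//.
  apply: le_lt_trans (truncnS_gt _).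
  by rewrite (bigD1 j)//= lerDl sumr_ge0.
apply: measurableC; apply: bigcupT_measurable => k.
by apply: sub_sigma_algebra; eexists.
Qed.

(** A Lipschitz stand-in for the indicator of the orthant at s: it is 1 there and falls off with
    slope k in the l1 excess over s. *)
Definition box_fun (k : R) (s : 'I_n -> R) (x : n.-tuple R) : R :=
  Num.max 0%R (1 - k * \sum_i Num.max 0%R (tnth x i - s i))%R.

Lemma box_fun_ge0 k s x : (0 <= box_fun k s x)%R.
Proof. by rewrite /box_fun le_max lexx. Qed.

Lemma measurable_box_fun k s : measurable_fun setT (box_fun k s).
Proof.
have mt i : measurable_fun setT (fun x : n.-tuple R => tnth x i).
  exact: measurable_tnth.
apply: measurable_maxr; first exact: measurable_cst.
apply: measurable_funB; first exact: measurable_cst.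
apply: measurable_funM; first exact: measurable_cst.
apply: measurable_sum => i; apply: measurable_maxr; first exact: measurable_cst.
by apply: measurable_funB; [exact: mt|exact: measurable_cst].
Qed.

Lemma ge0_le_max0 (a b : R) : (`|Num.max 0 a - Num.max 0 b| <= `|a - b|)%R.
Proof.
wlog ab : a b / (a <= b)%R.
  by move=> H; case/orP: (le_total a b) => ?; [|rewrite distrC (distrC a)]; exact: H.
rewrite distrC (distrC a) !ger0_norm ?subr_ge0 ?ge_max ?le_max ?lexx ?ab ?orbT//.
by rewrite !maxEle; case: ifP; case: ifP; lra.
Qed.

Lemma box_fun_lip k s x y : (0 <= k)%R ->
  (box_fun k s x <= box_fun k s y + k * \sum_i `|tnth x i - tnth y i|)%R.
Proof.
move=> k0; rewrite -lerBlDl (le_trans (ler_norm _))// (le_trans (ge0_le_max0 _ _))//.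
set a := (\sum_i _)%R; set b := (X in (k * X)%R).
have -> : (1 - k * a - (1 - k * (\sum_i Num.max 0%R (tnth y i - s i))) =
  k * \sum_i (Num.max 0%R (tnth y i - s i) - Num.max 0%R (tnth x i - s i)))%R.
  by rewrite sumrB /a; ring.
rewrite normrM ger0_norm// ler_wpM2l// (le_trans (ler_norm_sum _ _ _))// ler_sum// => i _.
rewrite (le_trans (ge0_le_max0 _ _))//.
have -> : (tnth y i - s i - (tnth x i - s i) = tnth y i - tnth x i)%R by ring.
by rewrite distrC.
Qed.

Lemma box_fun_ge_indic k s x : halfspaces s x -> box_fun k s x = 1%R.
Proof.
move=> xs; rewrite /box_fun big1 ?mulr0 ?subr0; first by apply/max_idPr.
by move=> i _; apply/max_idPl; rewrite subr_le0.
Qed.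

Lemma box_fun_le_indic k s x : (0 < k)%R ->
  (box_fun k s x <= \1_(halfspaces (fun i => s i + k^-1)) x)%R.
Proof.
move=> k0; rewrite indicE; case: (boolP (x \in _)) => /= [_|/negP xs].
  by rewrite /box_fun ge_max ler01 gerBl mulr_ge0 ?(ltW k0)// sumr_ge0// => i _;
    rewrite le_max lexx.
rewrite /box_fun ge_max lexx subr_le0 leNgt; apply/negP => lt1; apply: xs.
rewrite inE => i; rewrite -lerBlDl; apply: ltW.
have : (Num.max 0 (tnth x i - s i) < k^-1)%R.
  rewrite -(ltr_pM2l k0) divff ?gt_eqF//; apply: le_lt_trans lt1.
  rewrite ler_wpM2l ?(ltW k0)// (bigD1 i)//= lerDl sumr_ge0// => j _.
  by rewrite le_max lexx.
by rewrite gt_max => /andP[].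
Qed.

(** [box_fun k s] lies between the indicators of the orthants at s and at s + 1/k. The first bound
    is used under [m1], the second under [m2], and k tends to infinity by continuity from above. *)
Lemma tuple_prob_le_halfspaces (m1 m2 : probability (n.-tuple R) R) s :
  (forall k s, (0 <= k)%R ->
    \int[m1]_x (box_fun k s x)%:E = \int[m2]_x (box_fun k s x)%:E) ->
  m1 (halfspaces s) <= m2 (halfspaces s).
Proof.
move=> m12.
pose F k := halfspaces (fun i => s i + k.+1%:R^-1)%R.
have mF k : measurable (F k) by exact: measurable_halfspaces.
have FE : \bigcap_k F k = halfspaces s.
  apply/seteqP; split => [x Fx i|x xs k _ i]; last first.
    by rewrite ler_wpDr.
  apply/ler_addgt0Pr => e e0.
  have := Fx (Num.truncn e^-1) Logic.I i; move/le_trans; apply.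
  rewrite lerD2l -(invrK e) lef_pV2 ?posrE ?invr_gt0// ltW//.
  by rewrite invrK; exact: truncnS_gt.
have : m2 \o F @ \oo --> m2 (halfspaces s).
  rewrite -FE; apply: nonincreasing_cvg_mu => //.
  - by rewrite (le_lt_trans (probability_le1 _ _))// ltry.
  - by rewrite FE; exact: measurable_halfspaces.
  - move=> a b ab; rewrite subsetEset => x Fx i; apply: le_trans (Fx i) _.
    by rewrite lerD2l lef_pV2 ?posrE// ler_nat.
move=> cvgF; rewrite -(cvg_lim _ cvgF)//; apply: lime_ge; first by apply/cvg_ex; eexists; exact: cvgF.
apply: nearW => k /=.
have mb (l : R) : measurable_fun setT (fun x => (box_fun l s x)%:E).
  by apply/measurable_EFinP; exact: measurable_box_fun.
apply: (@le_trans _ _ (\int[m1]_x (box_fun k.+1%:R s x)%:E)).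
  rewrite -(setIT (halfspaces s)) -integral_indic//; last exact: measurable_halfspaces.
  apply: ge0_le_integral => //.
  - by apply/measurable_EFinP; apply: measurable_indic; exact: measurable_halfspaces.
  - move=> x _; rewrite lee_fin indicE; case: (boolP (x \in _)) => /=.
      by rewrite inE => xs; rewrite box_fun_ge_indic.
    by move=> _; exact: box_fun_ge0.
rewrite m12// -(setIT (F k)) -integral_indic//.
apply: ge0_le_integral => //.
- by move=> x _; rewrite lee_fin box_fun_ge0.
- by apply/measurable_EFinP; exact: measurable_indic.
- by move=> x _; rewrite lee_fin box_fun_le_indic.
Qed.

(** Orthants form a generating class stable under intersection, so equality on them suffices; the
    orthants at (k, ..., k) exhaust the space. *)
Lemma tuple_prob_eq (m1 m2 : probability (n.-tuple R) R) :
  (forall k s, (0 <= k)%R ->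
    \int[m1]_x (box_fun k s x)%:E = \int[m2]_x (box_fun k s x)%:E) ->
  forall A, measurable A -> m1 A = m2 A.
Proof.
move=> m12.
apply: (measure_unique (range halfspaces) (fun k => halfspaces (fun=> k%:R))).
- exact: measurable_tupleE.
- move=> _ _ [s _ <-] [t _ <-]; exists (fun i => Num.min (s i) (t i)) => //.
  apply/seteqP; split => [x xst|x [xs xt] i]; last by rewrite le_min xs xt.
  by split => i; have := xst i; rewrite le_min => /andP[].
- by move=> k; eexists.
- rewrite -subTset => x _; exists (Num.truncn (\sum_j `|tnth x j|)%R).+1 => // j.
  rewrite (le_trans (ler_norm _))// ltW//.
  apply: le_lt_trans (truncnS_gt _).
  by rewrite (bigD1 j)//= lerDl sumr_ge0.
- move=> _ [s _ <-]; apply/eqP; rewrite eq_le !tuple_prob_le_halfspaces// => k t k0.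
  by rewrite m12.
- by move=> k; rewrite (le_lt_trans (probability_le1 _ (measurable_halfspaces _)))// ltry.
Qed.

End tuple_laws.

(** * Bernstein polynomials, and laws on the unit interval determined by their moments *)

Section bernstein.
Context (R : realType).

(* [bern x n g] is the Bernstein polynomial [\sum_k 'C(n, k) x^k (1-x)^(n-k) g k]
   at x, evaluated by conditioning on the first of n Bernoulli trials. *)
Fixpoint bern (x : R) (n : nat) (g : nat -> R) : R :=
  if n is m.+1 then x * bern x m (g \o succn) + (1 - x) * bern x m g else g 0.

Lemma bernD x n g h : bern x n (fun k => g k + h k) = bern x n g + bern x n h.
Proof.
elim: n g h => //= n IH g h.
by rewrite IH (IH (g \o succn) (h \o succn)); ring.
Qed.

Lemma bernZ x n c g : bern x n (fun k => c * g k) = c * bern x n g.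
Proof.
elim: n g => //= n IH g.
by rewrite IH (IH (g \o succn)); ring.
Qed.

Lemma bern_cst x n c : bern x n (fun=> c) = c.
Proof. by elim: n => //= n IH; rewrite [X in x * X]IH IH; ring. Qed.

Lemma bern_le x n g h : 0 <= x <= 1 -> (forall k, g k <= h k) ->
  bern x n g <= bern x n h.
Proof.
case/andP => x0 x1; elim: n g h => [|n IH] g h gh /=; first exact: gh.
by rewrite lerD// ler_wpM2l ?subr_ge0// IH// => k; exact: gh.
Qed.

(** The second moment of a centred binomial variable plus t. The shift t is what makes the induction
    close: conditioning on the first trial replaces t by t + 1 - x or t - x. *)
Lemma bern_var x n t :
  bern x n (fun k => (k%:R - n%:R * x + t) ^+ 2) = n%:R * (x * (1 - x)) + t ^+ 2.
Proof.
elim: n t => [|n IH] t /=; first by rewrite !mul0r subrr !add0r.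
have -> : (fun k => (k%:R - n.+1%:R * x + t) ^+ 2) \o succn =
    (fun k => (k%:R - n%:R * x + (t + 1 - x)) ^+ 2).
  by apply/funext => k /=; rewrite -!natr1; ring.
have -> : (fun k => (k%:R - n.+1%:R * x + t) ^+ 2) =
    (fun k => (k%:R - n%:R * x + (t - x)) ^+ 2) :> (nat -> R).
  by apply/funext => k /=; rewrite -!natr1; ring.
by rewrite !IH -natr1; ring.
Qed.

(** The error is at most L times the binomial mean of |k/n - x|, which is of order the inverse
    square root of n. Taking n a perfect square turns this into L/(N+1) without roots. *)
Lemma bern_approx (L : R) (f : R -> R) (N : nat) (x : R) : 0 <= L ->
  (forall x y, f x <= f y + L * `|x - y|) -> 0 <= x <= 1 ->
  let n := (N.+1 ^ 2)%N in let g k := f (k%:R / n%:R) in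
  f x <= bern x n g + L / N.+1%:R /\ bern x n g <= f x + L / N.+1%:R.
Proof.
move=> L0 fL x01 n g.
have N0 : 0 < N.+1%:R :> R by [].
have nE : n%:R = N.+1%:R ^+ 2 :> R by rewrite natrX.
(* Cauchy-Schwarz in the form |t| <= (1/N + N t^2) / 2 *)
pose e k : R := L / 2 * (N.+1%:R^-1 + N.+1%:R * (k%:R / n%:R - x) ^+ 2).
have absle k : L * `|k%:R / n%:R - x| <= e k.
  rewrite /e -mulrA ler_wpM2l// ler_pdivlMl//.
  set t := _ - x; rewrite -subr_ge0.
  have -> : t ^+ 2 = `|t| ^+ 2 by rewrite real_normK ?num_real.
  have -> : N.+1%:R^-1 + N.+1%:R * `|t| ^+ 2 - 2 * `|t| =
      N.+1%:R^-1 * (1 - N.+1%:R * `|t|) ^+ 2 by field.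
  by rewrite mulr_ge0 ?invr_ge0 ?sqr_ge0 ?ler0n.
have bern_e : bern x n e <= L / N.+1%:R.
  rewrite /e bernZ bernD bern_cst bernZ.
  have -> : (fun k => (k%:R / n%:R - x) ^+ 2) =
      (fun k => (n%:R ^+ 2)^-1 * (k%:R - n%:R * x + 0) ^+ 2) :> (nat -> R).
    by apply/funext => k; rewrite nE; field.
  rewrite bernZ bern_var expr0n addr0 nE.
  have -> : L / N.+1%:R = L / 2 * (N.+1%:R^-1 + N.+1%:R^-1) by field.
  rewrite ler_wpM2l ?divr_ge0// lerD2l.
  have -> : N.+1%:R * ((N.+1%:R ^+ 2 ^+ 2)^-1 * (N.+1%:R ^+ 2 * (x * (1 - x)))) =
      N.+1%:R^-1 * (x * (1 - x)) :> R by field.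
  case/andP: x01 => x0 x1.
  by rewrite ler_piMr ?invr_ge0// mulr_ile1 ?subr_ge0// gerBl.
split.
  rewrite -[leLHS](bern_cst x n) (le_trans _ (lerD (lexx _) bern_e))// -bernD.
  by apply: bern_le => // k; rewrite (le_trans (fL _ (k%:R / n%:R)))// lerD2l distrC.
apply: le_trans (lerD (lexx (f x)) bern_e); rewrite -[X in _ <= X + _](bern_cst x n) -bernD.
by apply: bern_le => // k; rewrite (le_trans (fL _ x))// lerD2l.
Qed.

End bernstein.

Section law.
Context d d' (T1 : measurableType d) (T2 : measurableType d') (R : realType).
Variables (P : probability T1 R) (f : T1 -> T2) (mf : measurable_fun setT f).

Definition law : probability T2 R :=
  distribution P (HB.pack f (isMeasurableFun.Build _ _ _ _ _ mf) : {mfun T1 >-> T2}).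

Lemma lawE A : law A = P (f @^-1` A).
Proof. by []. Qed.

Lemma ge0_integral_law (h : T2 -> \bar R) : (forall x, 0 <= h x)%E ->
  measurable_fun setT h -> (\int[law]_x h x = \int[P]_x h (f x))%E.
Proof. by move=> h0 mh; rewrite /law ge0_integral_distribution. Qed.

End law.

Section ae_tools.
Context d (T : measurableType d) (R : realType) (m : probability T R).
Local Open Scope ereal_scope.

Lemma ge0_le_integral_full (S : set T) (f g : T -> \bar R) :
  measurable S -> m S = 1 ->
  (forall x, 0 <= f x) -> measurable_fun setT f ->
  (forall x, 0 <= g x) -> measurable_fun setT g ->
  (forall x, S x -> f x <= g x) -> \int[m]_x f x <= \int[m]_x g x.
Proof.
move=> mS mS1 f0 mf g0 mg fg; apply: ae_ge0_le_integral => //.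
exists (~` S); split; first exact: measurableC.
  by have /= -> := probability_setC m mS; rewrite mS1 subee.
by move=> x /= nfg Sx; apply: nfg => _; exact: fg.
Qed.

Lemma ge0_eq_integral_full (S : set T) (f g : T -> \bar R) :
  measurable S -> m S = 1 ->
  (forall x, 0 <= f x) -> measurable_fun setT f ->
  (forall x, 0 <= g x) -> measurable_fun setT g ->
  (forall x, S x -> f x = g x) -> \int[m]_x f x = \int[m]_x g x.
Proof.
move=> mS mS1 f0 mf g0 mg fg; apply/eqP; rewrite eq_le.
by rewrite !(ge0_le_integral_full mS mS1)// => x Sx; rewrite fg.
Qed.

Lemma integral_prob_cst (c : \bar R) : \int[m]_x c = c.
Proof. by rewrite integral_cst// [X in _ * X]probability_setT mule1. Qed.

End ae_tools.

Section moments.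
Context (R : realType).
Local Open Scope ereal_scope.

Lemma measurable_bern n (g : nat -> R) : measurable_fun setT (fun x : R => bern x n g).
Proof.
elim: n g => [|n IH] g /=; first exact: measurable_cst.
apply: measurable_funD; apply: measurable_funM; [exact: measurable_id|exact: IH| |exact: IH].
by apply: measurable_funB; [exact: measurable_cst|exact: measurable_id].
Qed.

Lemma measurable_XMonemXE k l : measurable_fun setT (fun x : R => (x ^+ k * (1 - x) ^+ l)%R).
Proof.
apply: measurable_funM; apply: measurable_funX; first exact: measurable_id.
by apply: measurable_funB; [exact: measurable_cst|exact: measurable_id].
Qed.

Lemma bern_ge0 (x : R) n g : (0 <= x <= 1)%R -> (forall k, 0 <= g k)%R -> (0 <= bern x n g)%R.
Proof.
by move=> x01 g0; rewrite -(bern_cst x n 0%R) bern_le.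
Qed.

Lemma itv01P (x : R) : `[0%R, 1%R]%classic x -> (0 <= x <= 1)%R.
Proof. by rewrite /= in_itv. Qed.

(** Using the mixed moments of x and 1 - x, rather than pure powers, writes the Bernstein polynomial
    of a nonnegative function as a nonnegative combination, so no integral is ever subtracted.
    Approximation then reaches Lipschitz functions, among them [box_fun]. *)
Lemma prob01_eq (m1 m2 : probability R R) :
  (forall k l, \int[m1]_(x in `[0%R, 1%R]) (x ^+ k * (1 - x) ^+ l)%:E =
               \int[m2]_(x in `[0%R, 1%R]) (x ^+ k * (1 - x) ^+ l)%:E) ->
  m1 `[0%R, 1%R]%classic = 1 -> m2 `[0%R, 1%R]%classic = 1 ->
  forall A, measurable A -> m1 A = m2 A.
Proof.
move=> m12 m1I m2I; set I : set R := `[0%R, 1%R]%classic.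
have mI : measurable I by exact: measurable_itv.
have bernE n : forall (g : nat -> R) k l, (forall i, 0 <= g i)%R ->
    \int[m1]_(x in I) (x ^+ k * (1 - x) ^+ l * bern x n g)%:E =
    \int[m2]_(x in I) (x ^+ k * (1 - x) ^+ l * bern x n g)%:E.
  elim: n => [|n IH] g k l g0 /=.
    have E (m : probability R R) : \int[m]_(x in I) (x ^+ k * (1 - x) ^+ l * g 0%N)%:E =
        (g 0%N)%:E * \int[m]_(x in I) (x ^+ k * (1 - x) ^+ l)%:E.
      rewrite -ge0_integralZl//.
      - by apply: eq_integral => x _; rewrite mulrC EFinM.
      - by apply/measurable_EFinP/measurable_funTS; exact: measurable_XMonemXE.
      - by move=> x /itv01P/andP[x0 x1]; rewrite lee_fin mulr_ge0 ?exprn_ge0// subr_ge0.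
      - by rewrite lee_fin.
    by rewrite !E m12.
  have E (m : probability R R) :
      \int[m]_(x in I) (x ^+ k * (1 - x) ^+ l *
         (x * bern x n (g \o succn) + (1 - x) * bern x n g))%:E =
      \int[m]_(x in I) (x ^+ k.+1 * (1 - x) ^+ l * bern x n (g \o succn))%:E +
      \int[m]_(x in I) (x ^+ k * (1 - x) ^+ l.+1 * bern x n g)%:E.
    rewrite -ge0_integralD//.
    - by apply: eq_integral => x _; rewrite -EFinD !exprS; congr EFin; ring.
    - move=> x /itv01P x01; case/andP: (x01) => x0 x1.
      by rewrite lee_fin !mulr_ge0 ?exprn_ge0 ?subr_ge0// bern_ge0// => i; exact: g0.
    - apply/measurable_EFinP/measurable_funTS/measurable_funM.
        exact: measurable_XMonemXE.
      exact: measurable_bern.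
    - move=> x /itv01P x01; case/andP: (x01) => x0 x1.
      by rewrite lee_fin !mulr_ge0 ?exprn_ge0 ?subr_ge0// bern_ge0.
    - apply/measurable_EFinP/measurable_funTS/measurable_funM.
        exact: measurable_XMonemXE.
      exact: measurable_bern.
  by rewrite !E IH ?IH// => i; exact: g0.
have lipE (f : R -> R) L : (0 <= L)%R -> (forall x, 0 <= f x)%R -> measurable_fun setT f ->
    (forall x y, f x <= f y + L * `|x - y|)%R ->
    \int[m1]_x (f x)%:E = \int[m2]_x (f x)%:E.
  move=> L0 f0 mf fL.
  have le12 (p q : probability R R) : p I = 1 -> q I = 1 ->
      (forall n (g : nat -> R), (forall i, 0 <= g i)%R ->
         \int[p]_(x in I) (bern x n g)%:E = \int[q]_(x in I) (bern x n g)%:E) ->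
      \int[p]_x (f x)%:E <= \int[q]_x (f x)%:E.
    move=> pI qI pq; apply/lee_addgt0Pr => e e0.
    (* The approximation is used twice, once under each law, at cost L/(N+1) each time; this choice
       keeps the total below e. *)
    pose N := Num.truncn (L * 2 / e).
    have LN : (L / N.+1%:R + L / N.+1%:R <= e)%R.
      have := truncnS_gt (L * 2 / e); rewrite -/N => lt.
      rewrite -mulrDl ler_pdivrMr// mulrC -ler_pdivrMr// ltW//.
      by rewrite (_ : (L + L = L * 2)%R)//; ring.
    have mfI : measurable_fun I (fun x => (f x)%:E).
      exact/measurable_EFinP/measurable_funTS.
    have fI (m : probability R R) : m I = 1 ->
        \int[m]_(x in I) (f x)%:E = \int[m]_x (f x)%:E.
      move=> mI1; rewrite integral_mkcond; apply: (ge0_eq_integral_full mI mI1).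
      - by move=> x; apply: erestrict_ge0 => y _; rewrite lee_fin.
      - exact/(measurable_restrictT _ mI).
      - by move=> x; rewrite lee_fin.
      - exact/measurable_EFinP.
      - by move=> x Ix; rewrite patchE mem_set.
    rewrite -(fI p pI) -(fI q qI).
    set n := (N.+1 ^ 2)%N; pose g k := f (k%:R / n%:R)%R.
    have g0 k : (0 <= g k)%R by exact: f0.
    have mB : measurable_fun I (fun x => (bern x n g)%:E).
      by apply/measurable_EFinP/measurable_funTS; exact: measurable_bern.
    have cI (m : probability R R) (h : R -> \bar R) (c : R) : m I = 1 -> (0 <= c)%R ->
        (forall x, I x -> 0 <= h x) -> measurable_fun I h ->
        \int[m]_(x in I) (h x + c%:E) = \int[m]_(x in I) h x + c%:E.
      move=> mI1 c0 h0 mh; rewrite ge0_integralD//.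
      by rewrite integral_cst// [X in _ * X]mI1 mule1.
    have Lc : (0 <= L / N.+1%:R)%R by rewrite divr_ge0.
    apply: (@le_trans _ _ (\int[p]_(x in I) ((bern x n g)%:E + (L / N.+1%:R)%:E))).
      apply: ge0_le_integral => //.
      - by move=> x _; rewrite lee_fin.
      - exact: emeasurable_funD.
      - move=> x /itv01P x01; rewrite -EFinD lee_fin.
        by have [] := bern_approx N L0 fL x01.
    rewrite cI//; last by move=> x /itv01P x01; rewrite lee_fin bern_ge0.
    rewrite pq//.
    apply: (@le_trans _ _ (\int[q]_(x in I) ((f x)%:E + (L / N.+1%:R)%:E) + (L / N.+1%:R)%:E)).
      rewrite leeD2r//; apply: ge0_le_integral => //.
      - by move=> x /itv01P x01; rewrite lee_fin bern_ge0.
      - exact: emeasurable_funD.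
      - move=> x /itv01P x01; rewrite -EFinD lee_fin.
        by have [] := bern_approx N L0 fL x01.
    rewrite cI//; last by move=> x _; rewrite lee_fin.
    by rewrite -addeA leeD2l// -EFinD lee_fin.
  have bernE0 n (g : nat -> R) : (forall i, 0 <= g i)%R ->
      \int[m1]_(x in I) (bern x n g)%:E = \int[m2]_(x in I) (bern x n g)%:E.
    move=> g0; have := bernE n g 0%N 0%N g0.
    under eq_integral do rewrite !expr0 !mul1r.
    by under [in X in _ = X -> _]eq_integral do rewrite !expr0 !mul1r.
  by apply/eqP; rewrite eq_le !le12// => n g g0; rewrite bernE0.
(* A real law is viewed as a law on 1-tuples so that [tuple_prob_eq] applies; there [box_fun] is
   Lipschitz with constant k. *)
have mt : measurable_fun setT (fun x : R => [tuple x] : 1.-tuple R).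
  apply/measurable_fun_tnthP => i; rewrite (_ : _ \o _ = id) //.
  by apply/funext => x /=; rewrite ord1 tnth0.
move=> A mA.
pose h (t : 1.-tuple R) := thead t.
have mh : measurable_fun setT h by exact: (@measurable_tnth _ _ 1 ord0).
have AE : A = (fun x : R => [tuple x] : 1.-tuple R) @^-1` (h @^-1` A).
  by apply/seteqP; split => x /=; rewrite /h theadE.
rewrite AE -!(lawE _ mt); apply: tuple_prob_eq; last first.
  by rewrite -[X in measurable X]setTI; exact: mh.
move=> k s k0.
have b0 (x : 1.-tuple R) : 0 <= (box_fun k s x)%:E by rewrite lee_fin box_fun_ge0.
have mb : measurable_fun setT (fun x : 1.-tuple R => (box_fun k s x)%:E).
  by apply/measurable_EFinP; exact: measurable_box_fun.
rewrite (ge0_integral_law m1 mt b0 mb) (ge0_integral_law m2 mt b0 mb).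
apply: (lipE (fun x => box_fun k s [tuple x]) k k0).
- by move=> x; exact: box_fun_ge0.
- exact: (measurableT_comp (measurable_box_fun k s) mt).
- move=> x y; rewrite (le_trans (box_fun_lip _ _ [tuple y] k0))//.
  by rewrite big_ord1 !tnth0.
Qed.

End moments.

(** * Contracting random affine maps *)

Definition tmix (R : realType) n (v : R) (u x : n.-tuple R) : n.-tuple R :=
  [tuple v * tnth u i + (1 - v) * tnth x i | i < n].

Section contraction.
Context (R : realType) (n : nat) d (Om : measurableType d) (P : probability Om R).
Variables (V : Om -> R) (U : Om -> n.-tuple R).
Hypotheses (mV : measurable_fun setT V) (mU : measurable_fun setT U).
Hypothesis V01 : forall w, 0 <= V w <= 1.
Variable r : R.
Hypotheses (r_ge0 : 0 <= r) (r_lt1 : r < 1).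
Local Open Scope ereal_scope.
Hypothesis EV : \int[P]_w (1 - V w)%:E <= r%:E.

Lemma measurable_tmix d' (S : measurableType d') (v : S -> R) (u x : S -> n.-tuple R) :
  measurable_fun setT v -> measurable_fun setT u -> measurable_fun setT x ->
  measurable_fun setT (fun s => tmix (v s) (u s) (x s)).
Proof.
move=> mv mu mx; apply/measurable_fun_tnthP => i.
rewrite (_ : _ \o _ = fun s => v s * tnth (u s) i + (1 - v s) * tnth (x s) i)%R; last first.
  by apply/funext => s /=; rewrite tnth_mktuple.
have mt (y : S -> n.-tuple R) : measurable_fun setT y ->
    measurable_fun setT (fun s => tnth (y s) i).
  exact: measurableT_comp (measurable_tnth i).
apply: measurable_funD; apply: measurable_funM; [exact: mv|exact: mt| |exact: mt].
by apply: measurable_funB; [exact: measurable_cst|exact: mv].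
Qed.

(** The Markov operator of the random affine map: a law is invariant under the map when [f] and
    [mixop f] have the same integral. *)
Definition mixop (f : n.-tuple R -> \bar R) (x : n.-tuple R) : \bar R :=
  \int[P]_w f (tmix (V w) (U w) x).

Let dist (x y : n.-tuple R) : R := (\sum_i `|tnth x i - tnth y i|)%R.

Let lip (c : R) (f : n.-tuple R -> \bar R) := forall x y, f x <= f y + (c * dist x y)%:E.

Lemma mixop_ge0 f x : (forall x, 0 <= f x) -> 0 <= mixop f x.
Proof. by move=> f0; apply: integral_ge0. Qed.

Lemma measurable_mixop f : (forall x, 0 <= f x) -> measurable_fun setT f ->
  measurable_fun setT (mixop f).
Proof.
move=> f0 mf.
apply: (@measurable_fun_fubini_tonelli_F _ _ _ _ R P
  (fun p : n.-tuple R * Om => f (tmix (V p.2) (U p.2) p.1))) => //.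
apply: (measurableT_comp mf); apply: measurable_tmix.
- exact: measurableT_comp mV measurable_snd.
- exact: measurableT_comp mU measurable_snd.
- exact: measurable_fst.
Qed.

Let measurable_section (f : n.-tuple R -> \bar R) x : measurable_fun setT f ->
  measurable_fun setT (fun w => f (tmix (V w) (U w) x)).
Proof.
move=> mf; apply: (measurableT_comp mf); apply: measurable_tmix => //.
Qed.

Let m1V : measurable_fun setT (fun w => (1 - V w)%:E).
Proof. by apply/measurable_EFinP; apply: measurable_funB. Qed.

Let oneV w : (0 <= 1 - V w)%R.
Proof. by rewrite subr_ge0; case/andP: (V01 w). Qed.

(** At a fixed w the term in U cancels in the difference of two images, which leaves (1 - V)(x - y);
    averaging over w costs the factor r. *)
Let lip_mixop c f : (0 <= c)%R -> (forall x, 0 <= f x) -> measurable_fun setT f ->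
  lip c f -> lip (c * r) (mixop f).
Proof.
move=> c0 f0 mf lf x y.
have d0 : (0 <= c * dist x y)%R by rewrite mulr_ge0// sumr_ge0.
apply: (@le_trans _ _ (\int[P]_w
    (f (tmix (V w) (U w) y) + (c * dist x y)%:E * (1 - V w)%:E))).
  apply: ge0_le_integral => //.
  - exact: measurable_section.
  - apply: emeasurable_funD; first exact: measurable_section.
    exact: emeasurable_funM.
  - move=> w _; apply: le_trans (lf _ (tmix (V w) (U w) y)) _.
    rewrite leeD2l// -EFinM lee_fin -mulrA ler_wpM2l//.
    rewrite /dist mulr_suml ler_sum// => i _; rewrite !tnth_mktuple.
    rewrite (_ : _ - _ = (1 - V w) * (tnth x i - tnth y i))%R; last by ring.
    by rewrite normrM ger0_norm// mulrC.
rewrite ge0_integralD//; last 3 first.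
- exact: measurable_section.
- by move=> w _; rewrite mule_ge0// lee_fin.
- exact: emeasurable_funM.
rewrite leeD2l// -ge0_mulr_integral//.
rewrite (_ : c * r * dist x y = c * dist x y * r)%R; last by ring.
rewrite [leRHS]EFinM; apply: lee_wpmul2l; last exact: EV.
by rewrite lee_fin.
Qed.

(** A c-Lipschitz function varies by at most cC on the common carrier S. Replacing it k times by its
    [mixop] leaves both integrals unchanged and shrinks this bound to c r^k C. The inequality is
    one-sided because the integrals may be infinite. *)
Lemma contraction_le (m1 m2 : probability (n.-tuple R) R) (S : set (n.-tuple R)) (C : R) :
  (forall f, (forall x, 0 <= f x) -> measurable_fun setT f ->
     \int[m1]_x f x = \int[m1]_x mixop f x) ->
  (forall f, (forall x, 0 <= f x) -> measurable_fun setT f ->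
     \int[m2]_x f x = \int[m2]_x mixop f x) ->
  measurable S -> m1 S = 1 -> m2 S = 1 -> (0 <= C)%R ->
  (forall x y, S x -> S y -> (dist x y <= C)%R) ->
  forall f c, (0 <= c)%R -> (forall x, 0 <= f x) -> measurable_fun setT f -> lip c f ->
  \int[m1]_x f x <= \int[m2]_x f x.
Proof.
move=> inv1 inv2 mS m1S m2S C0 SC.
have key k : forall f c, (0 <= c)%R -> (forall x, 0 <= f x) -> measurable_fun setT f ->
    lip c f -> \int[m1]_x f x <= \int[m2]_x f x + (c * r ^+ k * C)%:E.
  elim: k => [|k IH] f c c0 f0 mf lf; last first.
    rewrite inv1// (inv2 f)// exprS mulrA; apply: IH.
    - exact: mulr_ge0.
    - by move=> x; exact: mixop_ge0.
    - exact: measurable_mixop.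
    - exact: lip_mixop.
  have cC : (0 <= c * C)%R by exact: mulr_ge0.
  have fC y : S y -> \int[m1]_x f x <= f y + (c * C)%:E.
    move=> Sy; rewrite -[leRHS](integral_prob_cst m1).
    apply: (ge0_le_integral_full mS m1S) => //.
    - by move=> x; rewrite adde_ge0// lee_fin.
    - move=> x Sx; rewrite (le_trans (lf x y))// leeD2l// lee_fin ler_wpM2l//.
      exact: SC.
  rewrite expr0 mulr1 -[leLHS](integral_prob_cst m2).
  rewrite -[X in _ <= _ + X](integral_prob_cst m2) -ge0_integralD//.
  apply: (ge0_le_integral_full mS m2S) => //.
  - by move=> x; exact: integral_ge0.
  - by move=> x; rewrite adde_ge0// lee_fin.
  - exact: emeasurable_funD.
move=> f c c0 f0 mf lf; apply/lee_addgt0Pr => e e0.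
have : ((c * C) * r ^+ k)%R @[k --> \oo] --> ((c * C) * 0)%R.
  by apply: cvgM; [exact: cvg_cst|apply: cvg_expr; rewrite ger0_norm].
rewrite mulr0 => /cvgrPdist_le/(_ _ e0)[k _ /(_ k (leqnn k))].
rewrite sub0r normrN ger0_norm ?mulr_ge0 ?exprn_ge0// => ke.
apply: le_trans (key k f c c0 f0 mf lf) _.
by rewrite leeD2l// lee_fin mulrAC.
Qed.

Lemma contraction_eq (m1 m2 : probability (n.-tuple R) R) (S : set (n.-tuple R)) (C : R) :
  (forall f, (forall x, 0 <= f x) -> measurable_fun setT f ->
     \int[m1]_x f x = \int[m1]_x mixop f x) ->
  (forall f, (forall x, 0 <= f x) -> measurable_fun setT f ->
     \int[m2]_x f x = \int[m2]_x mixop f x) ->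
  measurable S -> m1 S = 1 -> m2 S = 1 -> (0 <= C)%R ->
  (forall x y, S x -> S y -> (\sum_i `|tnth x i - tnth y i| <= C)%R) ->
  forall A, measurable A -> m1 A = m2 A.
Proof.
move=> inv1 inv2 mS m1S m2S C0 SC; apply: tuple_prob_eq => k s k0.
have f0 x : 0 <= (box_fun k s x)%:E by rewrite lee_fin box_fun_ge0.
have mf : measurable_fun setT (fun x => (box_fun k s x)%:E).
  by apply/measurable_EFinP; exact: measurable_box_fun.
have lf : lip k (fun x => (box_fun k s x)%:E).
  by move=> x y; rewrite -EFinD lee_fin box_fun_lip.
apply/eqP; rewrite eq_le; apply/andP; split.
  exact: (contraction_le inv1 inv2 mS m1S m2S C0 SC k0).
exact: (contraction_le inv2 inv1 mS m2S m1S C0 SC k0).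
Qed.

End contraction.

(** * Uniqueness for the moment recursion *)

Section moment_recursion.
Context (R : realType).

(* [c k l] stands for the moment E[v^k (1 - v)^l]. *)
Lemma moment_recursion_unique (c c' : nat -> nat -> R) :
  (forall k l, c k l.+1 = c k l - c k.+1 l) ->
  (forall k l, c' k l.+1 = c' k l - c' k.+1 l) ->
  c 0 0 = 1 -> c' 0 0 = 1 -> c 1 0 = c' 1 0 ->
  (forall m, c m 1 = c 0 m.+1 * c m 0) ->
  (forall m, c' m 1 = c' 0 m.+1 * c' m 0) ->
  (forall m, 0 <= c m 0) -> (forall m, c m.+1 0 < 1) ->
  forall k l, c k l = c' k l.
Proof.
move=> cS c'S c00 c'00 c10 cr c'r c0 c1.
(* Once the pure moments below order m agree, a single unknown is left in order m: every mixed
   difference of that total order equals it up to the sign (-1)^l. *)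
have diff m : (forall j, (j < m)%N -> c j 0 = c' j 0) -> forall l k, (k + l = m)%N ->
    c k l - c' k l = (-1) ^+ l * (c m 0 - c' m 0).
  move=> em l; elim: l m em => [|l IH] m em k; first by rewrite addn0 expr0 mul1r => ->.
  rewrite addnS => klm; rewrite cS c'S.
  have -> : c k l - c k.+1 l - (c' k l - c' k.+1 l) =
    (c k l - c' k l) - (c k.+1 l - c' k.+1 l) by ring.
  rewrite (IH m em k.+1) ?addSn//.
  rewrite (IH (k + l)%N _ k erefl); last by move=> j jkl; apply: em; rewrite -klm ltnS ltnW.
  by rewrite em -?klm ?ltnSn// subrr mulr0 exprS; ring.
have eqm m : forall j, (j <= m)%N -> c j 0 = c' j 0.
  elim: m => [|m IH] j; first by rewrite leqn0 => /eqP ->; rewrite c00 c'00.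
  rewrite leq_eqVlt => /predU1P[->|]; last by rewrite ltnS; exact: IH.
  (* Order 1 is a hypothesis; the recursion only starts to bite in order 2. *)
  case: m IH => [//|m] IH.
  have em := diff m.+2 (fun j jm => IH j jm).
  have E1 := em 1%N m.+1 (addn1 _).
  have E2 := em m.+2 0%N (add0n _).
  rewrite cr c'r -(IH m.+1)// in E1.
  (* Both sides of the recursion in order m + 2 are differences covered by [diff]: one with l = 1,
     the other with l = m + 2. Comparing them leaves this product, whose first factor is nonzero
     because [c m.+1 0] lies in [0, 1). *)
  have E3 : (1 + (-1) ^+ m.+2 * c m.+1 0) * (c m.+2 0 - c' m.+2 0) = 0.
    have -> : (1 + (-1) ^+ m.+2 * c m.+1 0) * (c m.+2 0 - c' m.+2 0) =
      (c 0 m.+2 - c' 0 m.+2) * c m.+1 0 + (c m.+2 0 - c' m.+2 0) by rewrite E2; ring.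
    have -> : (c 0 m.+2 - c' 0 m.+2) * c m.+1 0 = - (c m.+2 0 - c' m.+2 0).
      by rewrite mulrBl E1; ring.
    by ring.
  have nz : 1 + (-1) ^+ m.+2 * c m.+1 0 != 0.
    rewrite -signr_odd; case: (odd m.+2); rewrite ?expr0 ?expr1.
      by rewrite mulN1r subr_eq0 eq_sym lt_eqF.
    by rewrite mul1r gt_eqF// ltr_pwDl.
  by move/eqP: E3; rewrite mulf_eq0 (negbTE nz)/= subr_eq0 => /eqP.
have eq0 m : c m 0 = c' m 0 by exact: (eqm m).
move=> k l; elim: l k => // l IH k.
by rewrite cS c'S !IH.
Qed.

End moment_recursion.

(** * Size-biased picks *)

Section series_tools.
Context (R : realType).
Local Open Scope ereal_scope.

Lemma nneseries_bump (f : nat -> \bar R) (i : nat) : (forall n, 0 <= f n) ->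
  \sum_(n <oo) f n = f i + \sum_(n <oo) f (bump i n).
Proof.
elim: i f => [|i IH] f f0.
  rewrite (nneseries_recl (P := xpredT))//= -(nneseries_addn 1)//.
  by congr (_ + _); apply: eq_eseriesr => n _; rewrite /bump addn1 add1n.
rewrite (nneseries_recl (P := xpredT))//= -(nneseries_addn 1)//.
rewrite [X in _ + X = _](_ : _ = \sum_(n <oo) (f \o succn) n); last first.
  by apply: eq_eseriesr => n _; rewrite addn1.
rewrite (IH (f \o succn))//= [in RHS](nneseries_recl (P := xpredT))//=.
rewrite -(nneseries_addn 1)//= addeCA; congr (_ + (_ + _)).
by apply: eq_eseriesr => n _; rewrite addn1 bumpS.
Qed.

Lemma nneseries_neq (f : nat -> \bar R) (i : nat) : (forall n, 0 <= f n) ->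
  \sum_(n <oo) (if n == i then 0 else f n) = \sum_(n <oo) f (bump i n).
Proof.
move=> f0; rewrite (nneseries_bump i).
  rewrite eqxx add0e; apply: eq_eseriesr => n _.
  by rewrite eq_sym (negbTE (neq_bump _ _)).
by move=> n; case: ifP.
Qed.

End series_tools.

Lemma drop_atE (T : Type) i (x : mseq T) n : drop_at i x n = x (bump i n).
Proof. by rewrite /drop_at /bump ltnNge; case: (i <= n)%N; rewrite ?add1n. Qed.

Lemma measurable_invr d (T : measurableType d) (R : realType) (f : T -> R) :
  measurable_fun setT f -> measurable_fun setT (fun x => (f x)^-1).
Proof.
move=> mf.
(* Reduces inversion to a real power with nonnegative base; at a zero of f both sides are 0. *)
have -> : (fun x => (f x)^-1) = (fun x => f x * (f x ^+ 2) `^ (-1)).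
  apply/funext => x; rewrite powR_inv1 ?sqr_ge0// expr2 invfM mulrA.
  by have [->|nz] := eqVneq (f x) 0; rewrite ?invr0 ?mulr0// divff// mul1r.
apply: measurable_funM => //.
apply: (measurableT_comp (measurable_powR _)).
exact: measurable_funX.
Qed.

Lemma measurable_drop_at d (T : measurableType d) i :
  measurable_fun setT (@drop_at T i).
Proof.
apply: measurable_mseqP => n; rewrite (_ : (fun _ => _) = (fun x : mseq T => x (bump i n))).
  exact: measurable_coord.
by apply/funext => x; rewrite drop_atE.
Qed.

Lemma measurable_sdrop_at (R : realType) i : measurable_fun setT (@sdrop_at R i).
Proof.
apply: measurable_mseqP => n; apply: measurable_funM.
  apply: measurable_invr; apply: measurable_funB; first exact: measurable_cst.
  exact: measurable_coord.
rewrite (_ : (fun _ => _) = (fun x : mseq R => x (bump i n))).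
  exact: measurable_coord.
by apply/funext => x; rewrite drop_atE.
Qed.

Section size_bias_series.
Context (R : realType) (z : mseq R).
Hypothesis z01 : forall n, 0 < z n < 1.
Local Open Scope ereal_scope.
Hypothesis sumz : \sum_(n <oo) (z n)%:E = 1.

Let z_ge0 n : (0 <= z n)%R. Proof. by case/andP: (z01 n) => /ltW. Qed.

Let drop_sum i : \sum_(n <oo) (z (bump i n))%:E = (1 - z i)%:E.
Proof.
have := sumz; rewrite (nneseries_bump (f := fun n => (z n)%:E) i); last first.
  by move=> n; rewrite lee_fin.
by rewrite EFinB => <-; rewrite addeAC subee// add0e.
Qed.

(** Both sides evaluate the sum of z_i^(m+1) z_j over pairs i != j. Summing over j first gives 1 -
    z_i; summing over i first, each z_i is 1 - z_j times an entry of the rescaled sequence without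
    z_j. *)
Lemma size_bias_series m :
  \sum_(i <oo) ((z i)%:E * (z i ^+ m * (1 - z i))%:E) =
  \sum_(j <oo) ((z j)%:E * (((1 - z j) ^+ m.+1)%:E *
     \sum_(n <oo) (sdrop_at j z n ^+ m.+1)%:E)).
Proof.
pose a i j : \bar R := if j == i then 0 else (z i ^+ m.+1 * z j)%:E.
have a0 i j : 0 <= a i j.
  by rewrite /a; case: ifP => // _; rewrite lee_fin mulr_ge0// exprn_ge0.
transitivity (\sum_(i <oo) \sum_(j <oo) a i j).
  apply: eq_eseriesr => i _.
  rewrite (nneseries_neq (f := fun j => (z i ^+ m.+1 * z j)%:E)); last first.
    by move=> n; rewrite lee_fin mulr_ge0// exprn_ge0.
  under eq_eseriesr do rewrite EFinM.
  rewrite nneseriesZl; last by move=> n _; rewrite lee_fin.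
  by rewrite drop_sum -!EFinM exprS mulrA.
rewrite nneseries_interchange//; apply: eq_eseriesr => j _.
under eq_eseriesr do rewrite /a eq_sym.
rewrite (nneseries_neq (f := fun i => (z i ^+ m.+1 * z j)%:E)); last first.
  by move=> n; rewrite lee_fin mulr_ge0// exprn_ge0.
have nz : (1 - z j != 0)%R by rewrite subr_eq0 gt_eqF//; case/andP: (z01 j).
have s0 n : (0 <= sdrop_at j z n)%R.
  rewrite /sdrop_at drop_atE mulr_ge0// invr_ge0 subr_ge0.
  by case/andP: (z01 j) => _ /ltW.
rewrite -nneseriesZl; last by move=> n _; rewrite lee_fin exprn_ge0.
rewrite -nneseriesZl; last first.
  move=> n _; rewrite mule_ge0// lee_fin exprn_ge0// subr_ge0.
  by case/andP: (z01 j) => _ /ltW.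
apply: eq_eseriesr => n _; rewrite -!EFinM -exprMn /sdrop_at drop_atE.
by rewrite mulVKf// mulrC.
Qed.

End size_bias_series.

Section interval_moments.
Context (R : realType) (m : probability R R).
Local Open Scope ereal_scope.
Local Notation I := (`[0%R, 1%R]%classic : set R).

Definition emoment k l := \int[m]_(x in I) (x ^+ k * (1 - x) ^+ l)%:E.

Let mI : measurable I. Proof. exact: measurable_itv. Qed.

Let mX k l : measurable_fun I (fun x : R => (x ^+ k * (1 - x) ^+ l)%:E).
Proof. by apply/measurable_EFinP/measurable_funTS; exact: measurable_XMonemXE. Qed.

Let X0 k l (x : R) : I x -> 0 <= (x ^+ k * (1 - x) ^+ l)%:E.
Proof.
by move=> /itv01P/andP[x0 x1]; rewrite lee_fin mulr_ge0 ?exprn_ge0// subr_ge0.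
Qed.

Lemma emoment_fin_num k l : emoment k l \is a fin_num.
Proof.
rewrite ge0_fin_numE; last by apply: integral_ge0 => x; exact: X0.
apply: (@le_lt_trans _ _ (m I)); last first.
  by rewrite (le_lt_trans (probability_le1 _ mI))// ltry.
rewrite -[leRHS]mul1e -integral_cst//; apply: ge0_le_integral => //.
- by move=> x; exact: X0.
- by move=> x /itv01P/andP[x0 x1]; rewrite lee_fin mulr_ile1 ?exprn_ge0 ?exprn_ile1//
    ?subr_ge0// gerBl.
Qed.

Lemma emomentS k l : emoment k l = emoment k l.+1 + emoment k.+1 l.
Proof.
rewrite -ge0_integralD//; last 2 first.
- by move=> x; exact: X0.
- by move=> x; exact: X0.
by apply: eq_integral => x _; rewrite -EFinD !exprS; congr EFin; ring.
Qed.

End interval_moments.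

Lemma emoment_beta (R : realType) (a : R) (a0 : 0 < a) k l :
  emoment (beta_measure (@ltr01 R) a0) k l =
  (Beta k.+1%:R (l%:R + a) / Beta 1 a)%:E.
Proof.
rewrite /emoment integral_mkcond ge0_integral_beta; last 2 first.
- move=> x; apply: erestrict_ge0 => y /itv01P/andP[x0 x1].
  by rewrite lee_fin mulr_ge0 ?exprn_ge0// subr_ge0.
- apply/(measurable_restrictT _ _).1; first exact: measurable_itv.
  by apply/measurable_EFinP/measurable_funTS; exact: measurable_XMonemXE.
rewrite mulrC EFinM -ebetaE ?ltr_wpDl//.
congr (_ * _)%E; apply: eq_integral => x _; rewrite patchE mem_setE in_itv/= /bdens.
case: ifPn => [/andP[x0 x1]|_]; last by rewrite mul0e.
rewrite !(ltW x0) (ltW x1)/= -EFinM subrr powRr0 mul1r; congr EFin.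
have -> : (k.+1%:R - 1 = k%:R :> R) by rewrite -natr1 addrK.
rewrite powR_mulrn ?(ltW x0)// mulrCA; congr (_ * _).
rewrite -powR_mulrn ?subr_ge0 ?(ltW x1)//.
have -> : (l%:R + a - 1 = (a - 1) + l%:R :> R) by ring.
rewrite (@powRD _ (1 - x) (a - 1) l%:R)//; apply/implyP => _.
by rewrite subr_eq0 gt_eqF.
Qed.

Section indep_fubini.
Context d d1 d2 (Om : measurableType d) (T1 : measurableType d1) (T2 : measurableType d2).
Context (R : realType) (P : probability Om R) (m1 : probability T1 R) (m2 : probability T2 R).
Variables (U : Om -> T1) (W : Om -> T2).
Hypotheses (mU : measurable_fun setT U) (mW : measurable_fun setT W).
Local Open Scope ereal_scope.

(** The marginals [m1] and [m2] are prescribed through rectangles instead of being defined from [U]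
    and [W]. This allows the reduced sequence to be replaced directly by the law of the original
    one. *)
Lemma integral_indep (K : T1 * T2 -> \bar R) :
  (forall A B, measurable A -> measurable B ->
    P (U @^-1` A `&` W @^-1` B) = m1 A * m2 B) ->
  (forall p, 0 <= K p) -> measurable_fun setT K ->
  \int[P]_w K (U w, W w) = \int[m1]_x \int[m2]_y K (x, y).
Proof.
move=> ind K0 mK.
have mUW : measurable_fun setT (fun w => (U w, W w)) by exact: measurable_fun_pair.
rewrite -(ge0_integral_law P mUW K0 mK) -(fubini_tonelli1 K)//.
apply: eq_measure_integral => A mA _; apply/esym.
by apply: product_measure_unique => // C D mC mD; rewrite -ind.
Qed.

End indep_fubini.

Section positive_expectation.
Context d (T : measurableType d) (R : realType) (P : probability T R).
Local Open Scope ereal_scope.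

Lemma integral_prob_gt0 (f : T -> \bar R) : measurable_fun setT f ->
  (forall x, 0 < f x) -> 0 < \int[P]_x f x.
Proof.
move=> mf f0; rewrite lt_neqAle integral_ge0 ?andbT; last by move=> x _; exact: ltW.
apply/eqP => E.
have : \int[P]_x `|f x| = 0.
  by rewrite [RHS]E; apply: eq_integral => x _; rewrite gee0_abs// ltW.
move/(ae_eq_integral_abs P measurableT mf) => [N [mN N0 NE]].
have : P setT <= P N.
  apply: le_measure; rewrite ?inE//.
  by move=> x _; apply: NE => /= H; have := H Logic.I; have := f0 x => /[swap] ->; rewrite ltxx.
by rewrite [X in X <= _]probability_setT N0 leNgt lte01.
Qed.

End positive_expectation.

(** * The random pick [kappa] and the law of the picked mass *)

Section size_bias.
Context (R : realType) (dO dX : measure_display) (Omega : measurableType dO)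
  (T : measurableType dX) (P : probability Omega R)
  (Z : {mfun Omega >-> mseq R}) (X : {mfun Omega >-> mseq T})
  (kappa : {mfun Omega >-> nat}).
Hypothesis Z01 : forall w n, 0 < Z w n < 1.
Hypothesis sumZ : {ae P, forall w, (\sum_(n <oo) (Z w n)%:E = 1)%E}.
Hypothesis kappaZ : forall i : nat,
  is_cond_prob P (g_sigma_algebra_preimage (joint_seq Z X))
    (kappa @^-1` [set i]) (fun w => Z w i).
Hypothesis eq_law : forall A, measurable A ->
  distribution P (reduced_seq Z X kappa) A = distribution P (joint_seq Z X) A.
Hypothesis indep : independent3 P (reduced_seq Z X kappa)
  (at_index kappa Z) (at_index kappa X).

Local Notation J := (joint_seq Z X).
Local Notation V := (at_index kappa Z).
Local Notation Zred := (fun w => sdrop_at (kappa w) (Z w)).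
Local Open Scope ereal_scope.

Let Z_ge0 w n : (0 <= Z w n)%R. Proof. by case/andP: (Z01 w n) => /ltW. Qed.
Let Z_le1 w n : (Z w n <= 1)%R. Proof. by case/andP: (Z01 w n) => _ /ltW. Qed.
Let V_ge0 w : (0 <= V w)%R. Proof. exact: Z_ge0. Qed.
Let V_lt1 w : (V w < 1)%R. Proof. by case/andP: (Z01 w (kappa w)). Qed.
Let V_gt0 w : (0 < V w)%R. Proof. by case/andP: (Z01 w (kappa w)). Qed.

Let mJ : measurable_fun setT J. Proof. exact: measurable_joint_seq. Qed.
Let mZ n : measurable_fun setT (fun w => Z w n).
Proof. exact: measurableT_comp (measurable_coord n) (measurable_funPT Z). Qed.
Let mV : measurable_fun setT V. Proof. exact: measurable_at_index. Qed.
Let mkappa i : measurable (kappa @^-1` [set i]).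
Proof. exact: measurable_funPTI. Qed.

(** The conditional probability says that P restricted to kappa = i and the measure with density Z_i
    have the same image under [joint_seq]; the claim integrates H against that image. *)
Lemma integral_kappa_eq i (H : mseq R * mseq T -> \bar R) :
  (forall p, 0 <= H p) -> measurable_fun setT H ->
  \int[P]_(w in kappa @^-1` [set i]) H (J w) = \int[P]_w ((Z w i)%:E * H (J w)).
Proof.
move=> H0 mH.
have i0 w : (0 <= \1_(kappa @^-1` [set i]) w :> R)%R by rewrite indicE.
have mi : measurable_fun setT (\1_(kappa @^-1` [set i]) : Omega -> R).
  exact: measurable_indic.
have Zi0 w : (0 <= Z w i)%R by exact: Z_ge0.
pose m1 := image_measure (density P i0 mi) mJ.
pose m2 := image_measure (density P Zi0 (mZ i)) mJ.
have m12 A : measurable A -> m1 A = m2 A.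
  move=> mA; rewrite /m1 /m2 /image_measure/= /pushforward /density.
  have mJA : measurable (J @^-1` A) by rewrite -[X in measurable X]setTI; exact: mJ.
  rewrite integral_indic//.
  have [_ _ ->] := kappaZ i; first by rewrite setIC.
  by exists A => //; rewrite setTI.
have mHJ : measurable_fun setT (H \o J) by exact: measurableT_comp.
have H0J w : 0 <= (H \o J) w by exact: H0.
have E1 : \int[m1]_x H x = \int[P]_(w in kappa @^-1` [set i]) H (J w).
  rewrite (@ge0_integral_pushforward _ _ _ _ _ _ mJ)// preimage_setT.
  rewrite (@ge0_integral_density _ _ _ P (density P i0 mi) _ i0 mi)//.
  rewrite [RHS]integral_mkcond; apply: eq_integral => w _.
  by rewrite epatch_indic/= muleC.
have E2 : \int[m2]_x H x = \int[P]_w ((Z w i)%:E * H (J w)).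
  rewrite (@ge0_integral_pushforward _ _ _ _ _ _ mJ)// preimage_setT.
  by rewrite (@ge0_integral_density _ _ _ P (density P Zi0 (mZ i)) _ Zi0 (mZ i)).
by rewrite -E1 -E2; apply: eq_measure_integral => A mA _; exact: m12.
Qed.

Lemma integral_kappa (H : nat -> mseq R * mseq T -> \bar R) :
  (forall i p, 0 <= H i p) -> (forall i, measurable_fun setT (H i)) ->
  \int[P]_w H (kappa w) (J w) = \int[P]_w (\sum_(i <oo) ((Z w i)%:E * H i (J w))).
Proof.
move=> H0 mH.
have mHJ i : measurable_fun setT (fun w => H i (J w)) by exact: measurableT_comp (mH i) mJ.
have mHk : measurable_fun setT (fun w => H (kappa w) (J w)).
  exact: (@measurable_random_index _ _ _ _ kappa (fun i w => H i (J w))).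
have kT : \bigcup_i (kappa @^-1` [set i]) = setT.
  by rewrite -subTset => w _; exists (kappa w).
rewrite integral_nneseries//; last 2 first.
- move=> i; apply: emeasurable_funM => //; exact/measurable_EFinP.
- by move=> i w _; rewrite mule_ge0// lee_fin.
rewrite -{1}kT ge0_integral_bigcup//; last 2 first.
- by rewrite kT.
- by apply/trivIsetP => i j _ _ /eqP ij; rewrite -subset0 => w [/= ki kj]; apply: ij; rewrite -ki -kj.
apply: eq_eseriesr => i _; rewrite -integral_kappa_eq//.
by apply: eq_integral => w; rewrite inE/= => ->.
Qed.

Let mZr : measurable_fun setT Zred.
Proof.
have := measurable_reduced_seq Z X kappa => /(measurableT_comp measurable_fst); exact.
Qed.

Lemma integral_VZred (K : R * mseq R -> \bar R) :
  (forall p, 0 <= K p) -> measurable_fun setT K ->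
  \int[P]_w K (V w, Zred w) = \int[P]_w \int[P]_w' K (V w, Z w').
Proof.
move=> K0 mK.
rewrite (@integral_indep _ _ _ _ _ _ _ P (law P mV) (law P (measurable_funPT Z)) V Zred mV mZr K)//.
  rewrite ge0_integral_law//; last 2 first.
  - by move=> x; exact: integral_ge0.
  - exact: measurable_fun_fubini_tonelli_F.
  apply: eq_integral => w _; rewrite ge0_integral_law//.
  exact: measurableT_comp.
move=> A B mA mB.
have mBT : measurable (B `*` [set: mseq T]) by exact: measurableX.
have := indep mBT mA measurableT.
rewrite preimage_setT setIT probability_setT mule1 => E.
have eqB : P (reduced_seq Z X kappa @^-1` (B `*` setT)) = P (Z @^-1` B).
  transitivity (P (J @^-1` (B `*` setT))); first exact: (eq_law mBT).
  by congr (P _); apply/seteqP; split => w //= -[].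
transitivity (P (reduced_seq Z X kappa @^-1` (B `*` setT) `&` V @^-1` A)).
  congr (P _); apply/seteqP; split => [w [VA ZB]|w [[ZB _] VA]]; last by split.
  by split => //; split.
by rewrite [LHS]E eqB muleC.
Qed.

(** Condenses the assumptions on [kappa]: the left side is the size-biased pick, the right side uses
    independence and the equality in law. Both the moment identity and the gamma scaling start from
    it. *)
Lemma integral_size_bias (K : R * mseq R -> \bar R) :
  (forall p, 0 <= K p) -> measurable_fun setT K ->
  \int[P]_w (\sum_(i <oo) ((Z w i)%:E * K (Z w i, sdrop_at i (Z w)))) =
  \int[P]_w \int[P]_w' K (V w, Z w').
Proof.
move=> K0 mK; rewrite -integral_VZred//.
rewrite (integral_kappa (H := fun i p => K (p.1 i, sdrop_at i p.1)))// => i.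
apply: (measurableT_comp mK); apply: measurable_fun_pair.
  exact: measurableT_comp (measurable_coord i) measurable_fst.
exact: measurableT_comp (measurable_sdrop_at i) measurable_fst.
Qed.

Let lawV : probability R R := distribution P V.

Let VI w : `[0%R, 1%R]%classic (V w).
Proof. by rewrite /= in_itv/= V_ge0 ltW. Qed.

Lemma emomentE k l : emoment lawV k l = \int[P]_w (V w ^+ k * (1 - V w) ^+ l)%:E.
Proof.
rewrite /emoment /lawV /distribution (@ge0_integral_pushforward _ _ _ _ _ _ mV)//.
- by congr integral; apply/seteqP; split => w // _; exact: VI.
- by apply/measurable_EFinP/measurable_funTS; exact: measurable_XMonemXE.
- move=> x /set_mem/itv01P/andP[x0 x1].
  by rewrite lee_fin mulr_ge0 ?exprn_ge0// subr_ge0.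
Qed.

Let mZp (i : nat) (f : R -> R) : measurable_fun setT f ->
  measurable_fun setT (fun p : mseq R * mseq T => (f (p.1 i))%:E).
Proof.
move=> mf; apply/measurable_EFinP; apply: (measurableT_comp mf).
exact: measurableT_comp (measurable_coord i) measurable_fst.
Qed.

Lemma integral_series_pow m :
  \int[P]_w \sum_(n <oo) (Z w n ^+ m.+1)%:E = \int[P]_w (V w ^+ m)%:E.
Proof.
transitivity (\int[P]_w (\sum_(i <oo) ((Z w i)%:E * (`|Z w i ^+ m|)%:E))).
  apply: eq_integral => w _; apply: eq_eseriesr => i _.
  by rewrite ger0_norm ?exprn_ge0// -EFinM exprS.
rewrite -(integral_kappa (H := fun i p => (`|p.1 i ^+ m|)%:E))//.
- apply: eq_integral => w _; rewrite ger0_norm//.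
  exact: exprn_ge0 (V_ge0 w).
- move=> i; apply: (mZp _ (f := fun x => `|x ^+ m|%R)).
  by apply: (measurableT_comp (@normr_measurable R setT)); exact: measurable_funX.
Qed.

(** In the pair sum of [size_bias_series] the atom j is taken as the picked one. Then (1 - V)^(m+1)
    is independent of the power sum of the reduced sequence, and the latter has mean E V^m by
    [integral_series_pow]. *)
Lemma moment_size_bias m : emoment lawV m 1 = emoment lawV 0 m.+1 * emoment lawV m 0.
Proof.
rewrite !emomentE.
transitivity (\int[P]_w (`|V w ^+ m * (1 - V w)|)%:E).
  by apply: eq_integral => w _; rewrite expr1 ger0_norm// mulr_ge0 ?exprn_ge0// subr_ge0 ltW.
rewrite (integral_kappa (H := fun i p => (`|p.1 i ^+ m * (1 - p.1 i)|)%:E))//; last first.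
  move=> i; apply: (mZp _ (f := fun x => `|x ^+ m * (1 - x)|%R)).
  apply: (measurableT_comp (@normr_measurable R setT)).
  by apply: measurable_funM; [exact: measurable_funX|exact: measurable_funB].
pose K (p : R * mseq R) :=
  (`|1 - p.1| ^+ m.+1)%:E * \sum_(n <oo) (`|p.2 n| ^+ m.+1)%:E.
have S0 (z : mseq R) : 0 <= \sum_(n <oo) (`|z n| ^+ m.+1)%:E.
  by apply: nneseries_ge0 => n _ _; rewrite lee_fin exprn_ge0.
have K0 p : 0 <= K p by rewrite /K mule_ge0// lee_fin exprn_ge0.
have mS : measurable_fun setT (fun z : mseq R => \sum_(n <oo) (`|z n| ^+ m.+1)%:E).
  apply: (ge0_emeasurable_sum (P := xpredT)) => [k x _ _|k _].
    by rewrite lee_fin exprn_ge0.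
  apply/measurable_EFinP/measurable_funX.
  exact: measurableT_comp (@normr_measurable R setT) (measurable_coord k).
have mK : measurable_fun setT K.
  apply: emeasurable_funM; last exact: measurableT_comp mS measurable_snd.
  apply/measurable_EFinP/measurable_funX.
  apply: (measurableT_comp (@normr_measurable R setT)).
  by apply: measurable_funB; [exact: measurable_cst|exact: measurable_fst].
transitivity (\int[P]_w (\sum_(i <oo) ((Z w i)%:E * K (Z w i, sdrop_at i (Z w))))).
  apply: ae_eq_integral => //.
  - apply: (ge0_emeasurable_sum (P := xpredT)) => [k x _ _|k _].
      by rewrite mule_ge0// lee_fin.
    apply: emeasurable_funM; first exact/measurable_EFinP.
    apply: (measurableT_comp (mZp k (f := fun x => `|x ^+ m * (1 - x)|%R) _) mJ).
    apply: (measurableT_comp (@normr_measurable R setT)).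
    by apply: measurable_funM; [exact: measurable_funX|exact: measurable_funB].
  - apply: (ge0_emeasurable_sum (P := xpredT)) => [k x _ _|k _].
      by rewrite mule_ge0// lee_fin.
    apply: emeasurable_funM; first exact/measurable_EFinP.
    apply: (measurableT_comp mK); apply: measurable_fun_pair; first exact: mZ.
    exact: measurableT_comp (measurable_sdrop_at k) (measurable_funPT Z).
  - apply: filterS sumZ => w sw _.
    transitivity (\sum_(i <oo) ((Z w i)%:E * (Z w i ^+ m * (1 - Z w i))%:E)).
      apply: eq_eseriesr => i _; rewrite ger0_norm//.
      by apply: mulr_ge0; [exact: exprn_ge0 (Z_ge0 w i)|rewrite subr_ge0; exact: Z_le1].
    rewrite (size_bias_series (Z01 w) sw); apply: eq_eseriesr => j _.
    rewrite /K/= ger0_norm ?subr_ge0//; congr (_ * (_ * _)).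
    apply: eq_eseriesr => n _; rewrite ger0_norm// /sdrop_at drop_atE.
    by rewrite mulr_ge0// invr_ge0 subr_ge0.
rewrite integral_size_bias//.
transitivity (\int[P]_w ((1 - V w) ^+ m.+1)%:E * \int[P]_w \sum_(n <oo) (Z w n ^+ m.+1)%:E).
  rewrite -ge0_integralZr//; last 3 first.
  - apply/measurable_EFinP/measurable_funX.
    by apply: measurable_funB; [exact: measurable_cst|exact: mV].
  - by move=> w _; rewrite lee_fin exprn_ge0// subr_ge0 ltW.
  - apply: integral_ge0 => w _; apply: nneseries_ge0 => n _ _.
    by rewrite lee_fin exprn_ge0.
  apply: eq_integral => w _; rewrite /K/= -ge0_mulr_integral; last 3 first.
  - by rewrite exprn_ge0.
  - by move=> w'; exact: S0.
  - exact: measurableT_comp mS (measurable_funPT Z).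
  rewrite ger0_norm; last by rewrite subr_ge0; exact: ltW (V_lt1 w).
  congr (_ * _); apply: eq_integral => w' _.
  by apply: eq_eseriesr => n _; rewrite ger0_norm.
rewrite integral_series_pow; congr (_ * _); apply: eq_integral => w _.
  by rewrite expr0 mul1r.
by rewrite expr0 mulr1.
Qed.

Lemma integral_V : ('E_P[V] = \int[P]_w (V w)%:E)%E.
Proof. by rewrite unlock. Qed.

Let EV : R := fine 'E_P[V]%E.

Lemma EFin_EV : EV%:E = \int[P]_w (V w)%:E.
Proof.
rewrite /EV integral_V fineK// -[X in X \is a _](_ : emoment lawV 1 0 = _).
  exact: emoment_fin_num.
by rewrite emomentE; apply: eq_integral => w _; rewrite expr0 mulr1.
Qed.

Lemma integral_oneV : \int[P]_w (1 - V w)%:E = (1 - EV)%:E.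
Proof.
have E1 := emomentS lawV 0 0.
have E00 : emoment lawV 0 0 = 1.
  rewrite emomentE -[RHS](integral_prob_cst P); apply: eq_integral => w _.
  by rewrite !expr0 mulr1.
have E10 : emoment lawV 1 0 = EV%:E.
  by rewrite EFin_EV emomentE; apply: eq_integral => w _; rewrite expr0 mulr1.
have E01 : emoment lawV 0 1 = \int[P]_w (1 - V w)%:E.
  by rewrite emomentE; apply: eq_integral => w _; rewrite expr0 mul1r.
rewrite E00 E10 in E1; rewrite EFinB -E01 E1 -addeA subee ?adde0//.
Qed.

Lemma EV_gt0 : (0 < EV)%R.
Proof.
rewrite -lte_fin EFin_EV; apply: integral_prob_gt0 => //.
exact/measurable_EFinP.
Qed.

Lemma EV_lt1 : (EV < 1)%R.
Proof.
rewrite -subr_gt0 -lte_fin -integral_oneV; apply: integral_prob_gt0.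
  by apply/measurable_EFinP; apply: measurable_funB; [exact: measurable_cst|exact: mV].
by move=> w; rewrite lte_fin subr_gt0.
Qed.

Lemma size_bias_alpha_gt0 : (0 < (1 - EV) / EV)%R.
Proof. by rewrite divr_gt0 ?EV_gt0// subr_gt0 EV_lt1. Qed.

Lemma size_bias_beta (a : R) (a0 : (0 < a)%R) : a = ((1 - EV) / EV)%R ->
  forall A, measurable A -> distribution P V A = beta_measure (@ltr01 R) a0 A.
Proof.
move=> aE; have EV0 := EV_gt0.
set b := beta_measure _ _.
pose c k l := fine (emoment lawV k l).
pose c' k l := fine (emoment b k l).
have cE k l : emoment lawV k l = (c k l)%:E by rewrite fineK// emoment_fin_num.
have c'E k l : c' k l = (Beta k.+1%:R (l%:R + a) / Beta 1 a)%R.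
  by rewrite /c' emoment_beta.
have B0 := Beta_gt0 (@ltr01 R) a0.
have cS (m : probability R R) k l :
    (fine (emoment m k l.+1) = fine (emoment m k l) - fine (emoment m k.+1 l))%R.
  have E := emomentS m k l.
  rewrite -(fineK (emoment_fin_num m k l)) -(fineK (emoment_fin_num m k l.+1)) in E.
  by move: E; rewrite -(fineK (emoment_fin_num m k.+1 l)) -EFinD => -[->]; ring.
have c00 : c 0%N 0%N = 1%R.
  apply/EFin_inj; rewrite -cE emomentE -[RHS](integral_prob_cst P).
  by apply: eq_integral => w _; rewrite !expr0 mulr1.
have c10 : c 1%N 0%N = EV.
  apply/EFin_inj; rewrite -cE emomentE EFin_EV.
  by apply: eq_integral => w _; rewrite expr0 mulr1.
have c'00 : c' 0%N 0%N = 1%R by rewrite c'E add0r divff// gt_eqF.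
have G0 (x : R) : (0 < x)%R -> Gamma x != 0%R by move=> x0; rewrite gt_eqF// Gamma_gt0.
have c'10 : c' 1%N 0%N = EV.
  (* The mean of Beta(1, a) is 1/(1 + a); this is where the formula for alpha comes from. *)
  have EVE : (EV = 1 / (1 + a))%R.
    have -> : (1 + a = EV^-1)%R by rewrite aE; field; rewrite gt_eqF.
    by rewrite div1r invrK.
  rewrite c'E EVE add0r /Beta (_ : 2%:R + a = (1 + a) + 1)%R; last by ring.
  rewrite (_ : 2%:R = 1 + 1 :> R)%R// !GammaS ?addr_gt0// !Gamma1.
  have := G0 a a0; have := G0 (1 + a)%R (addr_gt0 ltr01 a0).
  have : (1 + a != 0)%R by rewrite gt_eqF// addr_gt0.
  move: (Gamma (1 + a)) (Gamma a) => g h n1 g0 h0.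
  by field; rewrite n1 g0 h0.
have ccE : forall k l, c k l = c' k l.
  apply: moment_recursion_unique => //.
  - by move=> k l; exact: cS.
  - by move=> k l; exact: cS.
  - by rewrite c10 c'10.
  - move=> m; apply/EFin_inj; rewrite EFinM -!cE; exact: moment_size_bias.
  - move=> m; rewrite !c'E /Beta add0r (_ : m.+1%:R + (1 + a) = m.+2%:R + a)%R; last first.
      by rewrite -(natr1 m.+1); ring.
    rewrite (_ : 1 + (m.+1%:R + a) = m.+2%:R + a)%R; last by rewrite -(natr1 m.+1); ring.
    rewrite !Gamma1 !mul1r.
    have := G0 (1 + a)%R (addr_gt0 ltr01 a0); have := G0 a a0.
    have := G0 (m.+1%:R + a)%R (addr_gt0 (ltr0Sn _ _) a0).
    have := G0 (m.+2%:R + a)%R (addr_gt0 (ltr0Sn _ _) a0).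
    move: (Gamma m.+1%:R) (Gamma (m.+2%:R + a)) (Gamma (m.+1%:R + a)) (Gamma a)
      (Gamma (1 + a)) => g1 g2 g3 g4 g5 n2 n3 n4 n5.
    by field; rewrite n2 n3 n4 n5.
  - move=> m; rewrite -lee_fin -cE; apply: integral_ge0 => x /itv01P/andP[x0 x1].
    by rewrite lee_fin mulr_ge0 ?exprn_ge0// subr_ge0.
  - move=> m; rewrite -lte_fin -cE; apply: (@le_lt_trans _ _ EV%:E); last first.
      by rewrite lte_fin EV_lt1.
    rewrite emomentE EFin_EV; apply: ge0_le_integral => //.
    + by move=> w _; rewrite lee_fin mulr_ge0 ?exprn_ge0// subr_ge0 ltW.
    + apply/measurable_EFinP; exact: (measurableT_comp (measurable_XMonemXE m.+1 0) mV).
    + exact/measurable_EFinP.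
    + move=> w _; rewrite expr0 mulr1 lee_fin exprS ler_piMr// exprn_ile1//.
      exact: ltW.
apply: prob01_eq.
- move=> k l; have := cE k l; rewrite /emoment => ->.
  by rewrite ccE /c' fineK// emoment_fin_num.
- have VT : V @^-1` `[0%R, 1%R]%classic = setT.
    by apply/seteqP; split => w // _; exact: VI.
  exact: etrans (congr1 P VT) (probability_setT P).
- have b00 : emoment b 0 0 = 1.
    by rewrite -(fineK (emoment_fin_num b 0 0)) -/(c' 0%N 0%N) c'00.
  rewrite -b00 /emoment; under eq_integral do rewrite !expr0 mulr1.
  by rewrite integral_cst ?mul1e//; exact: measurable_itv.
Qed.

End size_bias.

(** * The Mecke equation characterizes the Poisson process *)

Section counting.
Context d (T : measurableType d) (R : realType).
Implicit Types (B : set T) (z : mseq T).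
Local Open Scope ereal_scope.

Definition npoints B z : \bar R := \sum_(n <oo) \d_(z n) B.

Let dirac_ge0 B x : 0 <= \d_x B :> \bar R. Proof. by rewrite diracE lee_fin. Qed.

Lemma npoints_ge0 B z : 0 <= npoints B z.
Proof. exact: nneseries_ge0. Qed.

Lemma npoints_drop_at B z i : npoints B z = \d_(z i) B + npoints B (drop_at i z).
Proof.
rewrite /npoints (nneseries_bump (f := fun n => \d_(z n) B) i)//.
by congr (_ + _); apply: eq_eseriesr => n _; rewrite drop_atE.
Qed.

Lemma measurable_dirac_coord B n : measurable B ->
  measurable_fun setT (fun z : mseq T => \d_(z n) B : \bar R).
Proof.
move=> mB; apply/measurable_EFinP.
exact: measurableT_comp (measurable_indic mB) (measurable_coord n).
Qed.

Lemma measurable_npoints B : measurable B -> measurable_fun setT (npoints B).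
Proof.
move=> mB; apply: (ge0_emeasurable_sum (P := xpredT)) => // n _.
exact: measurable_dirac_coord.
Qed.

(** If the series converges, its tails are eventually below 1; the terms being 0 or 1, all of them
    vanish from there on, and a finite sum remains. *)
Lemma npoints_nat B z : npoints B z = +oo \/ exists k : nat, npoints B z = k%:R%:E.
Proof.
have [fin|] := ltP (npoints B z) +oo; last by rewrite leye_eq => /eqP; left.
right; have := nneseries_tail_cvg fin (fun k _ => dirac_ge0 B (z k)).
move=> /(@fine_cvgP R nat \oo)[[M0 _ finM]] /cvgrPdist_lt/(_ _ ltr01)[M1 _ ltM].
pose M := maxn M0 M1.
have tail0 k : (M <= k)%N -> \d_(z k) B = 0 :> \bar R.
  move=> Mk; rewrite diracE; case: (boolP (z k \in B)) => //= zkB.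
  have := ltM M (leq_maxr _ _); rewrite sub0r normrN /= ger0_norm; last first.
    by apply/fine_ge0/nneseries_ge0.
  suff : (1 <= fine (\sum_(M <= k <oo) \d_(z k) B :> \bar R))%R.
    by move=> ge1 /(le_lt_trans ge1); rewrite ltxx.
  rewrite -lee_fin fineK; last by apply: (finM M); exact: leq_maxl.
  rewrite (nneseries_split M (k - M)%N)// subnKC//.
  rewrite (nneseries_split k 1)// addn1 big_nat1 diracE zkB/=.
  apply: (@le_trans _ _ (1 + \sum_(k.+1 <= i <oo) \d_(z i) B)).
    by rewrite leeDl//; apply: nneseries_ge0.
  by rewrite leeDr//; apply: sume_ge0.
exists (\sum_(0 <= k < M) (z k \in B))%N.
rewrite /npoints (nneseries_split 0 M)// add0n.
rewrite [X in _ + X](_ : _ = 0); last first.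
  by rewrite eseries0// => k Mk _; exact: tail0.
rewrite adde0 natr_sum -sumEFin; apply: eq_bigr => k _; exact: diracE.
Qed.

End counting.
Arguments npoints {d T R} B z.

Lemma measurable_smeasureP d (T : measurableType d) (R : realType)
    d' (S : measurableType d') (f : S -> smeasure T R) :
  (forall B, measurable B -> measurable_fun setT (fun s => f s B)) ->
  measurable_fun setT f.
Proof.
move=> mf; apply: (@measurability _ _ _ _ setT f (\bigcup_(A in measurable)
  preimage_set_system setT (@smeasure_ev _ T R A) measurable)) => //.
move=> _ [_ [B mB [A mA <-]] <-]; rewrite !setTI.
by have := mf B mB measurableT A mA; rewrite setTI.
Qed.

Lemma measurable_sum_diracs d (T : measurableType d) (R : realType) :
  measurable_fun setT (fun z : mseq T => sum_diracs z : smeasure T R).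
Proof. by apply: measurable_smeasureP => B mB; exact: measurable_npoints. Qed.

Section mecke.
Context (R : realType) d (Om : measurableType d) (P : probability Om R).
Variables (t : Om -> mseq R) (mt : measurable_fun setT t) (lam : R -> R).
Hypotheses (lam0 : forall x, 0 <= lam x) (mlam : measurable_fun setT lam).
Local Open Scope ereal_scope.
Hypothesis mecke : forall F : R * mseq R -> \bar R,
  (forall p, 0 <= F p) -> measurable_fun setT F ->
  \int[P]_w (\sum_(n <oo) F (t w n, drop_at n (t w))) =
  \int[@leb R]_x ((lam x)%:E * \int[P]_w F (x, t w)).

Local Notation intensity := (density (@leb R) lam0 mlam).

Let N (B : set R) w : \bar R := npoints B (t w).

Let mN B : measurable B -> measurable_fun setT (N B).
Proof. by move=> mB; exact: measurableT_comp (measurable_npoints mB) mt. Qed.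

Let mNE B (A : set (\bar R)) : measurable B -> measurable A -> measurable [set w | A (N B w)].
Proof. by move=> mB mA; rewrite -[X in measurable X]setTI; exact: mN. Qed.

Let mtC C : measurable C -> measurable [set w | C (t w)].
Proof. by move=> mC; rewrite -[X in measurable X]setTI; exact: mt. Qed.

Let q B C (e : \bar R) : \bar R := P [set w | N B w = e /\ C (t w)].

Let mq B C e : measurable B -> measurable C ->
  measurable [set w | N B w = e /\ C (t w)].
Proof.
move=> mB mC; apply: measurableI; last exact: mtC.
exact: (mNE mB (emeasurable_set1 e)).
Qed.

(** Typical instances are the full space and events on the numbers of points in sets disjoint from
    B. Carrying C along in the recursion yields independence together with the Poisson law. *)
Definition drop_stable B (C : set (mseq R)) :=
  forall z n, B (z n) -> (C (drop_at n z) <-> C z).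

(** The Mecke equation for the indicator that x lies in B and that the remaining sequence is in C
    with k points in B. A sequence with k + 1 points in B offers k + 1 choices of the removed
    one. *)
Lemma mecke_rec B C (k : nat) : measurable B -> measurable C -> drop_stable B C ->
  k.+1%:R%:E * q B C k.+1%:R%:E = intensity B * q B C k%:R%:E.
Proof.
move=> mB mC BC.
pose D (e : \bar R) : set (mseq R) := [set z | npoints B z = e /\ C z].
have mD e : measurable (D e).
  apply: measurableI => //.
  have := @measurable_npoints _ _ R _ mB measurableT [set e] (emeasurable_set1 e).
  by rewrite setTI.
pose F (p : R * mseq R) : \bar R := (\1_B p.1)%:E * (\1_(D k%:R%:E) p.2)%:E.
have F0 p : 0 <= F p by rewrite /F mule_ge0// lee_fin indicE.
have mF : measurable_fun setT F.
  apply: emeasurable_funM; apply/measurable_EFinP.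
    exact: measurableT_comp (measurable_indic mB) measurable_fst.
  exact: measurableT_comp (measurable_indic (mD _)) measurable_snd.
have qE e : q B C e = \int[P]_w (\1_(D e) (t w))%:E.
  rewrite /q -[X in P X]setIT -integral_indic//; first exact: mq.
have m1t e : measurable_fun setT (fun w => (\1_(D e) (t w))%:E : \bar R).
  by apply/measurable_EFinP; exact: measurableT_comp (measurable_indic (mD e)) mt.
have := mecke F0 mF.
have -> : \int[@leb R]_x ((lam x)%:E * \int[P]_w F (x, t w)) = intensity B * q B C k%:R%:E.
  have q0 : 0 <= q B C k%:R%:E by rewrite /q.
  have -> : intensity B = \int[@leb R]_x ((lam x)%:E * (\1_B x)%:E).
    rewrite /density integral_mkcond; apply: eq_integral => x _.
    by rewrite epatch_indic.
  rewrite -ge0_integralZr//; last 2 first.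
  - apply: emeasurable_funM; apply/measurable_EFinP; first exact: mlam.
    exact: measurable_indic.
  - by move=> x _; rewrite mule_ge0// lee_fin// indicE.
  apply: eq_integral => x _; rewrite -muleA; congr (_ * _).
  by rewrite qE ge0_mulr_integral// => [|w]; rewrite ?lee_fin ?indicE.
move=> <-; rewrite qE ge0_mulr_integral; last 3 first.
- by [].
- by move=> w; rewrite lee_fin indicE.
- exact: m1t.
apply: eq_integral => w _; move: (t w) => z.
have FE n : F (z n, drop_at n z) = (\1_(D k.+1%:R%:E) z)%:E * \d_(z n) B.
  rewrite /F/= !indicE diracE.
  case: (boolP (z n \in B)) => zB /=; last by rewrite mul0e mule0.
  rewrite mul1e mule1; congr ((nat_of_bool _)%:R%:E).
  have NE := npoints_drop_at R B z n; rewrite diracE zB/= in NE.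
  have CE := BC z n (set_mem zB).
  apply/idP/idP; rewrite !inE => -[Nk Cz].
    by split; [rewrite NE Nk -EFinD -natrD add1n|exact/CE].
  split; last exact/CE.
  move: Nk; rewrite NE; case: (npoints B (drop_at n z)) => [r| |]//=.
  by rewrite -EFinD -(natr1 k) => -[E]; congr EFin; lra.
under [RHS]eq_eseriesr do rewrite FE.
rewrite nneseriesZl; last by move=> n _; rewrite diracE lee_fin.
rewrite -/(npoints B z) muleC indicE; case: (boolP (z \in D _)) => [|_].
  by rewrite inE => -[-> _].
by rewrite !mul0e ?mule0.
Qed.

Let q_fin B C e : measurable B -> measurable C -> q B C e \is a fin_num.
Proof.
move=> mB mC; rewrite ge0_fin_numE /q//.
by rewrite (le_lt_trans (probability_le1 _ (mq _ _ _)))// ltry.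
Qed.

(** Enumerates the possible counts, infinity at index 0, so that splitting over them is an ordinary
    series. *)
Let ext (k : nat) : \bar R := if k is j.+1 then j%:R%:E else +oo.

Let ext_inj i j : ext i = ext j -> i = j.
Proof.
case: i j => [|i] [|j] //= [/eqP]; rewrite eqr_nat => /eqP ->//.
Qed.

Lemma npoints_split B C A : measurable B -> measurable C -> measurable A ->
  P [set w | A (N B w) /\ C (t w)] =
  \sum_(k <oo) (if ext k \in A then q B C (ext k) else 0).
Proof.
move=> mB mC mA.
pose F k := if ext k \in A then [set w | N B w = ext k /\ C (t w)] else set0.
have mF k : measurable (F k) by rewrite /F; case: ifP => // _; exact: mq.
have -> : [set w | A (N B w) /\ C (t w)] = \bigcup_k F k.
  apply/seteqP; split => [w [AN Cw]|w [k _]]; last first.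
    by rewrite /F; case: ifPn => // /set_mem Ak [Nw Cw]; split => //; move: Ak; rewrite -Nw.
  move: AN; rewrite /N; have [Noo|[k Nk]] := @npoints_nat _ _ R B (t w).
    by rewrite Noo => Aoo; exists 0%N => //; rewrite /F/= (mem_set Aoo).
  by rewrite Nk => Ak; exists k.+1 => //; rewrite /F/= (mem_set Ak).
rewrite measure_semi_bigcup//; last 2 first.
- apply/trivIsetP => i j _ _ ij; rewrite -subset0 => w [].
  rewrite /F; case: ifP => // _; case: ifP => // _ [Ni _] [Nj _].
  by move/eqP: ij; apply; apply: ext_inj; rewrite -Ni.
- exact: bigcupT_measurable.
by apply: eq_eseriesr => k _; rewrite /F; case: ifP => // _; rewrite measure0.
Qed.

(** A positive probability would make the right side of [mecke_rec] infinite, while its left side is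
    finite. *)
Lemma q_infinite B C (k : nat) : measurable B -> measurable C -> drop_stable B C ->
  intensity B = +oo -> q B C k%:R%:E = 0.
Proof.
move=> mB mC BC Boo; have := mecke_rec k mB mC BC; rewrite Boo => E.
apply/eqP; rewrite eq_le measure_ge0 andbT leNgt; apply/negP => q0.
have : k.+1%:R%:E * q B C k.+1%:R%:E \is a fin_num by rewrite fin_numM// q_fin.
by rewrite E gt0_mulye.
Qed.

(** The Mecke equation for the indicator of B computes the mean count as the intensity of B; a count
    with finite mean is almost surely finite. *)
Lemma npoints_fin B C : measurable B -> measurable C -> intensity B < +oo ->
  q B C +oo = 0.
Proof.
move=> mB mC Bfin.
have EN : \int[P]_w N B w = intensity B.
  have := @mecke (fun p => (\1_B p.1)%:E).
  have -> : \int[@leb R]_x ((lam x)%:E * \int[P]__ (\1_B x)%:E) = intensity B.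
    rewrite /density integral_mkcond; apply: eq_integral => x _.
    by rewrite integral_prob_cst epatch_indic.
  move=> <-; last 2 first.
  - by move=> p; rewrite lee_fin indicE.
  - apply/measurable_EFinP; exact: measurableT_comp (measurable_indic mB) measurable_fst.
  by apply: eq_integral => w _; apply: eq_eseriesr.
have iN : P.-integrable setT (N B).
  apply/integrableP; split; first exact: mN.
  rewrite (eq_integral (N B)) ?EN// => w _; rewrite gee0_abs//.
  exact: npoints_ge0.
have [A [mA A0 AN]] := integrable_ae measurableT iN.
apply/eqP; rewrite eq_le measure_ge0 andbT -A0; apply: le_measure; rewrite ?inE//.
  exact: mq.
by move=> w [Noo _]; apply: AN => /= /(_ Logic.I); rewrite Noo.
Qed.

(** The recursion forces the value at k to be l^k/k! times the value at 0. Summing over all finite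
    counts must give P(C), which fixes the constant as P(C) e^(-l). *)
Lemma q_finite B C (k : nat) : measurable B -> measurable C -> drop_stable B C ->
  intensity B < +oo ->
  q B C k%:R%:E = P [set w | C (t w)] * poisson_prob (fine (intensity B)) 0%N [set k].
Proof.
move=> mB mC BC Bfin.
have i0 : 0 <= intensity B by exact: measure_ge0.
have ifin : intensity B \is a fin_num by rewrite ge0_fin_numE.
set l := fine _; have l0 : (0 <= l)%R by exact: fine_ge0.
pose p k := fine (q B C k%:R%:E).
have pE j : q B C j%:R%:E = (p j)%:E by rewrite fineK// q_fin.
have pS j : (j.+1%:R * p j.+1 = l * p j)%R.
  by apply/EFin_inj; rewrite !EFinM -!pE mecke_rec// fineK.
have pk j : p j = (p 0%N * (l ^+ j * j`!%:R^-1))%R.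
  elim: j => [|j IH]; first by rewrite expr0 fact0 invr1 !mulr1.
  have j0 : (j.+1%:R != 0 :> R)%R by [].
  apply: (mulfI j0); rewrite pS IH factS natrM exprS invfM.
  by move: (j.+1%:R) (j`!%:R^-1)%R j0 => m f m0; field.
have PC : P [set w | C (t w)] = \sum_(j <oo) q B C j%:R%:E.
  have := npoints_split mB mC (@measurableT _ (\bar R)).
  rewrite (_ : [set w | setT (N B w) /\ C (t w)] = [set w | C (t w)]); last first.
    by apply/seteqP; split => w // -[].
  move=> ->; rewrite (nneseries_recl (P := xpredT))//; last first.
    by move=> j _; case: ifP => // _; exact: measure_ge0.
  rewrite in_setT npoints_fin// add0e -nneseries_addn; last first.
    by move=> j; case: ifP => // _; exact: measure_ge0.
  by apply: eq_eseriesr => j _; rewrite in_setT addn1.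
rewrite PC; case: (ltP 0%R l) => l1.
  have pmfE j : q B C j%:R%:E =
      ((p 0%N) * expR l)%:E * (poisson_pmf l j)%:E.
    rewrite pE pk /poisson_pmf l1 -EFinM expRN; congr EFin.
    have : expR l != 0%R by rewrite gt_eqF ?expR_gt0.
    by move: (expR l) (j`!%:R^-1)%R => m f m0; field.
  rewrite pmfE (_ : \sum_(j <oo) _ = ((p 0%N) * expR l)%:E).
    by rewrite /poisson_prob l1 esum_set1// lee_fin poisson_pmf_ge0.
  under eq_eseriesr do rewrite pmfE.
  rewrite nneseriesZl; last by move=> j _; rewrite lee_fin poisson_pmf_ge0.
  rewrite (_ : \sum_(j <oo) (poisson_pmf l j)%:E = 1) ?mule1//.
  have := @probability_setT _ _ R (poisson_prob l 0%N); rewrite /= /poisson_prob l1.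
  rewrite -nneseries_esumT//.
  by move=> *; rewrite lee_fin poisson_pmf_ge0.
(* At rate 0 [poisson_prob] is the Dirac mass at 0, and the recursion kills every positive count. *)
have l00 : l = 0%R by apply/eqP; rewrite eq_le l1.
have q0 j : q B C j.+1%:R%:E = 0 by rewrite pE pk l00 exprS mul0r mul0r mulr0.
rewrite (nneseries_recl (P := xpredT))// -nneseries_addn//.
rewrite eseries0 ?adde0; last by move=> j _ _; rewrite addn1 q0.
rewrite /poisson_prob l00 ltxx diracE.
case: k => [|k]; first by rewrite mem_set// mule1.
by rewrite memNset ?mule0//; exact/eqP.
Qed.

(** Factorises value by value: each finite count has probability P(C) times a weight that does not
    depend on C, and for infinite intensity the whole mass sits at infinity. *)
Lemma npoints_indep B C A : measurable B -> measurable C -> measurable A ->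
  drop_stable B C ->
  P [set w | A (N B w) /\ C (t w)] = P [set w | A (N B w)] * P [set w | C (t w)].
Proof.
move=> mB mC mA BC; have BT : drop_stable B setT by [].
have PT : P [set w | A (N B w)] = P [set w | A (N B w) /\ setT (t w)].
  by congr (P _); apply/seteqP; split => w //= [].
have CP : P [set w | C (t w)] \is a fin_num.
  by rewrite fin_num_measure//; exact: mtC.
rewrite muleC PT !npoints_split// -(fineK CP) -nneseriesZl; last first.
  by move=> k _; case: ifP => // _; exact: measure_ge0.
have PTT : P [set w | setT (t w)] = 1 by exact: probability_setT.
have [Boo|Bfin] := eqVneq (intensity B) +oo.
  have qoo D : measurable D -> drop_stable B D -> q B D +oo = P [set w | D (t w)].
    move=> mD BD; have := npoints_split mB mD (@measurableT _ (\bar R)).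
    rewrite (_ : [set w | setT (N B w) /\ D (t w)] = [set w | D (t w)]); last first.
      by apply/seteqP; split => w // -[].
    move=> ->; rewrite (nneseries_recl (P := xpredT))//; last first.
      by move=> j _; case: ifP => // _; exact: measure_ge0.
    rewrite in_setT/= -nneseries_addn; last first.
      by move=> j; case: ifP => // _; exact: measure_ge0.
    by rewrite eseries0 ?adde0// => j _ _; rewrite addn1/= q_infinite//; case: ifP.
  apply: eq_eseriesr => k _; case: ifP => _; last by rewrite mule0.
  rewrite fineK//; case: k => [|k] /=; first by rewrite !qoo// PTT mule1.
  by rewrite !q_infinite// mule0.
have {}Bfin : intensity B < +oo by rewrite ltey.
apply: eq_eseriesr => k _; case: ifP => _; last by rewrite mule0.
rewrite fineK//; case: k => [|k] /=; first by rewrite !npoints_fin// mule0.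
by rewrite !q_finite// PTT mul1e.
Qed.

Lemma npoints_indep_family n (B : 'I_n -> set R) (A : 'I_n -> set (\bar R)) (s : seq 'I_n) :
  (forall i, measurable (B i)) -> trivIset setT B -> (forall i, measurable (A i)) ->
  uniq s ->
  P [set w | forall i, i \in s -> A i (N (B i) w)] =
  \prod_(i <- s) P [set w | A i (N (B i) w)].
Proof.
move=> mB tB mA; elim: s => [_|j s IH /= /andP[js us]].
  rewrite big_nil -[RHS](probability_setT P); congr (P _).
  by apply/seteqP; split.
rewrite big_cons -IH//.
pose C : set (mseq R) := [set z | forall i, i \in s -> A i (npoints (B i) z)].
have mC : measurable C.
  rewrite (_ : C = \bigcap_(i in [set` s]) (npoints (B i) @^-1` A i)).
    apply: fin_bigcap_measurable => // i _; rewrite -[X in measurable X]setTI.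
    exact: (@measurable_npoints _ _ R _ (mB i) measurableT _ (mA i)).
  by apply/seteqP; split.
(* A point of [B j] lies in none of the other blocks, so its removal leaves their counts
   unchanged. *)
have BC : drop_stable (B j) C.
  move=> z m Bz; have dE i : i \in s -> npoints (B i) (drop_at m z) = npoints (B i) z :> \bar R.
    move=> is'; rewrite [RHS](npoints_drop_at _ _ z m) diracE memNset ?add0e// => Biz.
    have /eqP ij : i = j by apply: (tB i j Logic.I Logic.I); exists (z m).
    by move: js; rewrite -(eqP ij) is'.
  by split => Cz i is'; [rewrite -dE//|rewrite dE//]; exact: Cz.
rewrite -(npoints_indep (mB j) mC (mA j) BC); congr (P _).
apply/seteqP; split => w /= H.
  by split => [|i is']; apply: H; rewrite in_cons ?eqxx// is' orbT.
by move=> i; rewrite in_cons => /predU1P[->|is']; [exact: H.1|exact: H.2].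
Qed.

Lemma mecke_poisson (lambda : set R -> \bar R) :
  (forall B, measurable B -> lambda B = intensity B) ->
  is_poisson_process P lambda (fun w => sum_diracs (t w)).
Proof.
move=> lE.
have stT B : drop_stable B setT by [].
have PTT : P [set w | setT (t w)] = 1 by exact: probability_setT.
have qT B e : P [set w | N B w = e] = q B setT e.
  by congr (P _); apply/seteqP; split => w //= -[].
split.
- exact: measurableT_comp (@measurable_sum_diracs _ R R) mt.
- move=> B mB; rewrite lE// => Bfin k.
  by rewrite [LHS]qT q_finite// PTT mul1e.
- move=> B mB; rewrite lE// => Boo.
  rewrite [LHS]qT; have := npoints_split mB (@measurableT _ (mseq R)) (@measurableT _ (\bar R)).
  rewrite (_ : [set w | setT (N B w) /\ setT (t w)] = setT); last by apply/seteqP; split.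
  rewrite [X in X = _ -> _]probability_setT => ->.
  rewrite (nneseries_recl (P := xpredT))//; last first.
    by move=> j _; case: ifP => // _; exact: measure_ge0.
  rewrite in_setT/= -nneseries_addn; last first.
    by move=> j; case: ifP => // _; exact: measure_ge0.
  by rewrite eseries0 ?adde0// => j _ _; rewrite addn1/= q_infinite//; case: ifP.
- move=> n B mB tB A mA.
  have := npoints_indep_family mB tB mA (index_enum_uniq _).
  move=> <-; congr (P _); apply/seteqP; split => w /= H i; first by move=> _; exact: H.
  by move=> _; apply: H; exact: mem_index_enum.
Qed.

End mecke.

(** * Scaling by an independent gamma variable *)

Section gamma_scaling.
Context (R : realType) d (Om : measurableType d) (P : probability Om R).
Variables (Z : Om -> mseq R) (mZ : measurable_fun setT Z).
Hypothesis Z01 : forall w n, 0 < Z w n < 1.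
Variables (a : R) (a0 : 0 < a).
Local Open Scope ereal_scope.
Hypothesis size_bias : forall K : R * mseq R -> \bar R,
  (forall p, 0 <= K p) -> measurable_fun setT K ->
  \int[P]_w (\sum_(i <oo) ((Z w i)%:E * K (Z w i, sdrop_at i (Z w)))) =
  \int[beta_measure (@ltr01 R) a0]_v \int[P]_w K (v, Z w).

Definition smul (c : R) (z : mseq R) : mseq R := fun n => (z n * c)%R.

(** Equal to g almost surely under the gamma law; the value 1 elsewhere makes the scaled points
    positive at every sample point, as [is_poisson_dirichlet] demands. *)
Definition gpos (g : R) : R := if (0 < g)%R then g else 1%R.

Definition scaled_seq (p : Om * R) : mseq R := smul (gpos p.2) (Z p.1).

Definition gamma_ext : probability (Om * R)%type R := P \x (gamma_law a).

Definition plam (x : R) : R := (if 0 < x then a * x^-1 * expR (- x) else 0)%R.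

Lemma plam_ge0 x : (0 <= plam x)%R.
Proof.
rewrite /plam; case: ifP => // x0.
by rewrite !mulr_ge0 ?expR_ge0 ?invr_ge0 ?(ltW a0) ?(ltW x0).
Qed.

Lemma measurable_plam : measurable_fun setT plam.
Proof.
apply: measurable_fun_ifT => //; first exact: measurable_fun_ltr.
apply: measurable_funM; last exact: (measurableT_comp (@measurable_expR R)).
by apply: measurable_funM; [exact: measurable_cst|apply: measurable_invr].
Qed.

Lemma gpos_gt0 g : (0 < gpos g)%R.
Proof. by rewrite /gpos; case: ifP. Qed.

Lemma gposE g : (0 < g)%R -> gpos g = g.
Proof. by rewrite /gpos => ->. Qed.

Lemma measurable_gpos : measurable_fun setT gpos.
Proof. by apply: measurable_fun_ifT => //; exact: measurable_fun_ltr. Qed.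

Lemma measurable_smul : measurable_fun setT (fun p : R * mseq R => smul p.1 p.2).
Proof.
apply: measurable_mseqP => n; apply: measurable_funM; last exact: measurable_fst.
exact: measurableT_comp (measurable_coord n) measurable_snd.
Qed.

Lemma measurable_smulE d' (S : measurableType d') (c : S -> R) (z : S -> mseq R) :
  measurable_fun setT c -> measurable_fun setT z ->
  measurable_fun setT (fun s => smul (c s) (z s)).
Proof.
move=> mc mz; exact: measurableT_comp measurable_smul (measurable_fun_pair mc mz).
Qed.

Lemma measurable_scaled_seq : measurable_fun setT scaled_seq.
Proof.
apply: measurable_smulE.
  exact: measurableT_comp measurable_gpos measurable_snd.
exact: measurableT_comp mZ measurable_fst.
Qed.

Section fixF.
Variable F : R * mseq R -> \bar R.
Hypotheses (F0 : forall p, 0 <= F p) (mF : measurable_fun setT F).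

Let Psi (p : R * R) : \bar R := \int[P]_w F (p.1, smul p.2 (Z w)).

Let Psi0 p : 0 <= Psi p. Proof. exact: integral_ge0. Qed.

Let mFZ d' (S : measurableType d') (x c : S -> R) (z : S -> mseq R) :
  measurable_fun setT x -> measurable_fun setT c -> measurable_fun setT z ->
  measurable_fun setT (fun s => F (x s, smul (c s) (z s))).
Proof.
move=> mx mc mz; apply: (measurableT_comp mF); apply: measurable_fun_pair => //.
exact: measurable_smulE.
Qed.

Let mPsi : measurable_fun setT Psi.
Proof.
apply: (@measurable_fun_fubini_tonelli_F _ _ _ _ R P
  (fun q : (R * R) * Om => F (q.1.1, smul q.1.2 (Z q.2)))) => //.
apply: mFZ.
- exact: measurableT_comp measurable_fst measurable_fst.
- exact: measurableT_comp measurable_snd measurable_fst.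
- exact: measurableT_comp mZ measurable_snd.
Qed.

Let A (g : R) : \bar R :=
  \int[P]_w \sum_(n <oo) F (Z w n * gpos g, drop_at n (smul (gpos g) (Z w)))%R.

Let mt : measurable_fun setT (fun p : Om * R =>
  \sum_(n <oo) F (scaled_seq p n, drop_at n (scaled_seq p))).
Proof.
apply: (ge0_emeasurable_sum (P := xpredT)) => // n _.
apply: (measurableT_comp mF); apply: measurable_fun_pair.
  exact: measurableT_comp (measurable_coord n) measurable_scaled_seq.
exact: measurableT_comp (measurable_drop_at n) measurable_scaled_seq.
Qed.

Let lhsE : \int[gamma_ext]_p (\sum_(n <oo) F (scaled_seq p n, drop_at n (scaled_seq p))) =
  \int[gamma_law a]_g A g.
Proof. by apply: (fubini_tonelli2 _ mt) => p; exact: nneseries_ge0. Qed.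

(** Here p.1 is the removed point and p.2 the total mass of the remaining ones. The factor 1/x, due
    to undoing the size bias, becomes the r^(-1) of the intensity. *)
Let f (p : R * R) : \bar R := (`|p.1|^-1)%:E * Psi p.

Let f0 p : 0 <= f p. Proof. by rewrite mule_ge0// lee_fin. Qed.

Let mf : measurable_fun setT f.
Proof.
apply: emeasurable_funM => //; apply/measurable_EFinP/measurable_invr.
exact: measurableT_comp (@normr_measurable R setT) measurable_fst.
Qed.

Let G (g : R) := \int[beta_measure (@ltr01 R) a0]_v f (g * v, g * (1 - v))%R.

(** Each summand is written as Z_i times a function K of Z_i and the rescaled remainder, where K
    carries the compensating factor g/(g Z_i). After the pick of size v, the remainder has total
    mass g (1 - v). *)
Let AE g : (0 < g)%R -> A g = `|g|%:E * G g.
Proof.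
move=> g0; have g00 := ltW g0.
pose K (p : R * mseq R) : \bar R :=
  g%:E * ((`|g * p.1|^-1)%:E * F (g * p.1, smul (g * (1 - p.1)) p.2)%R).
have K0 p : 0 <= K p by rewrite !mule_ge0// lee_fin.
have mgv : measurable_fun setT (fun v : R => (g * v)%R).
  by apply: measurable_funM; [exact: measurable_cst|exact: measurable_id].
have mg1v : measurable_fun setT (fun v : R => (g * (1 - v))%R).
  apply: measurable_funM; first exact: measurable_cst.
  by apply: measurable_funB; [exact: measurable_cst|exact: measurable_id].
have mK : measurable_fun setT K.
  apply: emeasurable_funM; first exact: measurable_cst.
  apply: emeasurable_funM.
    apply/measurable_EFinP/measurable_invr.
    apply: (measurableT_comp (@normr_measurable R setT)).
    exact: measurableT_comp mgv measurable_fst.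
  apply: mFZ; [| |exact: measurable_snd].
    exact: measurableT_comp mgv measurable_fst.
  exact: measurableT_comp mg1v measurable_fst.
transitivity (\int[P]_w (\sum_(i <oo) ((Z w i)%:E * K (Z w i, sdrop_at i (Z w))))).
  apply: eq_integral => w _; apply: eq_eseriesr => i _; rewrite /K/= !muleA -!EFinM.
  case/andP: (Z01 w i) => z0 z1.
  have -> : (Z w i * g * `|g * Z w i|^-1 = 1)%R.
    by rewrite gtr0_norm ?mulr_gt0// mulrC (mulrC g) mulVf// gt_eqF// mulr_gt0.
  rewrite mul1e gposE// (mulrC g (Z w i)); congr (F (_, _)).
  apply/funext => n; rewrite /smul/= /sdrop_at !drop_atE.
  have nz : (1 - Z w i != 0)%R by rewrite subr_eq0 gt_eqF.
  by move: (1 - Z w i)%R (Z w (bump i n)) nz => u y u0; field.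
rewrite size_bias// gtr0_norm// /G ge0_mulr_integral//; last first.
  by apply: (measurableT_comp mf); exact: measurable_fun_pair.
apply: eq_integral => v _; rewrite /K/=.
have mFv : measurable_fun setT (fun w => F (g * v, smul (g * (1 - v)) (Z w))%R).
  by apply: mFZ; [exact: measurable_cst|exact: measurable_cst|exact: mZ].
have ninv : (0 <= `|g * v|^-1)%R by rewrite invr_ge0.
rewrite -(ge0_mulr_integral P g00 _ (emeasurable_funM (measurable_cst _) mFv)); last first.
  by move=> w; rewrite mule_ge0// lee_fin.
by rewrite -(ge0_mulr_integral P ninv (fun w => F0 _) mFv).
Qed.

Let rhsE x : \int[gamma_ext]_p F (x, scaled_seq p) = \int[gamma_law a]_y Psi (x, y).
Proof.
have mx : measurable_fun setT (fun p : Om * R => F (x, scaled_seq p)).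
  apply: (measurableT_comp mF); apply: measurable_fun_pair; first exact: measurable_cst.
  exact: measurable_scaled_seq.
apply: etrans (fubini_tonelli2 _ mx (fun p => F0 (x, scaled_seq p))) _.
have mPx (y : R -> R) : measurable_fun setT y -> measurable_fun setT (fun s => Psi (x, y s)).
  move=> my; apply: (measurableT_comp mPsi).
  by apply: measurable_fun_pair; [exact: measurable_cst|exact: my].
apply: (gamma_law_gt0_eq (f := fun y => Psi (x, gpos y))) => //.
- by apply: mPx; exact: measurable_gpos.
- by apply: mPx; exact: measurable_id.
by move=> y y0; rewrite gposE.
Qed.

(** The factor g from [AE] turns the Gamma(a) total into a Gamma(1 + a) one, with constant a. This
    splits into an exponential x, the removed point, and an independent Gamma(a) mass of the rest;
    e^(-x) times a/x is the intensity. *)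
Lemma gamma_scaling_mecke :
  \int[gamma_ext]_p (\sum_(n <oo) F (scaled_seq p n, drop_at n (scaled_seq p))) =
  \int[@leb R]_x ((plam x)%:E * \int[gamma_ext]_p F (x, scaled_seq p)).
Proof.
have mG : measurable_fun setT G.
  have := @measurable_fun_fubini_tonelli_F _ _ _ _ R (beta_measure (@ltr01 R) a0)
    (fun p : R * R => f (p.1 * p.2, p.1 * (1 - p.2)))%R.
  apply=> //; apply: (measurableT_comp mf); apply: measurable_fun_pair.
    by apply: measurable_funM; [exact: measurable_fst|exact: measurable_snd].
  apply: measurable_funM; first exact: measurable_fst.
  by apply: measurable_funB; [exact: measurable_cst|exact: measurable_snd].
have G0 g : 0 <= G g by exact: integral_ge0.
have A0 g : 0 <= A g by apply: integral_ge0 => w _; exact: nneseries_ge0.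
have mA : measurable_fun setT A.
  by apply: (measurable_fun_fubini_tonelli_G _ mt) => p; exact: nneseries_ge0.
have mgG : measurable_fun setT (fun g : R => `|g|%:E * G g).
  by apply: emeasurable_funM => //; apply/measurable_EFinP; exact: (@normr_measurable R setT).
have gG0 g : 0 <= `|g|%:E * G g by rewrite mule_ge0// lee_fin.
have mI : measurable_fun setT (fun x => \int[gamma_law a]_y f (x, y)).
  have := @measurable_fun_fubini_tonelli_F _ _ _ _ R (gamma_law a) f; exact.
have I0 x : 0 <= \int[gamma_law a]_y f (x, y) by exact: integral_ge0.
apply: etrans lhsE _; apply: etrans (gamma_law_gt0_eq a0 A0 mA gG0 mgG AE) _.
apply: etrans (gamma_law_size_bias a0 G0 mG) _.
apply: etrans (congr1 (mule a%:E) (esym (gamma_law_add a0 f0 mf))) _.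
have E := ge0_integral_gamma_law (@ltr01 R) I0 mI; rewrite Gamma1 invr1 mul1e in E.
apply: etrans (congr1 (mule a%:E) E) _.
rewrite ge0_mulr_integral; last 3 first.
- exact: ltW.
- by move=> x; rewrite mule_ge0// lee_fin gdens_ge0.
- by apply: emeasurable_funM => //; apply/measurable_EFinP; exact: measurable_gdens.
apply: eq_integral => x _; rewrite rhsE.
have mPx : measurable_fun setT (fun y => Psi (x, y)).
  exact: (measurableT_comp mPsi (measurable_pair1 x)).
have ninv : (0 <= `|x|^-1)%R by rewrite invr_ge0.
rewrite -(ge0_mulr_integral (gamma_law a) ninv (fun y => Psi0 (x, y)) mPx).
rewrite !muleA -!EFinM; congr (_ * _); congr EFin; rewrite /plam /gdens.
case: ifPn => x0; last by rewrite mulr0 mul0r.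
by rewrite subrr powRr0 mul1r (gtr0_norm x0) mulrAC.
Qed.

End fixF.

Lemma gamma_scaling_poisson :
  is_poisson_process gamma_ext (gamma_intensity a) (fun p => sum_diracs (scaled_seq p)).
Proof.
apply: (@mecke_poisson _ _ _ _ _ measurable_scaled_seq plam plam_ge0 measurable_plam).
  exact: gamma_scaling_mecke.
move=> B mB; rewrite /gamma_intensity /density integral_leb; last 3 first.
- exact: measurableI.
- apply/measurable_EFinP/measurable_funTS/measurable_funM.
    apply: measurable_funM; first exact: measurable_cst.
    by apply: measurable_invr; exact: measurable_id.
  exact: (measurableT_comp (@measurable_expR R)).
- move=> x [_]; rewrite /= in_itv/= andbT => x0.
  by rewrite lee_fin !mulr_ge0 ?expR_ge0 ?invr_ge0 ?(ltW a0) ?(ltW x0).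
rewrite [LHS]integral_mkcond [RHS]integral_mkcond; apply: eq_integral => x _.
rewrite !patchE in_setI mem_setE/= in_itv/= andbT /plam.
by case: (x \in B) => //=; case: ifP.
Qed.

End gamma_scaling.

(** * Dirichlet laws as normalized gamma vectors *)

Section tuple_tools.
Context (R : realType).
Local Open Scope ereal_scope.

Definition tcons n (x : R) (y : n.-tuple R) : n.+1.-tuple R := [tuple of x :: y].

Definition tscale n (c : R) (y : n.-tuple R) : n.-tuple R :=
  [tuple of [seq c * z | z <- y]%R].

Definition tsum n (y : n.-tuple R) : R := (\sum_i tnth y i)%R.

Definition tnrm n (y : n.-tuple R) : n.-tuple R := tscale (tsum y)^-1 y.

Lemma tnth_tscale n c (y : n.-tuple R) i : tnth (tscale c y) i = (c * tnth y i)%R.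
Proof. by rewrite tnth_map. Qed.

Lemma tscale_tcons n c x (y : n.-tuple R) :
  tscale c (tcons x y) = tcons (c * x)%R (tscale c y).
Proof. exact: val_inj. Qed.

Lemma tscaleA n c c' (y : n.-tuple R) : tscale c (tscale c' y) = tscale (c * c')%R y.
Proof. by apply: eq_from_tnth => i; rewrite !tnth_tscale mulrA. Qed.

Lemma tsum_tcons n x (y : n.-tuple R) : tsum (tcons x y) = (x + tsum y)%R.
Proof. by rewrite /tsum big_ord_recl; congr (_ + _)%R; apply: eq_bigr => i _; rewrite tnthS. Qed.

Lemma tsum_tscale n c (y : n.-tuple R) : tsum (tscale c y) = (c * tsum y)%R.
Proof. by rewrite /tsum mulr_sumr; apply: eq_bigr => i _; rewrite tnth_tscale. Qed.

Lemma tcons_eta n (y : n.+1.-tuple R) : y = tcons (thead y) [tuple of behead y].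
Proof. by rewrite [LHS]tuple_eta; apply: val_inj. Qed.

Lemma tnrm_tscale n c (y : n.-tuple R) : (0 < c)%R -> tnrm (tscale c y) = tnrm y.
Proof.
move=> c0; rewrite /tnrm tscaleA tsum_tscale invfM -mulrA [X in (_ * X)%R]mulrC mulrA.
by rewrite mulVf ?mul1r// gt_eqF.
Qed.

Lemma measurable_tcons d (S : measurableType d) n (x : S -> R) (y : S -> n.-tuple R) :
  measurable_fun setT x -> measurable_fun setT y ->
  measurable_fun setT (fun s => tcons (x s) (y s)).
Proof. exact: measurable_cons. Qed.

Lemma measurable_tscale d (S : measurableType d) n (c : S -> R) (y : S -> n.-tuple R) :
  measurable_fun setT c -> measurable_fun setT y ->
  measurable_fun setT (fun s => tscale (c s) (y s)).
Proof.
move=> mc my; apply/measurable_fun_tnthP => i.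
rewrite (_ : _ \o _ = fun s => c s * tnth (y s) i)%R; last first.
  by apply/funext => s /=; rewrite tnth_tscale.
by apply: measurable_funM => //; exact: measurableT_comp (measurable_tnth i) my.
Qed.

Lemma measurable_tsum n : measurable_fun setT (@tsum n).
Proof. by apply: measurable_sum => i; exact: measurable_tnth. Qed.

Lemma measurable_tnrm n : measurable_fun setT (@tnrm n).
Proof.
apply: measurable_tscale; last exact: measurable_id.
by apply: measurable_invr; exact: measurable_tsum.
Qed.

Let tcons_pair n (p : R * n.-tuple R) := tcons p.1 p.2.

Lemma measurable_tcons_pair n : measurable_fun setT (@tcons_pair n).
Proof. by apply: measurable_tcons; [exact: measurable_fst|exact: measurable_snd]. Qed.

Fixpoint gamma_tuple n : n.-tuple R -> probability (n.-tuple R) R :=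
  match n with
  | 0 => fun=> \d_([tuple] : 0.-tuple R)
  | m.+1 => fun a => law
      (gamma_law (thead a) \x gamma_tuple [tuple of behead a] : probability (R * m.-tuple R)%type R)
      (measurable_tcons_pair (n := m))
  end.

Lemma integral_gamma_tuple0 (a : 0.-tuple R) (h : 0.-tuple R -> \bar R) :
  (forall y, 0 <= h y) -> measurable_fun setT h ->
  \int[gamma_tuple a]_y h y = h [tuple].
Proof. by move=> h0 mh; rewrite /= integral_dirac// diracT mul1e. Qed.

Lemma measurable_tuple_section d (S : measurableType d) n (a : n.-tuple R)
    (h : S * n.-tuple R -> \bar R) : (forall p, 0 <= h p) -> measurable_fun setT h ->
  measurable_fun setT (fun s => \int[gamma_tuple a]_y h (s, y)).
Proof. by move=> h0 mh; exact: measurable_fun_fubini_tonelli_F. Qed.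

Lemma integral_gamma_tuple n (a1 : R) (a : n.-tuple R) (h : n.+1.-tuple R -> \bar R) :
  (forall y, 0 <= h y) -> measurable_fun setT h ->
  \int[gamma_tuple (tcons a1 a)]_y h y =
  \int[gamma_law a1]_x \int[gamma_tuple a]_y h (tcons x y).
Proof.
move=> h0 mh; rewrite /= ge0_integral_law// theadE.
have -> : [tuple of behead (tcons a1 a)] = a by exact: val_inj.
rewrite (fubini_tonelli1 (fun p => h (tcons_pair p)))//.
exact: measurableT_comp mh (@measurable_tcons_pair n).
Qed.

Let tupleSF n (y : n.+1.-tuple R) : R * n.-tuple R := (thead y, [tuple of behead y]).

Section leb_step.
Variables (n : nat) (m : {sigma_finite_measure set (n.-tuple R) -> \bar R}).

Definition leb_step : set (n.+1.-tuple R) -> \bar R :=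
  image_measure (@leb R \x m) (measurable_tcons_pair (n := n)).

HB.instance Definition _ := Measure.on leb_step.

Let leb_step_sigma_finite : sigma_finite setT leb_step.
Proof.
have /sigma_finiteP[F [FT ndF Foo]] := sigma_finiteT (@leb R).
have /sigma_finiteP[G [GT ndG Goo]] := sigma_finiteT m.
have msf : measurable_fun setT (@tupleSF n).
  apply: measurable_fun_pair; first exact: (@measurable_tnth _ _ n.+1 ord0).
  exact: measurable_behead.
exists (fun k => @tupleSF n @^-1` (F k `*` G k)).
  apply/seteqP; split => // y _; have : setT (thead y) by [].
  have : setT [tuple of behead y] by [].
  rewrite FT GT => -[k _ Gk] [l _ Fl]; exists (maxn k l) => //; split.
    have /subsetPset := ndF l (maxn k l) (leq_maxr _ _); exact.
  have /subsetPset := ndG k (maxn k l) (leq_maxl _ _); exact.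
move=> k; have [mF Fk] := Foo k; have [mG Gk] := Goo k; split.
  by rewrite -[X in measurable X]setTI; apply: msf => //; exact: measurableX.
rewrite /leb_step/= /pushforward (_ : _ @^-1` _ = F k `*` G k).
  rewrite product_measure1E// lte_mul_pinfty//.
  by rewrite ge0_fin_numE.
apply/seteqP; split => -[x y]; rewrite /= /tupleSF/tcons_pair/= theadE;
  by have -> : [tuple of behead (tcons x y)] = y by exact: val_inj.
Qed.

HB.instance Definition _ :=
  @Measure_isSigmaFinite.Build _ _ _ leb_step leb_step_sigma_finite.

Definition leb_step_sf : {sigma_finite_measure set (n.+1.-tuple R) -> \bar R} := leb_step.

End leb_step.

(** A twin of [lebesgue_tuple], which is a bare set function; sigma-finiteness is carried through
    the recursion because Tonelli needs it in every dimension. *)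
Fixpoint leb_tuple n : {sigma_finite_measure set (n.-tuple R) -> \bar R} :=
  match n with
  | 0 => (\d_([tuple] : 0.-tuple R) : probability (0.-tuple R) R)
  | m.+1 => leb_step_sf (leb_tuple m)
  end.

Lemma leb_tupleE n A : measurable A -> @lebesgue_tuple R n A = leb_tuple n A.
Proof.
elim: n A => [//|n IH] A mA.
have mB : measurable (@tcons_pair n @^-1` A).
  by rewrite -[X in measurable X]setTI; exact: measurable_tcons_pair.
have -> : leb_tuple n.+1 A = \int[@leb R]_x leb_tuple n (xsection (@tcons_pair n @^-1` A) x).
  by [].
rewrite -integral_leb//; last exact: measurable_fun_xsection.
apply: eq_integral => x _; apply: IH.
exact: measurable_xsection.
Qed.

Section lebesgue_tuple_measure.
Variable n : nat.

Let lt0 : @lebesgue_tuple R n set0 = 0.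
Proof. by rewrite leb_tupleE. Qed.

Let lt_ge0 A : 0 <= @lebesgue_tuple R n A.
Proof.
elim: n A => [A|k IH A]; first exact: (measure_ge0 (\d_([tuple] : 0.-tuple R) : probability (0.-tuple R) R)).
by apply: integral_ge0 => x _; exact: IH.
Qed.

Let lt_sigma_additive : semi_sigma_additive (@lebesgue_tuple R n).
Proof.
move=> F mF tF mUF; rewrite leb_tupleE//.
under eq_cvg do under eq_bigr do rewrite leb_tupleE//.
exact: measure_semi_sigma_additive.
Qed.

HB.instance Definition _ := isMeasure.Build _ _ _ (@lebesgue_tuple R n)
  lt0 lt_ge0 lt_sigma_additive.

Lemma integral_lebesgue_tuple D (f : n.-tuple R -> \bar R) :
  \int[@lebesgue_tuple R n]_(x in D) f x = \int[leb_tuple n]_(x in D) f x.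
Proof. by apply: eq_measure_integral => A mA _; exact: leb_tupleE. Qed.

End lebesgue_tuple_measure.

Lemma integral_leb_tuple0 (h : 0.-tuple R -> \bar R) :
  (forall y, 0 <= h y) -> measurable_fun setT h ->
  \int[leb_tuple 0]_y h y = h [tuple].
Proof. by move=> h0 mh; rewrite /= integral_dirac// diracT mul1e. Qed.

Lemma integral_leb_tuple n (h : n.+1.-tuple R -> \bar R) :
  (forall y, 0 <= h y) -> measurable_fun setT h ->
  \int[leb_tuple n.+1]_y h y = \int[@leb R]_x \int[leb_tuple n]_y h (tcons x y).
Proof.
move=> h0 mh.
have mhc : measurable_fun setT (h \o @tcons_pair n).
  exact: measurableT_comp mh (@measurable_tcons_pair n).
rewrite /= /leb_step_sf/= /leb_step.
rewrite (@ge0_integral_pushforward _ _ _ _ _ _ (@measurable_tcons_pair n))//.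
rewrite preimage_setT.
apply: etrans (fubini_tonelli1 (m1 := @leb R) (m2 := leb_tuple n) _ _ _) _ => //.
by move=> p; exact: h0.
Qed.

Lemma integral_leb_tuple_scale n (c : R) (h : n.-tuple R -> \bar R) : (0 < c)%R ->
  (forall y, 0 <= h y) -> measurable_fun setT h ->
  \int[leb_tuple n]_y h y = (c ^+ n)%:E * \int[leb_tuple n]_y h (tscale c y).
Proof.
move=> c0; elim: n h => [|n IH] h h0 mh.
  rewrite !integral_leb_tuple0//; last exact: measurableT_comp mh (measurable_tscale (measurable_cst c) (@measurable_id _ _ _)).
  by rewrite expr0 mul1e; congr h; exact: val_inj.
have mhs k (g : k.-tuple R -> \bar R) : measurable_fun setT g ->
    measurable_fun setT (fun y => g (tscale c y)).
  move=> mg; apply: (measurableT_comp mg).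
  by apply: measurable_tscale; [exact: measurable_cst|exact: measurable_id].
have mht x : measurable_fun setT (fun y : n.-tuple R => h (tcons x y)).
  apply: (measurableT_comp mh).
  by apply: measurable_tcons; [exact: measurable_cst|exact: measurable_id].
have mI (g : n.+1.-tuple R -> \bar R) : (forall y, 0 <= g y) -> measurable_fun setT g ->
    measurable_fun setT (fun x => \int[leb_tuple n]_y g (tcons x y)).
  move=> g0 mg; apply: (@measurable_fun_fubini_tonelli_F _ _ _ _ R (leb_tuple n)
    (fun p : R * n.-tuple R => g (tcons p.1 p.2))) => //.
  exact: measurableT_comp mg (@measurable_tcons_pair n).
rewrite integral_leb_tuple// (ge0_integral_affine 0 c0); last 2 first.
- by move=> x; exact: integral_ge0.
- exact: mI.
have mh' : measurable_fun setT (fun y : n.+1.-tuple R => h (tscale c y)) by exact: mhs.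
have E := @integral_leb_tuple n (fun y => h (tscale c y)) (fun y => h0 _) mh'.
rewrite E exprS EFinM -muleA; congr (_ * _).
rewrite ge0_mulr_integral; last 3 first.
- by rewrite exprn_ge0// ltW.
- by move=> x; exact: integral_ge0.
- exact: (mI (fun y => h (tscale c y))).
apply: eq_integral => x _; rewrite addr0 (IH (fun y => h (tcons (c * x)%R y)))//.
by congr (_ * _); apply: eq_integral => y _; rewrite tscale_tcons.
Qed.

End tuple_tools.

(** * Polar coordinates for gamma vectors and the simplex *)

Section dirichlet_representation.
Context (R : realType).
Local Open Scope ereal_scope.

Lemma leb_eq_off0 (f g : R -> \bar R) :
  (forall x, 0 <= f x) -> measurable_fun setT f ->
  (forall x, 0 <= g x) -> measurable_fun setT g ->
  (forall x, x != 0%R -> f x = g x) -> \int[@leb R]_x f x = \int[@leb R]_x g x.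
Proof.
move=> f0 mf g0 mg fg; apply: ae_eq_integral => //.
exists [set 0%R]; split; first exact: measurable_set1.
  by rewrite /= /leb lebesgue_measure_set1.
by move=> x /= nfg; apply: contrapT => /eqP x0; apply: nfg => _; exact: fg.
Qed.

Lemma tuple_consP n (Q : n.+1.-tuple R -> Prop) :
  (forall x y, Q (tcons x y)) -> forall y, Q y.
Proof. by move=> H y; rewrite (tcons_eta y). Qed.

(** Cut off at negative arguments only, to agree with [dirichlet_pdf] on the closed simplex. The
    mismatch with [gdens] at 0 is removed by [leb_eq_off0]. *)
Definition pweight (a x : R) : R := (if 0 <= x then x `^ (a - 1) else 0)%R.

Definition tweight n (a x : n.-tuple R) : R := (\prod_i pweight (tnth a i) (tnth x i))%R.

Lemma pweight_ge0 a x : (0 <= pweight a x)%R.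
Proof. by rewrite /pweight; case: ifP => // _; exact: powR_ge0. Qed.

Lemma measurable_pweight a : measurable_fun setT (pweight a).
Proof.
by apply: measurable_fun_ifT => //; apply: measurable_fun_ler.
Qed.

Lemma tweight_ge0 n (a x : n.-tuple R) : (0 <= tweight a x)%R.
Proof. by apply: prodr_ge0 => i _; exact: pweight_ge0. Qed.

Lemma measurable_tweight n (a : n.-tuple R) : measurable_fun setT (tweight a).
Proof.
apply: measurable_prod => i _.
exact: measurableT_comp (measurable_pweight _) (measurable_tnth i).
Qed.

Lemma tweight_tcons n a1 (a : n.-tuple R) x y :
  tweight (tcons a1 a) (tcons x y) = (pweight a1 x * tweight a y)%R.
Proof.
by rewrite /tweight big_ord_recl; congr (_ * _)%R; apply: eq_bigr => i _; rewrite !tnthS.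
Qed.

Lemma tweight_tscale n (a x : n.-tuple R) (g : R) : (0 < g)%R ->
  tweight a (tscale g x) = (g `^ (tsum a - n%:R) * tweight a x)%R.
Proof.
move=> g0; elim: n a x => [|n IH] a x.
  by rewrite /tweight /tsum !big_ord0 subrr powRr0 mulr1.
elim/tuple_consP: a => a1 a; elim/tuple_consP: x => x1 x.
rewrite tscale_tcons !tweight_tcons IH tsum_tcons.
have -> : pweight a1 (g * x1) = (g `^ (a1 - 1) * pweight a1 x1)%R.
  rewrite /pweight pmulr_rge0//; case: ifPn => x0; last by rewrite mulr0.
  by rewrite powRM// ltW.
have -> : (a1 + tsum a - n.+1%:R = (a1 - 1) + (tsum a - n%:R))%R.
  by rewrite -natr1; ring.
rewrite [X in (_ = X * _)%R]powRD; last by rewrite (gt_eqF g0) implybT.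
by rewrite mulrACA.
Qed.

Lemma prod_Gamma_gt0 n (a : n.-tuple R) : (forall i, 0 < tnth a i)%R ->
  (0 < \prod_i Gamma (tnth a i))%R.
Proof. by move=> a0; apply: prodr_gt0 => i _; exact: Gamma_gt0. Qed.

Lemma measurable_tcons_cst n (h : n.+1.-tuple R -> \bar R) x :
  measurable_fun setT h -> measurable_fun setT (fun y => h (tcons x y)).
Proof.
move=> mh; apply: (measurableT_comp mh).
by apply: measurable_tcons; [exact: measurable_cst|exact: measurable_id].
Qed.

Lemma measurable_gamma_tuple_tcons n (a : n.-tuple R) (h : n.+1.-tuple R -> \bar R) :
  (forall y, 0 <= h y) -> measurable_fun setT h ->
  measurable_fun setT (fun x => \int[gamma_tuple a]_y h (tcons x y)).
Proof.
move=> h0 mh.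
apply: (@measurable_tuple_section R _ _ _ a (fun p => h (tcons p.1 p.2))) => //.
apply: (measurableT_comp mh).
by apply: measurable_tcons; [exact: measurable_fst|exact: measurable_snd].
Qed.

Lemma integral_gamma_tuple_density n (a : n.-tuple R) (h : n.-tuple R -> \bar R) :
  (forall i, 0 < tnth a i)%R -> (forall y, 0 <= h y) -> measurable_fun setT h ->
  \int[leb_tuple R n]_y ((tweight a y * expR (- tsum y))%:E * h y) =
  (\prod_i Gamma (tnth a i))%:E * \int[gamma_tuple a]_y h y.
Proof.
have mwe k (b : k.-tuple R) :
    measurable_fun setT (fun y => (tweight b y * expR (- tsum y))%:E).
  apply/measurable_EFinP; apply: measurable_funM; first exact: measurable_tweight.
  apply: (measurableT_comp (@measurable_expR R)).
  exact: (measurableT_comp (@oppr_measurable R setT) (@measurable_tsum R k)).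
have we0 k (b y : k.-tuple R) : 0 <= (tweight b y * expR (- tsum y))%:E.
  by rewrite lee_fin mulr_ge0 ?tweight_ge0 ?expR_ge0.
elim: n a h => [|n IH] a h a0 h0 mh.
  rewrite integral_leb_tuple0; last 2 first.
  - by move=> y; exact: mule_ge0.
  - by apply: emeasurable_funM; [exact: mwe|exact: mh].
  by rewrite integral_gamma_tuple0// /tweight /tsum !big_ord0 oppr0 expR0 mulr1.
elim/tuple_consP: a a0 => a1 a a0.
have a10 : (0 < a1)%R by have := a0 ord0; rewrite tnth0.
have a'0 i : (0 < tnth a i)%R by have := a0 (lift ord0 i); rewrite tnthS.
rewrite integral_leb_tuple; last 2 first.
- by move=> y; exact: mule_ge0.
- by apply: emeasurable_funM; [exact: mwe|exact: mh].
rewrite integral_gamma_tuple//.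
have mI : measurable_fun setT (fun x => \int[gamma_tuple a]_y h (tcons x y)).
  exact: measurable_gamma_tuple_tcons.
have I0 x : 0 <= \int[gamma_tuple a]_y h (tcons x y) by exact: integral_ge0.
rewrite ge0_integral_gamma_law// big_ord_recl tnth0.
rewrite [X in (_ * X)%R](_ : _ = \prod_i Gamma (tnth a i))%R; last first.
  by apply: eq_bigr => i _; rewrite tnthS.
set G := (\prod_i _)%R; have G0 : (0 < G)%R by exact: prod_Gamma_gt0.
rewrite muleA -EFinM mulrAC mulfV ?gt_eqF ?Gamma_gt0// mul1r.
rewrite ge0_mulr_integral; last 3 first.
- exact: ltW.
- by move=> x; rewrite mule_ge0// lee_fin gdens_ge0.
- by apply: emeasurable_funM => //; apply/measurable_EFinP; exact: measurable_gdens.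
transitivity (\int[@leb R]_x ((pweight a1 x * expR (- x))%:E *
    (G%:E * \int[gamma_tuple a]_y h (tcons x y)))).
  apply: eq_integral => x _; rewrite -(IH a (fun y => h (tcons x y)))//; last first.
    exact: measurable_tcons_cst.
  rewrite ge0_mulr_integral; last 3 first.
  - by rewrite mulr_ge0 ?pweight_ge0 ?expR_ge0.
  - by move=> y; exact: mule_ge0.
  - by apply: emeasurable_funM; [exact: mwe|exact: measurable_tcons_cst].
  apply: eq_integral => y _; rewrite tweight_tcons tsum_tcons opprD expRD muleA -EFinM.
  by rewrite mulrACA.
apply: leb_eq_off0.
- by move=> x; rewrite !mule_ge0// lee_fin ?mulr_ge0 ?pweight_ge0 ?expR_ge0// ltW.
- apply: emeasurable_funM; last by apply: emeasurable_funM => //; exact: measurable_cst.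
  apply/measurable_EFinP; apply: measurable_funM; first exact: measurable_pweight.
  apply: (measurableT_comp (@measurable_expR R)).
  exact: (@oppr_measurable R setT).
- by move=> x; rewrite !mule_ge0// lee_fin ?gdens_ge0// ltW.
- apply: emeasurable_funM; first exact: measurable_cst.
  by apply: emeasurable_funM => //; apply/measurable_EFinP; exact: measurable_gdens.
move=> x nx; rewrite muleCA; congr (_ * (_%:E * _)).
by rewrite /pweight /gdens lt_neqAle eq_sym nx/=; case: ifP => //; rewrite mul0r.
Qed.

Definition trcons n (y : n.-tuple R) (x : R) : n.+1.-tuple R := [tuple of rcons y x].

Lemma trcons_tcons n x (y : n.-tuple R) t : trcons (tcons x y) t = tcons x (trcons y t).
Proof. exact: val_inj. Qed.

Lemma tsum_trcons n (y : n.-tuple R) t : tsum (trcons y t) = (tsum y + t)%R.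
Proof.
elim: n y => [|n IH] y.
  rewrite /tsum big_ord_recr !big_ord0 (tnth_nth 0%R)/= !add0r.
  by rewrite (tuple0 y).
by elim/tuple_consP: y => x y; rewrite trcons_tcons !tsum_tcons IH addrA.
Qed.

Lemma tscale_trcons n c (y : n.-tuple R) t :
  tscale c (trcons y t) = trcons (tscale c y) (c * t)%R.
Proof. by apply: val_inj; rewrite /= map_rcons. Qed.

Lemma measurable_trcons d (S : measurableType d) n (y : S -> n.-tuple R) (t : S -> R) :
  measurable_fun setT y -> measurable_fun setT t ->
  measurable_fun setT (fun s => trcons (y s) (t s)).
Proof.
move=> my mt; elim: n y my => [|n IH] y my.
  rewrite (_ : (fun s => _) = (fun s => tcons (t s) [tuple])).
    by apply: measurable_tcons => //; exact: measurable_cst.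
  by apply/funext => s; apply: val_inj; rewrite /= (tuple0 (y s)).
rewrite (_ : (fun s => _) = (fun s => tcons (thead (y s)) (trcons [tuple of behead (y s)] (t s)))).
  apply: measurable_tcons; last apply: IH.
    exact: measurableT_comp (@measurable_tnth _ _ n.+1 ord0) my.
  exact: measurableT_comp (@measurable_behead _ _ _) my.
by apply/funext => s; rewrite [in LHS](tcons_eta (y s)) trcons_tcons.
Qed.

(** The recursion for [leb_tuple] splits off the first coordinate, whereas [simplex_point] appends
    the dependent coordinate at the end. *)
Lemma integral_leb_tuple_rcons n (h : n.+1.-tuple R -> \bar R) :
  (forall y, 0 <= h y) -> measurable_fun setT h ->
  \int[leb_tuple R n.+1]_y h y = \int[leb_tuple R n]_y \int[@leb R]_t h (trcons y t).
Proof.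
move=> h0; elim: n h h0 => [|n IH] h h0 mh.
  have mI : measurable_fun setT (fun y : 0.-tuple R => \int[@leb R]_t h (trcons y t)).
    apply: (@measurable_fun_fubini_tonelli_F _ _ _ _ R (@leb R) (fun p => h (trcons p.1 p.2))) => //.
    by apply: (measurableT_comp mh); apply: measurable_trcons; [exact: measurable_fst|exact: measurable_snd].
  rewrite integral_leb_tuple// (@integral_leb_tuple0 R (fun y => \int[@leb R]_t h (trcons y t)))//; last first.
    by move=> y; exact: integral_ge0.
  apply: eq_integral => t _; rewrite integral_leb_tuple0//; last exact: measurable_tcons_cst.
  by congr h; exact: val_inj.
have mI : measurable_fun setT (fun y : n.+1.-tuple R => \int[@leb R]_t h (trcons y t)).
  apply: (@measurable_fun_fubini_tonelli_F _ _ _ _ R (@leb R) (fun p => h (trcons p.1 p.2))) => //.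
  by apply: (measurableT_comp mh); apply: measurable_trcons; [exact: measurable_fst|exact: measurable_snd].
rewrite integral_leb_tuple// (@integral_leb_tuple R n (fun y => \int[@leb R]_t h (trcons y t)))//; last first.
  by move=> y; exact: integral_ge0.
apply: eq_integral => x _.
apply: etrans (IH (fun y => h (tcons x y)) (fun y => h0 _) (measurable_tcons_cst x mh)) _.
by apply: eq_integral => y _; apply: eq_integral => t _; rewrite trcons_tcons.
Qed.

Lemma simplex_pointE m (x : m.-tuple R) : simplex_point x = trcons x (1 - tsum x)%R.
Proof. exact: val_inj. Qed.

Lemma tsum_simplex_point m (x : m.-tuple R) : tsum (simplex_point x) = 1%R.
Proof. by rewrite simplex_pointE tsum_trcons addrC subrK. Qed.

Lemma measurable_simplex_point m : measurable_fun setT (@simplex_point R m).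
Proof.
rewrite (_ : @simplex_point R m = fun x => trcons x (1 - tsum x)%R); last first.
  by apply/funext => x; rewrite simplex_pointE.
apply: measurable_trcons; first exact: measurable_id.
by apply: measurable_funB; [exact: measurable_cst|exact: measurable_tsum].
Qed.

Lemma tweight_lt0 n (a x : n.-tuple R) : (tsum x < 0)%R -> tweight a x = 0%R.
Proof.
move=> x0; have [i xi] : exists i, (tnth x i < 0)%R.
  apply/not_existsP => H; move: x0; apply/negP; rewrite -leNgt.
  by apply: sumr_ge0 => i _; rewrite leNgt; apply/negP; exact: H.
rewrite /tweight (bigD1 i)//= /pweight leNgt xi/=; exact: mul0r.
Qed.

(** The last coordinate is replaced by the sum g, then the others are scaled by g, with Jacobian
    g^m. Homogeneity of [tweight] contributes the exponent [tsum a] - (m+1), and together they give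
    the Gamma([tsum a]) density in g. *)
Lemma gamma_tuple_polar m (a : m.+1.-tuple R) (h : m.+1.-tuple R -> \bar R) :
  (forall i, 0 < tnth a i)%R -> (forall y, 0 <= h y) -> measurable_fun setT h ->
  (\prod_i Gamma (tnth a i))%:E * \int[gamma_tuple a]_y h y =
  \int[@leb R]_g ((gdens (tsum a) g)%:E * \int[leb_tuple R m]_x
    ((tweight a (simplex_point x))%:E * h (tscale g (simplex_point x)))).
Proof.
move=> a0 h0 mh; rewrite -integral_gamma_tuple_density//.
pose F (y : m.+1.-tuple R) := (tweight a y * expR (- tsum y))%:E * h y.
have F0 y : 0 <= F y by rewrite mule_ge0// lee_fin mulr_ge0 ?tweight_ge0 ?expR_ge0.
have mF : measurable_fun setT F.
  apply: emeasurable_funM; last exact: mh.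
  apply/measurable_EFinP; apply: measurable_funM; first exact: measurable_tweight.
  apply: (measurableT_comp (@measurable_expR R)).
  exact: (measurableT_comp (@oppr_measurable R setT) (@measurable_tsum R _)).
rewrite -/(F _) (integral_leb_tuple_rcons F0 mF).
pose K (p : m.-tuple R * R) := F (trcons p.1 (p.2 - tsum p.1)%R).
have K0 p : 0 <= K p by exact: F0.
have mK : measurable_fun setT K.
  apply: (measurableT_comp mF); apply: measurable_trcons; first exact: measurable_fst.
  apply: measurable_funB; first exact: measurable_snd.
  exact: measurableT_comp (@measurable_tsum R m) measurable_fst.
transitivity (\int[leb_tuple R m]_y \int[@leb R]_g K (y, g)).
  apply: eq_integral => y _.
  rewrite (@ge0_integral_affine R 1 (- tsum y) (fun t => F (trcons y t)))//.
    rewrite mul1e; apply: eq_integral => g _.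
    by rewrite mul1r.
  by apply: (measurableT_comp mF); apply: measurable_trcons; [exact: measurable_cst|exact: measurable_id].
rewrite (@fubini_tonelli _ _ _ _ _ (leb_tuple R m) (@leb R) K mK K0).
pose W (p : R * m.-tuple R) :=
  (tweight a (simplex_point p.2))%:E * h (tscale p.1 (simplex_point p.2)).
have W0 p : 0 <= W p by rewrite mule_ge0// lee_fin tweight_ge0.
have msp2 : measurable_fun setT (fun p : R * m.-tuple R => simplex_point p.2).
  exact: measurableT_comp (@measurable_simplex_point m) measurable_snd.
have mW : measurable_fun setT W.
  apply: emeasurable_funM.
    by apply/measurable_EFinP; exact: (measurableT_comp (measurable_tweight a) msp2).
  apply: (measurableT_comp mh); apply: measurable_tscale; last exact: msp2.
  exact: measurable_fst.
apply: leb_eq_off0.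
- by move=> g; exact: integral_ge0.
- have := @measurable_fun_fubini_tonelli_G _ _ _ _ _ (leb_tuple R m) K.
  by apply.
- by move=> g; rewrite mule_ge0 ?lee_fin ?gdens_ge0//; apply: integral_ge0 => x _; exact: (W0 (g, x)).
- apply: emeasurable_funM; first by apply/measurable_EFinP; exact: measurable_gdens.
  have := @measurable_fun_fubini_tonelli_F _ _ _ _ _ (leb_tuple R m) W.
  by apply.
(* A negative sum forces a negative coordinate, where the weight vanishes; g = 0 has been discarded
   as a null point. *)
move=> g ng; have [g0|g0] := ltP 0%R g; last first.
  have g0' : (g < 0)%R by rewrite lt_neqAle ng.
  rewrite /gdens ltNge g0/= mul0e; apply: integral0_eq => x _.
  by rewrite /K /F tweight_lt0 ?mul0r ?mul0e// tsum_trcons addrC subrK.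
have mKg : measurable_fun setT (fun x => K (x, g)).
  exact: (measurableT_comp mK (measurable_pair2 g)).
rewrite (@integral_leb_tuple_scale R m g (fun x => K (x, g)))// ge0_mulr_integral; last 3 first.
- by rewrite exprn_ge0// ltW.
- by move=> x; exact: K0.
- apply: (measurableT_comp mKg); apply: measurable_tscale; [exact: measurable_cst|exact: measurable_id].
have mWg : measurable_fun setT (fun x => W (g, x)).
  exact: (measurableT_comp mW (measurable_pair1 g)).
rewrite (@ge0_mulr_integral _ _ _ _ _ (fun x => W (g, x))) ?gdens_ge0//.
apply: eq_integral => x _; rewrite /K /F/= /W/=.
have -> : trcons (tscale g x) (g - tsum (tscale g x)) = tscale g (simplex_point x).
  by rewrite simplex_pointE tscale_trcons tsum_tscale mulrBr mulr1.
rewrite tweight_tscale// tsum_tscale tsum_simplex_point mulr1 !muleA -!EFinM.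
congr (_%:E * _); rewrite /gdens g0.
have -> : (tsum a - 1 = m%:R + (tsum a - m.+1%:R))%R by rewrite -natr1; ring.
rewrite [in RHS]powRD; last by rewrite (gt_eqF g0) implybT.
by rewrite powR_mulrn ?ltW//; ring.
Qed.

End dirichlet_representation.

Section dirichlet_gamma.
Context (R : realType).
Local Open Scope ereal_scope.

Lemma tnrm_sum1 n (p : n.-tuple R) : tsum p = 1%R -> tnrm p = p.
Proof.
by move=> p1; rewrite /tnrm p1 invr1; apply: eq_from_tnth => i; rewrite tnth_tscale mul1r.
Qed.

Lemma integral_prob_indic d (S : measurableType d) (m : probability S R) A :
  measurable A -> \int[m]_x (\1_A x)%:E = m A.
Proof. by move=> mA; rewrite integral_indic// setIT. Qed.

Lemma mule_EFin_inj (c : R) (x y : \bar R) : (0 < c)%R -> c%:E * x = c%:E * y -> x = y.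
Proof.
move=> c0 /(congr1 (mule (c^-1)%:E)); rewrite !muleA -EFinM mulVf ?gt_eqF//.
by rewrite !mul1e.
Qed.

Section positive_parameters.
Variables (m : nat) (a : m.+1.-tuple R).
Hypothesis a0 : forall i, (0 < tnth a i)%R.

Definition simplex_integral (k : m.+1.-tuple R -> \bar R) :=
  \int[leb_tuple R m]_x ((tweight a (simplex_point x))%:E * k (simplex_point x)).

Lemma simplex_integral_ge0 k : (forall y, 0 <= k y) -> 0 <= simplex_integral k.
Proof. by move=> k0; apply: integral_ge0 => x _; rewrite mule_ge0// lee_fin tweight_ge0. Qed.

Lemma tsum_gt0 : (0 < tsum a)%R.
Proof.
rewrite /tsum big_ord_recl; apply: ltr_wpDr => //.
by apply: sumr_ge0 => i _; exact: ltW.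
Qed.

Let G0 : (0 < \prod_i Gamma (tnth a i))%R. Proof. exact: prod_Gamma_gt0. Qed.

Lemma gamma_tuple_polar_nrm (H : R * m.+1.-tuple R -> \bar R) :
  (forall p, 0 <= H p) -> measurable_fun setT H ->
  (\prod_i Gamma (tnth a i))%:E * \int[gamma_tuple a]_y H (tsum y, tnrm y) =
  \int[@leb R]_g ((gdens (tsum a) g)%:E * simplex_integral (fun x => H (g, x))).
Proof.
move=> H0 mH; pose h (y : m.+1.-tuple R) := H (tsum y, tnrm y).
have mh : measurable_fun setT h.
  apply: (measurableT_comp mH); apply: measurable_fun_pair.
    exact: measurable_tsum.
  exact: measurable_tnrm.
apply: (etrans (gamma_tuple_polar a0 (fun y => H0 _ : 0 <= h y) mh)).
apply: eq_integral => g _; rewrite /gdens; case: ifPn => [g0|_]; last by rewrite !mul0e.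
congr (_ * _); apply: eq_integral => x _; rewrite /h; congr (_ * H (_, _)).
  by rewrite tsum_tscale tsum_simplex_point mulr1.
by rewrite tnrm_tscale// tnrm_sum1// tsum_simplex_point.
Qed.

Lemma gamma_tuple_nrm (k : m.+1.-tuple R -> \bar R) :
  (forall y, 0 <= k y) -> measurable_fun setT k ->
  (\prod_i Gamma (tnth a i))%:E * \int[gamma_tuple a]_y k (tnrm y) =
  (Gamma (tsum a))%:E * simplex_integral k.
Proof.
move=> k0 mk; have mk2 : measurable_fun setT (fun p : R * m.+1.-tuple R => k p.2).
  exact: measurableT_comp mk measurable_snd.
apply: (etrans (gamma_tuple_polar_nrm (fun p => k0 p.2) mk2)).
have -> : \int[@leb R]_g ((gdens (tsum a) g)%:E * simplex_integral k) =
    (\int[@leb R]_g (gdens (tsum a) g)%:E) * simplex_integral k.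
  apply: ge0_integralZr => //.
  - by apply/measurable_EFinP; exact: measurable_gdens.
  - by move=> g _; rewrite lee_fin gdens_ge0.
  - exact: simplex_integral_ge0.
by rewrite EFin_Gamma// tsum_gt0.
Qed.

(** In polar form the density is a product of a function of the sum and one of the direction, so the
    two are independent; [gamma_tuple_nrm] identifies the normalising constant. *)
Lemma gamma_tuple_indep_pos (H : R * m.+1.-tuple R -> \bar R) :
  (forall p, 0 <= H p) -> measurable_fun setT H ->
  \int[gamma_tuple a]_y H (tsum y, tnrm y) =
  \int[gamma_law (tsum a)]_g \int[gamma_tuple a]_y H (g, tnrm y).
Proof.
move=> H0 mH; have S0 := Gamma_gt0 tsum_gt0.
have mHn : measurable_fun setT (fun p : R * m.+1.-tuple R => H (p.1, tnrm p.2)).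
  apply: (measurableT_comp mH); apply: measurable_fun_pair; first exact: measurable_fst.
  exact: measurableT_comp (@measurable_tnrm R _) measurable_snd.
have mI : measurable_fun setT (fun g => \int[gamma_tuple a]_y H (g, tnrm y)).
  exact: (@measurable_tuple_section R _ _ _ a (fun p => H (p.1, tnrm p.2))).
have I0 g : 0 <= \int[gamma_tuple a]_y H (g, tnrm y) by exact: integral_ge0.
rewrite ge0_integral_gamma_law//; last exact: tsum_gt0.
apply: (mule_EFin_inj G0).
rewrite (gamma_tuple_polar_nrm H0 mH) muleCA ge0_mulr_integral; last 3 first.
- exact: ltW.
- by move=> g; rewrite mule_ge0// lee_fin gdens_ge0.
- by apply: emeasurable_funM => //; apply/measurable_EFinP; exact: measurable_gdens.
rewrite ge0_mulr_integral; last 3 first.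
- by rewrite invr_ge0 ltW.
- by move=> g; rewrite !mule_ge0// lee_fin ?gdens_ge0// ltW.
- apply: emeasurable_funM; first exact: measurable_cst.
  by apply: emeasurable_funM => //; apply/measurable_EFinP; exact: measurable_gdens.
apply: eq_integral => g _; rewrite [X in _ = _ * X]muleCA.
have mHg : measurable_fun setT (fun y => H (g, y)).
  exact: (measurableT_comp mH (measurable_pair1 g)).
rewrite (gamma_tuple_nrm (fun y => H0 (g, y)) mHg) [RHS]muleCA; congr (_ * _).
by rewrite muleA -EFinM mulVf ?mul1e// gt_eqF.
Qed.

(** The coordinates of a [simplex_point] always sum to 1, so leaving the simplex means having a
    negative coordinate. Hence integrals over the simplex extend to the whole space. *)
Lemma simplex_point_notin (x : m.-tuple R) : ~ simplex (simplex_point x) ->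
  tweight a (simplex_point x) = 0%R.
Proof.
move=> nx; have [i xi] : exists i, (tnth (simplex_point x) i < 0)%R.
  apply/not_existsP => H; apply: nx.
  have p0 i : (0 <= tnth (simplex_point x) i)%R by rewrite leNgt; apply/negP; exact: H.
  split; last exact: tsum_simplex_point.
  move=> i; rewrite p0/= -(tsum_simplex_point x) /tsum (bigD1 i)//= lerDl.
  by apply: sumr_ge0.
rewrite /tweight (bigD1 i)//= /pweight leNgt xi/=; exact: mul0r.
Qed.

End positive_parameters.

Lemma dirichlet_posE n (a : n.-tuple R) A : (0 < n)%N -> (forall i, 0 < tnth a i)%R ->
  measurable A -> dirichlet_pos a A = gamma_tuple a (@tnrm R n @^-1` A).
Proof.
case: n a A => [//|m] a A _ a0 mA.
have mnA : measurable (@tnrm R m.+1 @^-1` A).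
  by rewrite -[X in measurable X]setTI; exact: measurable_tnrm.
have G0 := prod_Gamma_gt0 a0; have S0 := Gamma_gt0 (tsum_gt0 a0).
have iA0 (y : m.+1.-tuple R) : 0 <= (\1_A y)%:E :> \bar R by rewrite lee_fin.
have miA : measurable_fun setT (fun y : m.+1.-tuple R => (\1_A y)%:E : \bar R).
  by apply/measurable_EFinP; exact: measurable_indic.
have -> : gamma_tuple a (@tnrm R m.+1 @^-1` A) =
    ((Gamma (tsum a) / \prod_i Gamma (tnth a i))%:E * simplex_integral a (fun y => (\1_A y)%:E)).
  apply: (mule_EFin_inj G0); rewrite muleA -EFinM mulrCA mulfV ?gt_eqF// mulr1.
  by rewrite -gamma_tuple_nrm// -integral_prob_indic.
case: m a A a0 mA mnA G0 S0 iA0 miA => [|m] a A a0 mA mnA G0 S0 iA0 miA.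
  rewrite /simplex_integral integral_leb_tuple0; last 2 first.
  - by move=> y; rewrite mule_ge0// lee_fin tweight_ge0.
  - apply: emeasurable_funM; first apply/measurable_EFinP.
      exact: (measurableT_comp (measurable_tweight a) (@measurable_simplex_point R 0)).
    exact: (measurableT_comp miA (@measurable_simplex_point R 0)).
  have -> : (Gamma (tsum a) / \prod_i Gamma (tnth a i) = 1)%R.
    have -> : (\prod_i Gamma (tnth a i) = Gamma (tsum a))%R by rewrite /tsum !big_ord1.
    by rewrite mulfV// gt_eqF.
  have -> : simplex_point ([tuple] : 0.-tuple R) = [tuple 1%R].
    by apply: val_inj; rewrite /= big_ord0 subr0.
  rewrite /tweight big_ord_recl big_ord0 /pweight tnth0 ler01 powR1 mulr1 !mul1e.
  by rewrite /= diracE indicE.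
rewrite /= integral_lebesgue_tuple integral_mkcond /simplex_integral ge0_mulr_integral; last 3 first.
- by rewrite divr_ge0// ltW.
- by move=> y; rewrite mule_ge0// lee_fin tweight_ge0.
- apply: emeasurable_funM; first apply/measurable_EFinP.
    exact: (measurableT_comp (measurable_tweight a) (@measurable_simplex_point R _)).
  exact: (measurableT_comp miA (@measurable_simplex_point R _)).
apply: eq_integral => x _; rewrite patchE; case: ifPn => [/set_mem[[p01 _] Ax]|].
  rewrite indicE mem_set// mule1 -EFinM; congr (_%:E); rewrite /dirichlet_pdf; congr (_ * _)%R.
  by apply: eq_bigr => i _; rewrite /pweight; case/andP: (p01 i) => ->.
rewrite notin_setE => nx; have [Ax|Ax] := pselect (A (simplex_point x)); last first.
  by rewrite indicE memNset// !mule0.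
by rewrite simplex_point_notin ?mul0e ?mule0// => sx; exact: nx.
Qed.

End dirichlet_gamma.

(** * Vanishing Dirichlet parameters *)

Section zero_parameters.
Context (R : realType).
Local Open Scope ereal_scope.

Lemma zero_extend_pos n (a : n.-tuple R) a1 x (y : seq R) : (0 < a1)%R ->
  zero_extend (tcons a1 a) (x :: y) = tcons x (zero_extend a y).
Proof.
move=> a10; apply: eq_from_tnth => i; rewrite tnth_mktuple.
case: (unliftP ord0 i) => [j ->|->]; last by rewrite !tnth0 a10.
by rewrite !tnthS tnth_mktuple /= a10.
Qed.

Lemma zero_extend_npos n (a : n.-tuple R) a1 (y : seq R) : (a1 <= 0)%R ->
  zero_extend (tcons a1 a) y = tcons 0%R (zero_extend a y).
Proof.
move=> a10; apply: eq_from_tnth => i; rewrite tnth_mktuple.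
case: (unliftP ord0 i) => [j ->|->]; last by rewrite !tnth0 ltNge a10.
by rewrite !tnthS tnth_mktuple /= [(0 < a1)%R]ltNge a10.
Qed.

Lemma measurable_zero_extend n (a : n.-tuple R) k :
  measurable_fun setT (fun y : k.-tuple R => zero_extend a y).
Proof.
apply/measurable_fun_tnthP => i; set c := count (fun r => 0 < r)%R (take i a).
rewrite (_ : _ \o _ = fun y : k.-tuple R => if (0 < tnth a i)%R then nth 0%R y c else 0%R); last first.
  by apply/funext => y /=; rewrite tnth_mktuple.
case: (0 < tnth a i)%R; last exact: measurable_cst.
have [ck|kc] := ltnP c k.
  rewrite (_ : (fun y => _) = fun y : k.-tuple R => tnth y (Ordinal ck)).
    exact: measurable_tnth.
  by apply/funext => y; rewrite (tnth_nth 0%R).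
rewrite (_ : (fun y => _) = cst 0%R); first exact: measurable_cst.
by apply/funext => y; rewrite nth_default ?size_tuple.
Qed.

Lemma tscale_zero_extend n (a : n.-tuple R) k c (y : k.-tuple R) :
  tscale c (zero_extend a y) = zero_extend a (tscale c y).
Proof.
apply: eq_from_tnth => i; rewrite tnth_tscale !tnth_mktuple.
case: ifP => _; last by rewrite mulr0.
set j := count _ _; have [jk|kj] := ltnP j k.
  by rewrite (nth_map 0%R)// size_tuple.
by rewrite !nth_default ?size_map ?size_tuple// mulr0.
Qed.

Lemma tsum_seq n (a : n.-tuple R) : tsum a = (\sum_(x <- a) x)%R.
Proof. by rewrite big_tuple. Qed.

Lemma tsum_zero_extend n (a : n.-tuple R) (y : seq R) :
  size y = size [seq r <- a | (0 < r)%R] -> tsum (zero_extend a y) = (\sum_(x <- y) x)%R.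
Proof.
elim: n a y => [|n IH] a y.
  by rewrite (tuple0 a) /= => /size0nil ->; rewrite /tsum big_ord0 big_nil.
elim/tuple_consP: a => a1 a; have [a10|a10] := ltP 0%R a1.
  rewrite /= a10/=; case: y => [//|x y] /= [sy].
  by rewrite zero_extend_pos// tsum_tcons big_cons IH.
by rewrite /= ltNge a10/= => sy; rewrite zero_extend_npos// tsum_tcons add0r IH.
Qed.

Lemma tsum_filter n (a : n.-tuple R) : (forall i, 0 <= tnth a i)%R ->
  (\sum_(x <- [seq r <- a | 0 < r]) x = tsum a)%R.
Proof.
move=> a0; rewrite tsum_seq big_filter big_mkcond; apply: eq_big_seq => x /tnthP[i xE].
by case: ifPn => // x0; apply/eqP; rewrite eq_le xE a0/= -xE leNgt.
Qed.

(** Coordinates with nonpositive parameter are Dirac at 0 and integrate out. The filtered sequence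
    enters as a tuple [l] with an equation, so that the induction may vary its length. *)
Lemma integral_gamma_tuple_zero_extend n (a : n.-tuple R) k (l : k.-tuple R)
    (h : n.-tuple R -> \bar R) : [seq r <- a | (0 < r)%R] = l ->
  (forall y, 0 <= h y) -> measurable_fun setT h ->
  \int[gamma_tuple a]_y h y = \int[gamma_tuple l]_y h (zero_extend a y).
Proof.
elim: n a k l h => [|n IH] a k l h al h0 mh.
  have mhz : measurable_fun setT (fun y : k.-tuple R => h (zero_extend a y)).
    exact: measurableT_comp mh (measurable_zero_extend a (k := k)).
  case: k l al mhz => [|k] l al mhz.
    by rewrite !integral_gamma_tuple0//; congr h; rewrite (tuple0 (zero_extend _ _)).
  by have := congr1 size al; rewrite (tuple0 a)/= size_tuple.
elim/tuple_consP: a al => a1 a.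
have mI : measurable_fun setT (fun x => \int[gamma_tuple a]_y h (tcons x y)).
  exact: measurable_gamma_tuple_tcons.
have I0 x : 0 <= \int[gamma_tuple a]_y h (tcons x y) by exact: integral_ge0.
have [a10|a10] := ltP 0%R a1; rewrite /= ?a10 ?[(0 < a1)%R]ltNge ?a10/= => al.
  case: k l al => [|k] l; first by rewrite (tuple0 l).
  elim/tuple_consP: l => l1 l /= [<- al].
  have mhz : measurable_fun setT (fun y : k.+1.-tuple R => h (zero_extend (tcons a1 a) y)).
    exact: measurableT_comp mh (measurable_zero_extend _ (k := k.+1)).
  rewrite (integral_gamma_tuple _ _ h0 mh).
  rewrite (integral_gamma_tuple _ _ (fun y => h0 _) mhz); apply: eq_integral => x _.
  rewrite (IH a k l (fun y => h (tcons x y)) al)//; last exact: measurable_tcons_cst.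
  by apply: eq_integral => y _; rewrite zero_extend_pos.
rewrite (integral_gamma_tuple _ _ h0 mh) ge0_integral_gamma_law0//.
rewrite (IH a k l (fun y => h (tcons 0%R y)) al)//; last exact: measurable_tcons_cst.
by apply: eq_integral => y _; rewrite zero_extend_npos.
Qed.

Section nonneg_parameters.
Variables (n : nat) (a : n.-tuple R).
Hypotheses (a0 : forall i, (0 <= tnth a i)%R) (sa0 : (0 < tsum a)%R).

Let l := in_tuple [seq r <- a | (0 < r)%R].

Let tsum_l : tsum l = tsum a.
Proof. by rewrite tsum_seq tsum_filter. Qed.

Let l_gt0 i : (0 < tnth l i)%R.
Proof. by have := mem_tnth i l; rewrite mem_filter => /andP[]. Qed.

Let l_size : (0 < size [seq r <- a | (0 < r)%R])%N.
Proof.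
rewrite lt0n; apply/eqP => l0; move: sa0; rewrite -tsum_l /tsum.
by rewrite big1 ?ltxx// => i; have := ltn_ord i; rewrite [X in (_ < X)%N]l0.
Qed.

Let tsum_z (y : (size [seq r <- a | (0 < r)%R]).-tuple R) : tsum (zero_extend a y) = tsum y.
Proof. by rewrite tsum_zero_extend ?size_tuple// tsum_seq. Qed.

Let tnrm_z (y : (size [seq r <- a | (0 < r)%R]).-tuple R) :
  tnrm (zero_extend a y) = zero_extend a (tnrm y).
Proof. by rewrite /tnrm tsum_z tscale_zero_extend. Qed.

(** Inserting zeros does not change the sum, so it commutes with normalisation, and the positive
    case transfers. *)
Lemma dirichletE A : measurable A -> dirichlet a A = gamma_tuple a (@tnrm R n @^-1` A).
Proof.
move=> mA; have mnA : measurable (@tnrm R n @^-1` A).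
  by rewrite -[X in measurable X]setTI; exact: measurable_tnrm.
have mzA : measurable [set y : (size [seq r <- a | (0 < r)%R]).-tuple R | A (zero_extend a y)].
  by rewrite -[X in measurable X]setTI; exact: measurable_zero_extend.
have mnz : measurable (@tnrm R _ @^-1` [set y : (size [seq r <- a | (0 < r)%R]).-tuple R | A (zero_extend a y)]).
  by rewrite -[X in measurable X]setTI; exact: measurable_tnrm.
rewrite /dirichlet dirichlet_posE// -!integral_prob_indic//.
rewrite (@integral_gamma_tuple_zero_extend _ a _ l)//; last first.
  by apply/measurable_EFinP; exact: measurable_indic.
apply: eq_integral => y _; rewrite !indicE.
have -> : (zero_extend a y \in @tnrm R n @^-1` A) = (tnrm (zero_extend a y) \in A) by [].
by rewrite tnrm_z.
Qed.

Lemma gamma_tuple_indep (H : R * n.-tuple R -> \bar R) :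
  (forall p, 0 <= H p) -> measurable_fun setT H ->
  \int[gamma_tuple a]_y H (tsum y, tnrm y) =
  \int[gamma_law (tsum a)]_g \int[gamma_tuple a]_y H (g, tnrm y).
Proof.
move=> H0 mH.
have mn1 : measurable_fun setT (fun y : n.-tuple R => H (tsum y, tnrm y)).
  apply: (measurableT_comp mH); apply: measurable_fun_pair; first exact: measurable_tsum.
  exact: measurable_tnrm.
have mn2 g : measurable_fun setT (fun y : n.-tuple R => H (g, tnrm y)).
  apply: (measurableT_comp mH); apply: measurable_fun_pair; first exact: measurable_cst.
  exact: measurable_tnrm.
rewrite (@integral_gamma_tuple_zero_extend _ a _ l)//.
under eq_integral do rewrite tsum_z tnrm_z.
have -> : \int[gamma_law (tsum a)]_g \int[gamma_tuple a]_y H (g, tnrm y) =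
    \int[gamma_law (tsum a)]_g \int[gamma_tuple l]_y H (g, zero_extend a (tnrm y)).
  apply: eq_integral => g _; rewrite (@integral_gamma_tuple_zero_extend _ a _ l)//.
  by apply: eq_integral => y _; rewrite tnrm_z.
pose k := size [seq r <- a | (0 < r)%R].
pose H' (p : R * k.-tuple R) := H (p.1, zero_extend a p.2).
have mH' : measurable_fun setT H'.
  apply: (measurableT_comp mH); apply: measurable_fun_pair; first exact: measurable_fst.
  exact: measurableT_comp (measurable_zero_extend a (k := k)) measurable_snd.
have H'0 p : 0 <= H' p by exact: H0.
rewrite -tsum_l -/(H' (_, _)).
have pos j (b : j.-tuple R) (K : R * j.-tuple R -> \bar R) : (0 < j)%N ->
    (forall i, (0 < tnth b i)%R) -> (forall p, 0 <= K p) -> measurable_fun setT K ->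
    \int[gamma_tuple b]_y K (tsum y, tnrm y) =
    \int[gamma_law (tsum b)]_g \int[gamma_tuple b]_y K (g, tnrm y).
  by case: j b K => // j b K _ b0 K0 mK; exact: gamma_tuple_indep_pos.
exact: (pos _ l H').
Qed.

End nonneg_parameters.

Lemma gamma_tuple_ge0_eq n (a : n.-tuple R) (f g : n.-tuple R -> \bar R) :
  (forall y, 0 <= f y) -> measurable_fun setT f ->
  (forall y, 0 <= g y) -> measurable_fun setT g ->
  (forall y, (forall i, (0 <= tnth y i)%R) -> f y = g y) ->
  \int[gamma_tuple a]_y f y = \int[gamma_tuple a]_y g y.
Proof.
elim: n a f g => [|n IH] a f g f0 mf g0 mg fg.
  by rewrite !integral_gamma_tuple0// fg// => -[].
elim/tuple_consP: a => a1 a.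
rewrite (integral_gamma_tuple _ _ f0 mf) (integral_gamma_tuple _ _ g0 mg).
apply: gamma_law_ge0_eq.
- by move=> x; exact: integral_ge0.
- exact: measurable_gamma_tuple_tcons.
- by move=> x; exact: integral_ge0.
- exact: measurable_gamma_tuple_tcons.
move=> x x0; apply: IH => //; [exact: measurable_tcons_cst|exact: measurable_tcons_cst|].
move=> y y0; apply: fg => i; case: (unliftP ord0 i) => [j ->|->]; first by rewrite tnthS.
by rewrite tnth0.
Qed.

End zero_parameters.

(** * Mecke equation for gamma vectors and invariance of the Dirichlet law *)

Section gamma_mecke.
Context (R : realType).
Local Open Scope ereal_scope.

(** The sum of the two variables is Gamma(1 + a), the size-biased Gamma(a). The case a = 0, where
    both sides vanish, serves blocks of zero mass. *)
Lemma gamma_law_mecke (a : R) (F : R -> \bar R) : (0 <= a)%R ->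
  (forall v, 0 <= F v) -> measurable_fun setT F ->
  a%:E * \int[gamma_law 1]_s \int[gamma_law a]_x F (x + s)%R =
  \int[gamma_law a]_x (`|x|%:E * F x).
Proof.
move=> a0 F0 mF.
move: a0; rewrite le_eqVlt => /predU1P[<-|a0].
  rewrite mul0e ge0_integral_gamma_law0// ?normr0 ?mul0e// => [x|]; first by rewrite mule_ge0// lee_fin.
  by apply: emeasurable_funM => //; apply/measurable_EFinP; exact: (@normr_measurable R setT).
apply: etrans _ (esym (gamma_law_size_bias a0 F0 mF)); apply: congr1.
have mf : measurable_fun setT (fun p : R * R => F (p.2 + p.1)%R).
  by apply: (measurableT_comp mF); apply: measurable_funD; [exact: measurable_snd|exact: measurable_fst].
apply: etrans (gamma_law_add a0 (fun p => F0 (p.2 + p.1)%R) mf) _.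
apply: eq_integral => g _; rewrite -[RHS](integral_prob_cst (beta_measure (@ltr01 R) a0)).
by apply: eq_integral => v _ /=; congr F; ring.
Qed.

Definition tadd n (j : 'I_n) (s : R) (y : n.-tuple R) : n.-tuple R :=
  [tuple tnth y i + s * (i == j)%:R | i < n]%R.

Lemma tadd_ord0 n s x (y : n.-tuple R) : tadd ord0 s (tcons x y) = tcons (x + s)%R y.
Proof.
apply: eq_from_tnth => i; rewrite tnth_mktuple.
case: (unliftP ord0 i) => [j ->|->]; last by rewrite !tnth0 eqxx mulr1.
by rewrite !tnthS mulr0 addr0.
Qed.

Lemma tadd_lift n (j : 'I_n) s x (y : n.-tuple R) :
  tadd (lift ord0 j) s (tcons x y) = tcons x (tadd j s y).
Proof.
apply: eq_from_tnth => i; rewrite tnth_mktuple.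
case: (unliftP ord0 i) => [k ->|->]; last by rewrite !tnth0 mulr0 addr0.
by rewrite !tnthS tnth_mktuple (inj_eq lift_inj).
Qed.

Lemma measurable_tadd d (S : measurableType d) n (j : 'I_n) (s : S -> R) (y : S -> n.-tuple R) :
  measurable_fun setT s -> measurable_fun setT y ->
  measurable_fun setT (fun w => tadd j (s w) (y w)).
Proof.
move=> ms my; apply/measurable_fun_tnthP => i.
rewrite (_ : _ \o _ = fun w => tnth (y w) i + s w * (i == j)%:R)%R; last first.
  by apply/funext => w /=; rewrite tnth_mktuple.
apply: measurable_funD; first exact: measurableT_comp (measurable_tnth i) my.
by apply: measurable_funM => //; exact: measurable_cst.
Qed.

Lemma gamma_tuple_mecke n (a : n.-tuple R) (j : 'I_n) (h : n.-tuple R -> \bar R) :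
  (forall i, (0 <= tnth a i)%R) -> (forall y, 0 <= h y) -> measurable_fun setT h ->
  (tnth a j)%:E * \int[gamma_law 1]_s \int[gamma_tuple a]_y h (tadd j s y) =
  \int[gamma_tuple a]_y (`|tnth y j|%:E * h y).
Proof.
have mtnth k (i : 'I_k) : measurable_fun setT (fun y : k.-tuple R => `|tnth y i|%:E : \bar R).
  apply/measurable_EFinP; apply: (measurableT_comp (@normr_measurable R setT)).
  exact: measurable_tnth.
have mtadd k (i : 'I_k) s (g : k.-tuple R -> \bar R) : measurable_fun setT g ->
    measurable_fun setT (fun y => g (tadd i s y)).
  move=> mg; apply: (measurableT_comp mg).
  by apply: measurable_tadd; [exact: measurable_cst|exact: measurable_id].
elim: n a j h => [|n IH] a j h; first by case: j.
elim/tuple_consP: a => a1 a a0 h0 mh.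
have a10 : (0 <= a1)%R by have := a0 ord0; rewrite tnth0.
have a'0 i : (0 <= tnth a i)%R by have := a0 (lift ord0 i); rewrite tnthS.
have jh0 y : 0 <= `|tnth y j|%:E * h y by rewrite mule_ge0// lee_fin.
have mjh : measurable_fun setT (fun y : n.+1.-tuple R => `|tnth y j|%:E * h y).
  by apply: emeasurable_funM; [exact: mtnth|exact: mh].
pose I1 (p : R * R) := \int[gamma_tuple a]_y h (tadd j p.1 (tcons p.2 y)).
have E : \int[gamma_law 1]_s \int[gamma_tuple (tcons a1 a)]_y h (tadd j s y) =
    \int[gamma_law 1]_s \int[gamma_law a1]_x I1 (s, x).
  apply: eq_integral => s _.
  exact: (integral_gamma_tuple a1 a (fun y => h0 (tadd j s y)) (mtadd _ j s _ mh)).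
apply: etrans (congr1 (mule _) E) (etrans _ (esym (integral_gamma_tuple a1 a jh0 mjh))).
clear E; rewrite {}/I1; case: (unliftP ord0 j) => [i jE|jE]; rewrite {}jE in jh0 mjh *.
  rewrite tnthS.
  pose I2 (p : R * R) := \int[gamma_tuple a]_y h (tcons p.1 (tadd i p.2 y)).
  have I20 p : 0 <= I2 p by exact: integral_ge0.
  have mI2 : measurable_fun setT I2.
    apply: (@measurable_tuple_section R _ _ _ a
        (fun q : (R * R) * n.-tuple R => h (tcons q.1.1 (tadd i q.1.2 q.2)))) => //.
    apply: (measurableT_comp mh); apply: measurable_tcons.
      exact: measurableT_comp measurable_fst measurable_fst.
    apply: measurable_tadd; last exact: measurable_snd.
    exact: measurableT_comp measurable_snd measurable_fst.
  have E : \int[gamma_law 1]_s \int[gamma_law a1]_x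
        \int[gamma_tuple a]_y h (tadd (lift ord0 i) s (tcons x y)) =
      \int[gamma_law a1]_x \int[gamma_law 1]_s I2 (x, s).
    apply: etrans _ (esym (@fubini_tonelli _ _ _ _ R (gamma_law a1) (gamma_law 1) I2 mI2 I20)).
    apply: eq_integral => s _; apply: eq_integral => x _; apply: eq_integral => y _.
    by rewrite tadd_lift.
  apply: etrans (congr1 (mule _) E) (etrans (ge0_mulr_integral _ (a'0 i) _ _) _).
  - by move=> x; apply: integral_ge0 => s _.
  - have := @measurable_fun_fubini_tonelli_F _ _ _ _ R (gamma_law 1) I2.
    by apply.
  apply: eq_integral => x _.
  apply: etrans (IH a i (fun y => h (tcons x y)) a'0 (fun y => h0 _) (measurable_tcons_cst x mh)) _.
  by apply: eq_integral => y _; rewrite tnthS.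
rewrite tnth0.
pose I3 x := \int[gamma_tuple a]_y h (tcons x y).
have I30 x : 0 <= I3 x by exact: integral_ge0.
have E : \int[gamma_law 1]_s \int[gamma_law a1]_x
      \int[gamma_tuple a]_y h (tadd ord0 s (tcons x y)) =
    \int[gamma_law 1]_s \int[gamma_law a1]_x I3 (x + s)%R.
  apply: eq_integral => s _; apply: eq_integral => x _; apply: eq_integral => y _.
  by rewrite tadd_ord0.
have E2 := @gamma_law_mecke a1 I3 a10 I30 (measurable_gamma_tuple_tcons a h0 mh).
apply: etrans (congr1 (mule a1%:E) E) _; apply: etrans E2 _.
apply: eq_integral => x _.
apply: etrans (ge0_mulr_integral _ (normr_ge0 x) (fun y => h0 (tcons x y)) (measurable_tcons_cst x mh)) _.
by apply: eq_integral => y _; rewrite tnth0.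
Qed.

End gamma_mecke.

Section dirichlet_invariance.
Context (R : realType).
Local Open Scope ereal_scope.

Lemma beta_gamma_ratio (a : R) (a0 : (0 < a)%R) (F : R -> \bar R) :
  (forall v, 0 <= F v) -> measurable_fun setT F ->
  \int[gamma_law 1]_s \int[gamma_law a]_g F (s / (g + s))%R =
  \int[beta_measure (@ltr01 R) a0]_v F v.
Proof.
move=> F0 mF; pose f (p : R * R) := F (p.1 / (p.2 + p.1))%R.
have f0 p : 0 <= f p by exact: F0.
have mf : measurable_fun setT f.
  apply: (measurableT_comp mF); apply: measurable_funM; first exact: measurable_fst.
  by apply: measurable_invr; apply: measurable_funD; [exact: measurable_snd|exact: measurable_fst].
apply: etrans (gamma_law_add a0 f0 mf) _.
rewrite -[RHS](integral_prob_cst (gamma_law (1 + a))).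
apply: gamma_law_gt0_eq.
- exact: addr_gt0.
- by move=> g; exact: integral_ge0.
- have := @measurable_fun_fubini_tonelli_F _ _ _ _ R (beta_measure (@ltr01 R) a0)
    (fun p : R * R => f (p.1 * p.2, p.1 * (1 - p.2)))%R.
  apply=> //; apply: (measurableT_comp mf); apply: measurable_fun_pair.
    by apply: measurable_funM; [exact: measurable_fst|exact: measurable_snd].
  apply: measurable_funM; first exact: measurable_fst.
  by apply: measurable_funB; [exact: measurable_cst|exact: measurable_snd].
- by move=> _; exact: integral_ge0.
- exact: measurable_cst.
move=> g g0; apply: eq_integral => v _; congr F.
rewrite /= (_ : g * (1 - v) + g * v = g)%R; last by ring.
by rewrite mulrAC mulfV ?mul1r// gt_eqF.
Qed.

Definition tunit n (j : 'I_n) : n.-tuple R := [tuple (i == j)%:R | i < n].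

Lemma tsum_tadd n (j : 'I_n) s (y : n.-tuple R) : tsum (tadd j s y) = (tsum y + s)%R.
Proof.
rewrite /tsum; under eq_bigr do rewrite tnth_mktuple.
rewrite big_split/=; congr (_ + _)%R; rewrite (bigD1 j)//= eqxx mulr1 big1 ?addr0//.
by move=> i /negbTE ->; rewrite mulr0.
Qed.

(** Adding mass s at j before normalising is a convex mixture with the unit vector, of weight s over
    the new total. If y is zero its normalisation is junk, but then the weight is 1 and hides it. *)
Lemma tnrm_tadd n (j : 'I_n) s (y : n.-tuple R) : (0 < s)%R ->
  (forall i, 0 <= tnth y i)%R ->
  tnrm (tadd j s y) = tmix (s / (tsum y + s)) (tunit j) (tnrm y).
Proof.
move=> s0 y0; apply: eq_from_tnth => i; rewrite /tnrm tsum_tadd !(tnth_tscale, tnth_mktuple).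
have sy0 : (0 <= tsum y)%R by apply: sumr_ge0.
have ys0 : (tsum y + s != 0)%R by rewrite gt_eqF// ltr_wpDl.
have [ty0|ty0] := eqVneq (tsum y) 0%R; last first.
  by move: (i == j)%:R => u; move: (tsum y) ty0 ys0 => t t0 ts0; field; rewrite t0 ts0.
have yi : tnth y i = 0%R.
  apply/eqP; rewrite eq_le y0 andbT -ty0 /tsum (bigD1 i)//= lerDl.
  by apply: sumr_ge0.
by rewrite yi ty0 !mulr0 addr0 !add0r mulrA [(s^-1 * s)%R]mulrC.
Qed.

Section invariance.
Variables (n : nat) (a : n.-tuple R).
Hypotheses (a0 : forall i, (0 <= tnth a i)%R) (sa0 : (0 < tsum a)%R).
Variable f : n.-tuple R -> \bar R.
Hypotheses (f0 : forall y, 0 <= f y) (mf : measurable_fun setT f).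

Let mfn : measurable_fun setT (fun y => f (tnrm y)).
Proof. exact: measurableT_comp mf (@measurable_tnrm R n). Qed.

Let mmix d (S : measurableType d) (v : S -> R) (j : 'I_n) (x : S -> n.-tuple R) :
  measurable_fun setT v -> measurable_fun setT x ->
  measurable_fun setT (fun w => f (tmix (v w) (tunit j) (x w))).
Proof.
move=> mv mx; apply: (measurableT_comp mf); exact: measurable_tmix.
Qed.

Let Fv j v := \int[gamma_tuple a]_y f (tmix v (tunit j) (tnrm y)).

Let mFv j : measurable_fun setT (Fv j).
Proof.
apply: (@measurable_tuple_section R _ _ _ a (fun p => f (tmix p.1 (tunit j) (tnrm p.2)))) => //.
apply: mmix; first exact: measurable_fst.
exact: measurableT_comp (@measurable_tnrm R n) measurable_snd.
Qed.

(** The mixture weight s/(S + s) involves the sum S of y, which is independent of the direction. S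
    may thus be replaced by a fresh Gamma([tsum a]) variable, and the weight becomes Beta(1,
    [tsum a]). *)
Let gamma_step j :
  \int[gamma_law 1]_s \int[gamma_tuple a]_y f (tnrm (tadd j s y)) =
  \int[beta_measure (@ltr01 R) sa0]_v Fv j v.
Proof.
have Fv0 v : 0 <= Fv j v by exact: integral_ge0.
rewrite -(beta_gamma_ratio sa0 Fv0 (mFv j)).
have mL : measurable_fun setT (fun s => \int[gamma_tuple a]_y f (tnrm (tadd j s y))).
  apply: (@measurable_tuple_section R _ _ _ a (fun p => f (tnrm (tadd j p.1 p.2)))) => //.
  by apply: (measurableT_comp mfn); apply: measurable_tadd; [exact: measurable_fst|exact: measurable_snd].
have mR : measurable_fun setT (fun s : R => \int[gamma_law (tsum a)]_g Fv j (s / (g + s))%R).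
  have := @measurable_fun_fubini_tonelli_F _ _ _ _ R (gamma_law (tsum a))
    (fun p : R * R => Fv j (p.1 / (p.2 + p.1))%R).
  apply=> //; apply: (measurableT_comp (mFv j)); apply: measurable_funM; first exact: measurable_fst.
  by apply: measurable_invr; apply: measurable_funD; [exact: measurable_snd|exact: measurable_fst].
have L0 s : 0 <= \int[gamma_tuple a]_y f (tnrm (tadd j s y)) by exact: integral_ge0.
have R0 s : 0 <= \int[gamma_law (tsum a)]_g Fv j (s / (g + s))%R by exact: integral_ge0.
apply: etrans (ge0_integral_gamma_law (@ltr01 R) L0 mL) _.
apply: etrans _ (esym (ge0_integral_gamma_law (@ltr01 R) R0 mR)).
congr (_ * _); apply: eq_integral => s _; rewrite /gdens; case: ifPn => s0; last by rewrite !mul0e.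
congr (_ * _).
pose H (p : R * n.-tuple R) := f (tmix (s / (p.1 + s)) (tunit j) p.2).
have H0 p : 0 <= H p by exact: f0.
have mH : measurable_fun setT H.
  apply: mmix; last exact: measurable_snd.
  apply: measurable_funM; first exact: measurable_cst.
  by apply: measurable_invr; apply: measurable_funD; [exact: measurable_fst|exact: measurable_cst].
apply: etrans _ (gamma_tuple_indep a0 sa0 H0 mH).
apply: gamma_tuple_ge0_eq => //.
- by apply: (measurableT_comp mfn); apply: measurable_tadd; [exact: measurable_cst|exact: measurable_id].
- apply: (measurableT_comp mH); apply: measurable_fun_pair; first exact: measurable_tsum.
  exact: measurable_tnrm.
by move=> y y0; rewrite tnrm_tadd.
Qed.

(** By the Mecke equation the j-th term is the mean of y_j f(direction). The sum over j is the mean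
    of S f(direction), and independence separates S, whose mean is [tsum a]. *)
Lemma dirichlet_invariance :
  \sum_(j < n) (tnth a j)%:E * \int[beta_measure (@ltr01 R) sa0]_v
     \int[gamma_tuple a]_y f (tmix v (tunit j) (tnrm y)) =
  (tsum a)%:E * \int[gamma_tuple a]_y f (tnrm y).
Proof.
have mabs j : measurable_fun setT (fun y : n.-tuple R => `|tnth y j|%:E : \bar R).
  apply/measurable_EFinP; apply: (measurableT_comp (@normr_measurable R setT)).
  exact: measurable_tnth.
transitivity (\sum_(j < n) \int[gamma_tuple a]_y (`|tnth y j|%:E * f (tnrm y))).
  apply: eq_bigr => j _; rewrite -[X in _ * X]/(\int[_]_v Fv j v) -gamma_step.
  exact: (@gamma_tuple_mecke R n a j (fun y => f (tnrm y))).
rewrite -ge0_integral_sum//; last 2 first.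
- by move=> j; apply: emeasurable_funM; [exact: mabs|exact: mfn].
- by move=> j y _; rewrite mule_ge0// lee_fin.
pose H (p : R * n.-tuple R) := `|p.1|%:E * f p.2.
have H0 p : 0 <= H p by rewrite mule_ge0// lee_fin.
have mH : measurable_fun setT H.
  apply: emeasurable_funM; last exact: measurableT_comp mf measurable_snd.
  by apply/measurable_EFinP; exact: (measurableT_comp (@normr_measurable R setT) measurable_fst).
transitivity (\int[gamma_tuple a]_y H (tsum y, tnrm y)).
  apply: gamma_tuple_ge0_eq.
  - by move=> y; apply: sume_ge0 => j _; rewrite mule_ge0// lee_fin.
  - by apply: emeasurable_sum => j; apply: emeasurable_funM; [exact: mabs|exact: mfn].
  - by move=> y; exact: H0.
  - apply: (measurableT_comp mH); apply: measurable_fun_pair; first exact: measurable_tsum.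
    exact: measurable_tnrm.
  move=> y y0; rewrite -ge0_sume_distrl; last by move=> j _; rewrite lee_fin.
  rewrite /H/= sumEFin ger0_norm; last by apply: sumr_ge0.
  by congr (_%:E * _); apply: eq_bigr => j _; rewrite ger0_norm.
apply: etrans (gamma_tuple_indep a0 sa0 H0 mH) _.
have I0 : 0 <= \int[gamma_tuple a]_y f (tnrm y) by exact: integral_ge0.
transitivity (\int[gamma_law (tsum a)]_g (`|g|%:E * \int[gamma_tuple a]_y f (tnrm y))).
  by apply: eq_integral => g _; rewrite (ge0_mulr_integral _ (normr_ge0 g) (fun y => f0 _) mfn).
have -> : \int[gamma_law (tsum a)]_g (`|g|%:E * \int[gamma_tuple a]_y f (tnrm y)) =
    (\int[gamma_law (tsum a)]_g `|g|%:E) * \int[gamma_tuple a]_y f (tnrm y).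
  apply: ge0_integralZr => //.
  by apply/measurable_EFinP; exact: (@normr_measurable R setT).
congr (_ * _).
have E1 := @gamma_law_mecke R (tsum a) (cst 1) (ltW sa0) (fun=> lee01) (measurable_cst _).
transitivity (\int[gamma_law (tsum a)]_g (`|g|%:E * cst 1 g)).
  by apply: eq_integral => g _; rewrite mule1.
apply: etrans (esym E1) _.
have E2 : \int[gamma_law 1]_s \int[gamma_law (tsum a)]_x cst 1 (x + s)%R = 1.
  apply: etrans (integral_prob_cst (gamma_law 1) 1).
  by apply: eq_integral => s _; exact: integral_prob_cst.
by apply: etrans (congr1 (mule _) E2) _; rewrite mule1.
Qed.

End invariance.

End dirichlet_invariance.

(** * The Dirichlet process *)

Section weighted_sum.
Context (R : realType) d (T : measurableType d).
Local Open Scope ereal_scope.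

(** The mass given to A by the weighted sum of Dirac measures, as a function of the two sequences;
    the absolute value keeps it nonnegative and measurable on all of [mseq R]. *)
Definition wsum (A : set T) (p : mseq R * mseq T) : \bar R :=
  \sum_(k <oo) (`|p.1 k|%:E * \d_(p.2 k) A).

Let wterm_ge0 A (p : mseq R * mseq T) k : 0 <= `|p.1 k|%:E * \d_(p.2 k) A :> \bar R.
Proof. by rewrite mule_ge0// lee_fin. Qed.

Lemma wsum_ge0 A p : 0 <= wsum A p.
Proof. by apply: nneseries_ge0 => k _ _. Qed.

Lemma wsum_le A p : wsum A p <= \sum_(k <oo) `|p.1 k|%:E.
Proof.
apply: lee_nneseries => [k _ _|k _]; first exact: wterm_ge0.
by rewrite -[leRHS]mule1 lee_wpmul2l ?lee_fin// diracE lee_fin lern1 leq_b1.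
Qed.

Lemma measurable_wsum A : measurable A -> measurable_fun setT (wsum A).
Proof.
move=> mA; apply: (ge0_emeasurable_sum (P := xpredT)) => [k p _ _|k _]; first exact: wterm_ge0.
apply: emeasurable_funM.
  apply/measurable_EFinP; apply: (measurableT_comp (@normr_measurable R setT)).
  exact: measurableT_comp (measurable_coord k) measurable_fst.
have mk : measurable_fun setT (fun x : mseq T => \d_(x k) A : \bar R).
  exact: measurable_dirac_coord.
exact: measurableT_comp mk measurable_snd.
Qed.

(* With [i = kappa] this is the distributional fixed-point equation of the
   Dirichlet process. *)
Lemma wsum_reduce A (z : mseq R) (x : mseq T) i : (forall k, 0 <= z k)%R -> (z i < 1)%R ->
  wsum A (z, x) = (z i * \1_A (x i))%:E + (1 - z i)%:E * wsum A (sdrop_at i z, drop_at i x).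
Proof.
move=> z0 zi1; have zi0 : (0 < 1 - z i)%R by rewrite subr_gt0.
rewrite /wsum (nneseries_bump i (wterm_ge0 A (z, x)))/=; congr (_ + _).
  by rewrite ger0_norm// diracE EFinM indicE.
have E := @nneseriesZl R _ xpredT (1 - z i) 0
  (fun k _ => wterm_ge0 A (sdrop_at i z, drop_at i x) k).
apply: etrans _ E; apply: eq_eseriesr => k _ /=.
rewrite /sdrop_at !drop_atE muleA normrM normfV (gtr0_norm zi0) -[in RHS]EFinM.
by rewrite mulrA mulfV ?mul1r// gt_eqF.
Qed.

Lemma fine_wsum_reduce A (z : mseq R) (x : mseq T) i : (forall k, 0 <= z k)%R -> (z i < 1)%R ->
  \sum_(k <oo) (z k)%:E < +oo ->
  fine (wsum A (z, x)) =
  (z i * \1_A (x i) + (1 - z i) * fine (wsum A (sdrop_at i z, drop_at i x)))%R.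
Proof.
move=> z0 zi1 sumz.
have : wsum A (z, x) < +oo.
  apply: le_lt_trans (wsum_le _ _) _; apply: le_lt_trans sumz; apply: lee_nneseries => // k _ /=.
  by rewrite ger0_norm.
rewrite (wsum_reduce A x z0 zi1); move: (wsum_ge0 A (sdrop_at i z, drop_at i x)).
case: (wsum A _) => [r||]//= _.
by rewrite gt0_muley// lte_fin subr_gt0.
Qed.

End weighted_sum.

Section dirichlet_process.
Context (R : realType) (dO dX : measure_display) (Omega : measurableType dO)
  (T : measurableType dX) (P : probability Omega R)
  (Z : {mfun Omega >-> mseq R}) (X : {mfun Omega >-> mseq T})
  (kappa : {mfun Omega >-> nat}).
Hypothesis Z01 : forall w n, 0 < Z w n < 1.
Hypothesis sumZ : {ae P, forall w, (\sum_(n <oo) (Z w n)%:E = 1)%E}.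
Hypothesis kappaZ : forall i : nat,
  is_cond_prob P (g_sigma_algebra_preimage (joint_seq Z X))
    (kappa @^-1` [set i]) (fun w => Z w i).
Hypothesis eq_law : forall A, measurable A ->
  distribution P (reduced_seq Z X kappa) A = distribution P (joint_seq Z X) A.
Hypothesis indep : independent3 P (reduced_seq Z X kappa)
  (at_index kappa Z) (at_index kappa X).

Local Notation J := (joint_seq Z X).
Local Notation V := (at_index kappa Z).
Local Notation XK := (at_index kappa X).
Local Notation red := (reduced_seq Z X kappa).
Local Open Scope ereal_scope.

Let EV : R := fine 'E_P[V]%E.
Let alpha : R := ((1 - EV) / EV)%R.
Let alpha0 : (0 < alpha)%R. Proof. exact: (size_bias_alpha_gt0 P kappa Z01). Qed.
Let nu : probability T R := distribution P XK.
Let lawV : probability R R := distribution P V.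
Let beta := beta_measure (@ltr01 R) alpha0.

Let Z_ge0 w n : (0 <= Z w n)%R. Proof. by case/andP: (Z01 w n) => /ltW. Qed.
Let V_gt0 w : (0 < V w)%R. Proof. by case/andP: (Z01 w (kappa w)). Qed.
Let V_lt1 w : (V w < 1)%R. Proof. by case/andP: (Z01 w (kappa w)). Qed.
Let mJ : measurable_fun setT J. Proof. exact: measurable_joint_seq. Qed.
Let mred : measurable_fun setT red. Proof. exact: measurable_reduced_seq. Qed.
Let mV : measurable_fun setT V. Proof. exact: measurable_at_index. Qed.
Let mXK : measurable_fun setT XK. Proof. exact: measurable_at_index. Qed.
Let mVX : measurable_fun setT (fun w => (V w, XK w)).
Proof. exact: measurable_fun_pair. Qed.

Lemma measurable_sumZ : measurable [set w | \sum_(n <oo) (Z w n)%:E = 1].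
Proof.
rewrite -[X in measurable X]setTI.
have mf : measurable_fun setT (fun w => \sum_(n <oo) (Z w n)%:E).
  apply: (ge0_emeasurable_sum (P := xpredT)) => [n w _ _|n _].
    by rewrite lee_fin.
  by apply/measurable_EFinP; exact: measurableT_comp (measurable_coord n) (measurable_funPT Z).
exact: (mf measurableT [set 1] (emeasurable_set1 1)).
Qed.

Lemma sumZ_full : P [set w | \sum_(n <oo) (Z w n)%:E = 1] = 1.
Proof.
have mS := measurable_sumZ.
apply/eqP; rewrite -(setCK [set w | _]) probability_setC; last exact: measurableC.
rewrite (_ : P _ = 0) ?sube0//.
have [N [mN PN NS]] := sumZ.
apply/eqP; rewrite eq_le measure_ge0 andbT -[leRHS]PN; apply: le_measure; rewrite ?inE//.
exact: measurableC.
Qed.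

(** Independence of the triple is known on rectangles only. Given the event on the reduced pair, the
    conditional law of (V, X_kappa) agrees with the product on rectangles, hence everywhere; an
    event of probability 0 is treated apart. *)
Let indep_VX A B : measurable A -> measurable B ->
  P (red @^-1` A `&` (fun w => (V w, XK w)) @^-1` B) = P (red @^-1` A) * (lawV \x nu) B.
Proof.
move=> mA mB.
have mrA : measurable (red @^-1` A) by rewrite -[X in measurable X]setTI; exact: mred.
have mpV C : measurable C -> measurable (V @^-1` C).
  by move=> mC; rewrite -[X in measurable X]setTI; exact: mV.
have mpX C : measurable C -> measurable (XK @^-1` C).
  by move=> mC; rewrite -[X in measurable X]setTI; exact: mXK.
have mpVX C : measurable C -> measurable ((fun w => (V w, XK w)) @^-1` C).
  by move=> mC; rewrite -[X in measurable X]setTI; exact: mVX.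
pose c := fine (P (red @^-1` A)).
have cE : P (red @^-1` A) = c%:E by rewrite /c fineK// fin_num_measure.
have c0 : (0 <= c)%R by rewrite fine_ge0.
have [c00|cn0] := eqVneq c 0%R.
  rewrite cE c00 mul0e; apply/eqP; rewrite eq_le measure_ge0 andbT.
  have cE0 : P (red @^-1` A) = 0 by rewrite cE c00.
  rewrite -[leRHS]cE0; apply: le_measure; rewrite ?inE//.
  by apply: measurableI => //; exact: mpVX.
have ci0 : (0 <= c^-1)%R by rewrite invr_ge0.
pose m' := mscale (NngNum ci0) (image_measure (mrestr P mrA) mVX).
have m'E C : m' C = (c^-1)%:E * P (red @^-1` A `&` (fun w => (V w, XK w)) @^-1` C).
  by rewrite /m' /mscale/= /pushforward /mrestr setIC.
have -> : (lawV \x nu) B = m' B.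
  apply: product_measure_unique => // C D mC mD; apply: etrans (m'E _) _.
  rewrite (_ : _ `&` _ = red @^-1` A `&` V @^-1` C `&` XK @^-1` D); last first.
    by rewrite -setIA.
  by rewrite (indep mA mC mD) cE !muleA -EFinM mulVf// mul1e.
by rewrite m'E cE muleA -EFinM mulfV// mul1e.
Qed.

Section partition.
Variables (n : nat) (B : 'I_n -> set T).
Hypotheses (mB : forall i, measurable (B i)) (tB : trivIset setT B) (BT : \bigcup_i B i = setT).

Let Ub (t : T) : n.-tuple R := [tuple \1_(B i) t | i < n].

Let mUb : measurable_fun setT Ub.
Proof.
apply/measurable_fun_tnthP => i.
rewrite (_ : _ \o _ = \1_(B i)); first exact: measurable_indic.
by apply/funext => t /=; rewrite tnth_mktuple.
Qed.

Let U w := Ub (XK w).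

Let mU : measurable_fun setT U. Proof. exact: measurableT_comp mUb mXK. Qed.

Let Ub_in j t : B j t -> Ub t = tunit R j.
Proof.
move=> Bj; apply: eq_from_tnth => i; rewrite !tnth_mktuple indicE; congr (_%:R).
have [->|ij] := eqVneq i j; first by rewrite mem_set.
rewrite memNset// => Bi; move/trivIsetP: tB => /(_ i j Logic.I Logic.I ij).
by move=> E; have : (B i `&` B j) t by []; rewrite E.
Qed.

Let fineB i := fine (nu (B i)).

Let fineBE i : nu (B i) = (fineB i)%:E.
Proof. by rewrite /fineB fineK// fin_num_measure. Qed.

Let fineB_ge0 i : (0 <= fineB i)%R. Proof. exact: fine_ge0. Qed.

Lemma integral_partition (g : n.-tuple R -> \bar R) : (forall x, 0 <= g x) ->
  \int[nu]_t g (Ub t) = \sum_(j < n) (fineB j)%:E * g (tunit R j).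
Proof.
move=> g0; transitivity (\int[nu]_t \sum_(j < n) ((\1_(B j) t)%:E * g (tunit R j))).
  apply: eq_integral => t _; have : setT t by [].
  rewrite -BT => -[j _ Bj]; rewrite (Ub_in Bj) (bigD1 j)//= indicE mem_set// mul1e.
  rewrite big1 ?adde0// => i ij; rewrite indicE memNset ?mul0e// => Bi.
  move/trivIsetP: tB => /(_ i j Logic.I Logic.I ij) E.
  by have : (B i `&` B j) t by []; rewrite E.
have mi j : measurable_fun setT (fun t => (\1_(B j) t)%:E : \bar R).
  by apply/measurable_EFinP; exact: measurable_indic.
rewrite ge0_integral_sum//; last 2 first.
- by move=> j; apply: emeasurable_funM; [exact: mi|exact: measurable_cst].
- by move=> j t _; rewrite mule_ge0// lee_fin.
apply: eq_bigr => j _; rewrite ge0_integralZr//.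
by rewrite -fineBE integral_indic// setIT.
Qed.

Let sumB : (\sum_i fineB i = 1)%R.
Proof.
apply: EFin_inj; rewrite -sumEFin.
transitivity (\int[nu]_t cst 1 (Ub t)); last exact: integral_prob_cst.
by rewrite (integral_partition (g := cst 1))//; apply: eq_bigr => j _; rewrite mule1.
Qed.

Let a : n.-tuple R := [tuple (alpha * fineB i)%R | i < n].

Let tsum_a : tsum a = alpha.
Proof.
by rewrite /tsum; under eq_bigr do rewrite tnth_mktuple; rewrite -mulr_sumr sumB mulr1.
Qed.

Let a0 i : (0 <= tnth a i)%R.
Proof. by rewrite tnth_mktuple mulr_ge0// ltW. Qed.

Let q (p : mseq R * mseq T) : n.-tuple R := [tuple fine (wsum (B i) p) | i < n].

Let mq : measurable_fun setT q.
Proof.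
apply/measurable_fun_tnthP => i.
rewrite (_ : _ \o _ = fun p => fine (wsum (B i) p)); last first.
  by apply/funext => p /=; rewrite tnth_mktuple.
apply: measurableT_comp; last exact: measurable_wsum.
exact: fine_measurable.
Qed.

Section test_function.
Variable f : n.-tuple R -> \bar R.
Hypotheses (f0 : forall x, 0 <= f x) (mf : measurable_fun setT f).

(** The point where the Beta law of V enters the Dirichlet part: the operator built from P becomes
    the one for which [dirichlet_invariance] is stated. *)
Lemma mixop_partition x : mixop P V U f x =
  \sum_(j < n) (fineB j)%:E * \int[beta]_v f (tmix v (tunit R j) x).
Proof.
pose K (p : R * T) := f (tmix p.1 (Ub p.2) x).
have K0 p : 0 <= K p by exact: f0.
have mK : measurable_fun setT K.
  apply: (measurableT_comp mf); apply: measurable_tmix; first exact: measurable_fst.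
    exact: measurableT_comp mUb measurable_snd.
  exact: measurable_cst.
have iVX C D : measurable C -> measurable D -> P (V @^-1` C `&` XK @^-1` D) = lawV C * nu D.
  move=> mC mD; have := indep measurableT mC mD.
  by rewrite preimage_setT probability_setT mul1e setTI.
apply: etrans (integral_indep mV mXK iVX K0 mK) _.
have mfj j : measurable_fun setT (fun v => f (tmix v (tunit R j) x)).
  apply: (measurableT_comp mf); apply: measurable_tmix; first exact: measurable_id.
    exact: measurable_cst.
  exact: measurable_cst.
transitivity (\int[lawV]_v \sum_(j < n) ((fineB j)%:E * f (tmix v (tunit R j) x))).
  by apply: eq_integral => v _; exact: (integral_partition (g := fun u => f (tmix v u x))).
rewrite ge0_integral_sum//; last 2 first.
- by move=> j; apply: emeasurable_funM; [exact: measurable_cst|exact: mfj].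
- by move=> j v _; rewrite mule_ge0// lee_fin.
apply: eq_bigr => j _.
rewrite -(ge0_mulr_integral lawV (fineB_ge0 j) (fun v => f0 _) (mfj j)); congr (_ * _).
apply: eq_measure_integral => A mA _.
exact: (size_bias_beta Z01 sumZ kappaZ eq_law indep).
Qed.

Lemma dirichlet_mixop : \int[gamma_tuple a]_y f (tnrm y) =
  \int[gamma_tuple a]_y mixop P V U f (tnrm y).
Proof.
have sa0 : (0 < tsum a)%R by rewrite tsum_a.
have inv := dirichlet_invariance a0 sa0 f0 mf.
pose K j (p : R * n.-tuple R) := f (tmix p.1 (tunit R j) (tnrm p.2)).
have K0 j p : 0 <= K j p by exact: f0.
have mK j : measurable_fun setT (K j).
  apply: (measurableT_comp mf); apply: measurable_tmix; first exact: measurable_fst.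
    exact: measurable_cst.
  exact: measurableT_comp (@measurable_tnrm R n) measurable_snd.
apply: (mule_EFin_inj alpha0); rewrite -{1}tsum_a; apply: etrans (esym inv) _.
have E : \int[gamma_tuple a]_y mixop P V U f (tnrm y) =
    \sum_(j < n) (fineB j)%:E * \int[beta]_v \int[gamma_tuple a]_y K j (v, y).
  transitivity (\int[gamma_tuple a]_y \sum_(j < n) ((fineB j)%:E * \int[beta]_v K j (v, y))).
    by apply: eq_integral => y _; exact: mixop_partition.
  have mI j : measurable_fun setT (fun y => \int[beta]_v K j (v, y)).
    have := @measurable_fun_fubini_tonelli_G _ _ _ _ R beta (K j).
    by apply.
  have I0 j y : 0 <= \int[beta]_v K j (v, y) by exact: integral_ge0.
  rewrite ge0_integral_sum//; last 2 first.
  - by move=> j; apply: emeasurable_funM; [exact: measurable_cst|exact: mI].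
  - by move=> j y _; rewrite mule_ge0// lee_fin.
  apply: eq_bigr => j _.
  rewrite -(ge0_mulr_integral (gamma_tuple a) (fineB_ge0 j) (I0 j) (mI j)); congr (_ * _).
  exact: (esym (@fubini_tonelli _ _ _ _ R beta (gamma_tuple a) (K j) (mK j) (K0 j))).
apply: etrans _ (esym (congr1 (mule alpha%:E) E)).
rewrite ge0_sume_distrr; last first.
  move=> j _; apply: mule_ge0; first by rewrite lee_fin.
  by apply: integral_ge0 => v _; apply: integral_ge0.
apply: eq_bigr => j _; apply: etrans _ (esym (muleA _ _ _)); apply: congr2.
  by rewrite tnth_mktuple.
(* The two beta measures have equal parameters [tsum a] and [alpha] but different positivity proofs;
   [beta_law], which takes no proof, mediates. *)
apply: eq_measure_integral => A mA _.
apply: etrans (beta_measureE (@ltr01 R) sa0 mA) _.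
by rewrite tsum_a; exact: (esym (beta_measureE (@ltr01 R) alpha0 mA)).
Qed.

Lemma process_mixop : \int[P]_w f (q (J w)) = \int[P]_w mixop P V U f (q (J w)).
Proof.
pose lawVX := law P mVX.
have iVX C D : measurable C -> measurable D ->
    P (red @^-1` C `&` (fun w => (V w, XK w)) @^-1` D) = law P mred C * lawVX D.
  move=> mC mD; apply: etrans (indep_VX mC mD) _; congr (_ * _).
  have := indep_VX measurableT mD.
  by rewrite preimage_setT setTI probability_setT mul1e => <-.
pose K (p : (mseq R * mseq T) * (R * T)) := f (tmix p.2.1 (Ub p.2.2) (q p.1)).
have K0 p : 0 <= K p by exact: f0.
have mK : measurable_fun setT K.
  apply: (measurableT_comp mf); apply: measurable_tmix.
  - exact: measurableT_comp measurable_fst measurable_snd.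
  - by apply: (measurableT_comp mUb); exact: measurableT_comp measurable_snd measurable_snd.
  - exact: measurableT_comp mq measurable_fst.
have mS : measurable [set w | \sum_(n <oo) (Z w n)%:E = 1].
  exact: measurable_sumZ.
transitivity (\int[P]_w K (red w, (V w, XK w))).
  apply: (ge0_eq_integral_full mS sumZ_full) => //.
  - by apply: (measurableT_comp mf); exact: measurableT_comp mq mJ.
  - by apply: (measurableT_comp mK); exact: measurable_fun_pair.
  move=> w /= sw; rewrite /K/=; congr f; apply: eq_from_tnth => i; rewrite !tnth_mktuple.
  (* Since [fine] sends infinity to 0, the affine relation between masses survives it only when they
     are finite. *)
  have sfin : \sum_(n <oo) (Z w n)%:E < +oo by rewrite sw ltry.
  exact: (fine_wsum_reduce (B i) (X w) (Z_ge0 w) (V_lt1 w) sfin).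
apply: etrans (integral_indep mred mVX iVX K0 mK) _.
have mM : measurable_fun setT (fun r => mixop P V U f (q r)).
  by apply: (measurableT_comp _ mq); exact: measurable_mixop.
have M0 r : 0 <= mixop P V U f (q r) by exact: mixop_ge0.
transitivity (\int[law P mred]_r mixop P V U f (q r)).
  apply: eq_integral => r _.
  have mKr : measurable_fun setT (fun y => K (r, y)).
    exact: (measurableT_comp mK (measurable_pair1 r)).
  exact: (ge0_integral_law _ mVX (fun y => K0 (r, y)) mKr).
apply: etrans _ (ge0_integral_law _ mJ M0 mM).
by apply: eq_measure_integral => A mA _; exact: eq_law.
Qed.

End test_function.

(** The bounded carrier required by [contraction_eq]; its l1 diameter is at most n. *)
Let unit_cube : set (n.-tuple R) := [set x | forall i, (0 <= tnth x i <= 1)%R].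

Let measurable_unit_cube : measurable unit_cube.
Proof.
have -> : unit_cube = \bigcap_(i in [set: 'I_n]) ((@tnth n R ^~ i) @^-1` `[0%R, 1%R]%classic).
  apply/seteqP; split => [x xs i _|x xs i]; first by rewrite /= in_itv/=; exact: xs.
  by have := xs i Logic.I; rewrite /= in_itv.
apply: fin_bigcap_measurable => // i _.
rewrite -[X in measurable X]setTI.
exact: (@measurable_tnth _ _ n i measurableT _ (measurable_itv _)).
Qed.

Let process_cube : P [set w | unit_cube (q (J w))] = 1.
Proof.
have mqJ : measurable_fun setT (fun w => q (J w)) by exact: measurableT_comp mq mJ.
apply/eqP; rewrite eq_le probability_le1/=; last first.
  by rewrite -[X in measurable X]setTI; exact: mqJ.
rewrite -sumZ_full; apply: le_measure; rewrite ?inE.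
- exact: measurable_sumZ.
- by rewrite -[X in measurable X]setTI; exact: mqJ.
move=> w /= sw i; rewrite tnth_mktuple.
have w1 : wsum (B i) (J w) <= 1.
  apply: le_trans (wsum_le _ _) _; rewrite -sw; apply: lee_nneseries => // k _ /=.
  by rewrite ger0_norm.
move: (wsum_ge0 (B i) (J w)) w1; case: (wsum _ _) => [r||]//=.
by rewrite !lee_fin => -> ->.
Qed.

(** A zero gamma vector normalises to 0, which lies in the cube though not in the simplex; with the
    cube no null set has to be discussed. *)
Let gamma_cube : gamma_tuple a (@tnrm R n @^-1` unit_cube) = 1.
Proof.
have mC : measurable (@tnrm R n @^-1` unit_cube).
  by rewrite -[X in measurable X]setTI; exact: measurable_tnrm.
rewrite -integral_prob_indic// -[RHS](integral_prob_cst (gamma_tuple a)).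
apply: gamma_tuple_ge0_eq => //; first by apply/measurable_EFinP; exact: measurable_indic.
move=> y y0; rewrite indicE mem_set// => i; rewrite tnth_tscale.
have s0 : (0 <= tsum y)%R by apply: sumr_ge0.
have [sy|sy] := eqVneq (tsum y) 0%R; first by rewrite sy invr0 mul0r lexx ler01.
have sy0 : (0 < tsum y)%R by rewrite lt_neqAle eq_sym sy.
rewrite mulr_ge0 ?invr_ge0//= mulrC ler_pdivrMr// mul1r /tsum (bigD1 i)//= lerDl.
by apply: sumr_ge0.
Qed.

Lemma process_law A : measurable A -> P [set w | A (q (J w))] = dirichlet a A.
Proof.
move=> mA; have sa0 : (0 < tsum a)%R by rewrite tsum_a.
rewrite (dirichletE a0 sa0 mA).
have mqJ : measurable_fun setT (fun w => q (J w)) by exact: measurableT_comp mq mJ.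
have V01 w : (0 <= V w <= 1)%R by rewrite !ltW.
have EV0 := EV_gt0 P kappa Z01; have EV1 := EV_lt1 P kappa Z01.
have r0 : (0 <= 1 - EV)%R by rewrite subr_ge0 ltW.
have r1 : (1 - EV < 1)%R by rewrite gtrDl oppr_lt0.
have Er : \int[P]_w (1 - V w)%:E <= (1 - EV)%:E.
  by rewrite (integral_oneV P kappa Z01).
apply: (@contraction_eq R n _ _ P V U mV mU V01 (1 - EV)%R r0 r1 Er (law P mqJ)
  (law (gamma_tuple a) (@measurable_tnrm R n)) unit_cube n%:R) => //.
- move=> f f0 mf; have mM : measurable_fun setT (mixop P V U f) by exact: measurable_mixop.
  have M0 x : 0 <= mixop P V U f x by exact: mixop_ge0.
  apply: etrans (ge0_integral_law _ mqJ f0 mf) _.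
  apply: etrans _ (esym (ge0_integral_law _ mqJ M0 mM)).
  exact: process_mixop.
- move=> f f0 mf; have mM : measurable_fun setT (mixop P V U f) by exact: measurable_mixop.
  have M0 x : 0 <= mixop P V U f x by exact: mixop_ge0.
  apply: etrans (ge0_integral_law _ (@measurable_tnrm R n) f0 mf) _.
  apply: etrans _ (esym (ge0_integral_law _ (@measurable_tnrm R n) M0 mM)).
  exact: dirichlet_mixop.
move=> x y xS yS; apply: le_trans (_ : \sum_(i < n) 1 <= _)%R.
  apply: ler_sum => i _; have /andP[x0 x1] := xS i; have /andP[y0 y1] := yS i.
  by rewrite ler_norml; apply/andP; split; lra.
by rewrite sumr_const card_ord.
Qed.

End partition.
End dirichlet_process.

(** * The Poisson-Dirichlet law *)

Section poisson_dirichlet.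
Context (R : realType) d (Omega : measurableType d) (P : probability Omega R).
Variable Z : {mfun Omega >-> mseq R}.
Hypothesis Z01 : forall w n, 0 < Z w n < 1.
Local Open Scope ereal_scope.
Hypothesis sumZ : P [set w | \sum_(n <oo) (Z w n)%:E = 1] = 1.
Hypothesis measurable_sumZ : measurable [set w | \sum_(n <oo) (Z w n)%:E = 1].
Variables (a : R) (a0 : (0 < a)%R).
Hypothesis size_bias : forall K : R * mseq R -> \bar R,
  (forall p, 0 <= K p) -> measurable_fun setT K ->
  \int[P]_w (\sum_(i <oo) ((Z w i)%:E * K (Z w i, sdrop_at i (Z w)))) =
  \int[beta_measure (@ltr01 R) a0]_v \int[P]_w K (v, Z w).

Let mZ : measurable_fun setT Z. Proof. exact: measurable_funPT. Qed.

Let t : {mfun (Omega * R)%type >-> mseq R} :=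
  HB.pack (scaled_seq Z) (isMeasurableFun.Build _ _ _ _ _ (measurable_scaled_seq mZ)).

Let S p : R := fine (\sum_(n <oo) (t p n)%:E).

Let sumt p : \sum_(n <oo) (Z p.1 n)%:E = 1 -> forall n, (t p n / S p = Z p.1 n)%R.
Proof.
move=> s1 n; have -> : S p = gpos p.2.
  rewrite /S (_ : \sum_(n <oo) _ = (gpos p.2)%:E)//.
  rewrite -[RHS]mule1 -s1 -nneseriesZl; last first.
    by move=> i _; rewrite lee_fin; case/andP: (Z01 p.1 i) => /ltW.
  by apply: eq_eseriesr => i _; rewrite -EFinM mulrC.
by rewrite /= /scaled_seq /smul mulfK// gt_eqF// gpos_gt0.
Qed.

Lemma size_bias_poisson_dirichlet :
  is_poisson_dirichlet P a (fun w => sum_diracs (Z w)).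
Proof.
split => //; first by exact: measurableT_comp (@measurable_sum_diracs _ _ R) mZ.
exists _, (Omega * R)%type, (gamma_ext P a), t; split.
- move=> p n; rewrite /= /scaled_seq /smul mulr_gt0 ?gpos_gt0//.
  by case/andP: (Z01 p.1 n).
- have H := gamma_scaling_poisson mZ Z01 (a0 := a0) size_bias; exact: H.
move=> A mA.
have mE : measurable [set w | A (sum_diracs (Z w))].
  rewrite -[X in measurable X]setTI.
  exact: (measurableT_comp (@measurable_sum_diracs _ _ R) mZ).
have gfst E : measurable E -> gamma_ext P a (fst @^-1` E) = P E.
  move=> mE'; rewrite (_ : fst @^-1` E = E `*` setT); last first.
    by apply/seteqP; split => -[x y] //= [].
  apply: etrans (product_measure1E P (gamma_law a) mE' measurableT) _.
  by rewrite [X in _ * X]probability_setT mule1.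
apply: etrans (esym (gfst _ mE)) _.
have mtS : measurable_fun setT (fun p => (fun n => t p n / S p)%R : mseq R).
  apply: measurable_mseqP => n; apply: measurable_funM.
    exact: measurableT_comp (measurable_coord n) (measurable_funPT t).
  apply: measurable_invr; apply: measurableT_comp; first exact: fine_measurable.
  apply: (ge0_emeasurable_sum (P := xpredT)) => [k p _ _|k _].
    by rewrite lee_fin /= /scaled_seq /smul mulr_ge0// ?ltW ?gpos_gt0//; case/andP: (Z01 p.1 k).
  by apply/measurable_EFinP; exact: measurableT_comp (measurable_coord k) (measurable_funPT t).
have mB : measurable [set p | A (sum_diracs (fun n => t p n / S p)%R)].
  rewrite -[X in measurable X]setTI.
  exact: (measurableT_comp (@measurable_sum_diracs _ _ R) mtS).
have mC : measurable (fst @^-1` [set w | A (sum_diracs (Z w))] : set (Omega * R)).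
  by rewrite -[X in measurable X]setTI; exact: measurable_fst.
have mfull : measurable (fst @^-1` [set w | \sum_(n <oo) (Z w n)%:E = 1] : set (Omega * R)).
  by rewrite -[X in measurable X]setTI; exact: measurable_fst.
have full : gamma_ext P a (fst @^-1` [set w | \sum_(n <oo) (Z w n)%:E = 1]) = 1.
  by rewrite gfst.
apply: etrans (esym (integral_prob_indic (gamma_ext P a) mC)) _.
apply: etrans _ (integral_prob_indic (gamma_ext P a) mB).
apply: (ge0_eq_integral_full mfull full).
- by move=> p; rewrite lee_fin.
- by apply/measurable_EFinP; exact: measurable_indic.
- by move=> p; rewrite lee_fin.
- by apply/measurable_EFinP; exact: measurable_indic.
move=> p /= sp; rewrite !indicE; congr (_%:R%:E).
rewrite /in_mem/=; congr (asbool (A (sum_diracs _))).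
by apply/funext => n; rewrite sumt.
Qed.

End poisson_dirichlet.

Section weighted_diracs.
Context (R : realType) (dO dX : measure_display) (Omega : measurableType dO)
  (T : measurableType dX).
Variables (Z : {mfun Omega >-> mseq R}) (X : {mfun Omega >-> mseq T}).
Hypothesis Z01 : forall w n, 0 < Z w n < 1.
Local Open Scope ereal_scope.

Lemma weighted_diracs_wsum w A :
  weighted_diracs (fun n => NngNum (itv01_ge0 (Z01 w n))) (X w) A = wsum A (joint_seq Z X w).
Proof.
rewrite /weighted_diracs /mseries /wsum; apply: eq_eseriesr => k _.
by rewrite /mscale/= ger0_norm// itv01_ge0.
Qed.

End weighted_diracs.

Theorem theorem6p2 (R : realType)
  (dO dX : measure_display) (Omega : measurableType dO)
  (T : measurableType dX) (P : probability Omega R)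
  (Z : {mfun Omega >-> mseq R}) (X : {mfun Omega >-> mseq T})
  (kappa : {mfun Omega >-> nat})
  (Z01 : forall w n, 0 < Z w n < 1)
  (sumZ : {ae P, forall w, (\sum_(n <oo) (Z w n)%:E = 1)%E})
  (kappaZ : forall i : nat,
     is_cond_prob P (g_sigma_algebra_preimage (joint_seq Z X))
       (kappa @^-1` [set i]) (fun w => Z w i))
  (eq_law : forall A, measurable A ->
     distribution P (reduced_seq Z X kappa) A = distribution P (joint_seq Z X) A)
  (indep : independent3 P (reduced_seq Z X kappa)
     (at_index kappa Z) (at_index kappa X)) :
  let alpha := (1 - fine 'E_P[at_index kappa Z]%E)
               / fine 'E_P[at_index kappa Z]%E in
  let alpha_ge0 : 0 <= alpha :=
    @size_bias_ge0 R dO Omega P (at_index kappa Z) (fun w => Z01 w (kappa w)) in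
  let nu' := distribution P (at_index kappa X) in
  [/\ forall A : set R, measurable A ->
        distribution P (at_index kappa Z) A = beta_law 1 alpha A,
      is_dirichlet_process P (mscale (NngNum alpha_ge0) nu')
        (fun w => weighted_diracs (fun n => NngNum (itv01_ge0 (Z01 w n))) (X w)) &
      borel_space R T ->
        is_poisson_dirichlet P alpha (fun w => sum_diracs (Z w))].
Proof.
move=> alpha alpha_ge0 nu'.
have alpha0 : 0 < alpha := size_bias_alpha_gt0 P kappa Z01.
have lawV := size_bias_beta Z01 sumZ kappaZ eq_law indep alpha0 erefl.
split.
- by move=> A mA; rewrite lawV// beta_measureE.
- split.
  + have E : mscale (NngNum alpha_ge0) nu' setT = alpha%:E.
      by rewrite -[RHS]mule1 -(probability_setT nu').
    have : (0 < alpha%:E < +oo)%E by rewrite lte_fin alpha0 ltry.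
    by rewrite -E.
  + apply: measurable_smeasureP => B mB.
    rewrite (_ : (fun _ => _) = fun w => wsum B (joint_seq Z X w)); last first.
      by apply/funext => w; exact: weighted_diracs_wsum.
    exact: measurableT_comp (measurable_wsum mB) (measurable_joint_seq Z X).
  + move=> n B mB tB BT A mA.
    have := process_law Z01 sumZ kappaZ eq_law indep mB tB BT mA.
    have -> : [tuple (alpha * fine (nu' (B i)))%R | i < n.+1] =
        [tuple fine (mscale (NngNum alpha_ge0) nu' (B i)) | i < n.+1].
      apply: eq_from_tnth => i; rewrite !tnth_mktuple /mscale/= fineM//.
      by rewrite fin_num_measure.
    move=> <-; congr (P _); apply/funext => w; congr (A _).
    apply: eq_from_tnth => i; rewrite !tnth_mktuple; congr fine.
    exact: weighted_diracs_wsum.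
- move=> _; apply: (size_bias_poisson_dirichlet Z01 (sumZ_full Z01 sumZ) (measurable_sumZ Z01) (a0 := alpha0)).
  move=> K K0 mK; rewrite (integral_size_bias Z01 kappaZ eq_law indep K0 mK).
  have mI : measurable_fun setT (fun v => \int[P]_w K (v, Z w))%E.
    apply: (@measurable_fun_fubini_tonelli_F _ _ _ _ R P (fun p => K (p.1, Z p.2))) => //.
    apply: (measurableT_comp mK); apply: measurable_fun_pair; first exact: measurable_fst.
    exact: measurableT_comp (measurable_funPT Z) measurable_snd.
  have I0 v : (0 <= \int[P]_w K (v, Z w))%E by exact: integral_ge0.
  (* The inner integral depends on the outer sample point only through V, so the Beta law found for
     V can be substituted. *)
  apply: etrans (esym (ge0_integral_law _ (measurable_at_index kappa Z) I0 mI)) _.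
  by apply: eq_measure_integral => A mA _; exact: lawV.
Qed.
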